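(* Let $(M,g)$ and $(M,g')$ be space-times (on the same manifold $M$) with Levi-Civita connections $\nabla$ and $\nabla'$ respectively, and suppose $(M,g)$ is non-flat. Suppose that $(M,g)$ is of holonomy type $R_2$, $R_3$ or $R_4$ and that $\nabla$ and $\nabla'$ are projectively related. Then $\nabla=\nabla'$ on $M$.
   Context: A space-time $(M,g)$ is a 4-dimensional, Hausdorff, connected, smooth manifold $M$ with a smooth metric $g$ of Lorentz signature $(-,+,+,+)$. It is non-flat if its curvature tensor $\mathrm{Riem}$ does not vanish identically on any non-empty open subset of $M$. Projectively related: $\nabla$ and $\nabla'$ (or $g$ and $g'$) are projectively related if their sets of unparametrised geodesics (geodesic paths) coincide; equivalently there is a global smooth 1-form $\psi$ on $M$ with $\Gamma'^a_{bc}-\Gamma^a_{bc}=\delta^a_b\psi_c+\delta^a_c\psi_b$ in every coordinate domain. Bivectors: for $m\in M$ and $p,q\in T_mM$, $p\wedge q$ denotes the bivector $F^{ab}=p^aq^b-q^ap^b$, identified (using $g(m)$) with the skew-self-adjoint endomorphism $F^a{}_b=F^{ac}g_{cb}$ of $T_mM$. A null tetrad at $m$ is a basis $l,n,x,y$ of $T_mM$ whose only non-vanishing inner products are $g(l,n)=g(x,x)=g(y,y)=1$. Holonomy type: let $\phi$ be the Lie algebra of the holonomy group of $\nabla$ at a point $m\in M$, regarded as a Lie algebra of skew-self-adjoint endomorphisms (bivectors) of $T_mM$. $(M,g)$ is of holonomy type $R_2$, $R_3$, $R_4$ if, for some null tetrad $l,n,x,y$ at $m$, $\phi$ is the 1-dimensional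 algebra spanned by $l\wedge n$ (type $R_2$), by $l\wedge x$ (type $R_3$), by $x\wedge y$ (type $R_4$), respectively. (The type does not depend on the choice of $m$.) *)

(* Defs.v *)
From HB Require Import structures.
From mathcomp Require Import all_boot all_order all_algebra.
From mathcomp Require Import all_classical all_reals all_analysis.

Set Implicit Arguments.
Unset Strict Implicit.
Unset Printing Implicit Defensive.

Import Order.TTheory GRing.Theory Num.Theory.
Import numFieldNormedType.Exports.

Local Open Scope classical_set_scope.
Local Open Scope ring_scope.

(* C^k on an open set [O]: iterated directional derivatives up to order [k]
   exist and are continuous on [O]; for finite dimensional [V] this is the
   usual notion. *)
Fixpoint Ck (R : realType) (V W : normedModType R) (k : nat) (O : set V)
    (f : V -> W) : Prop :=
  (forall x, O x -> {for x, continuous f}) /\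
  match k with
  | 0 => True
  | k'.+1 => forall v : V,
      (forall x, O x -> derivable f x v) /\ Ck k' O (fun x => 'D_v f x)
  end.

Definition smooth_on (R : realType) (V W : normedModType R) (O : set V)
  (f : V -> W) : Prop := forall k, Ck k O f.

Definition basis_vec (R : realType) (b : 'I_4) : 'cV[R]_4 := delta_mx b 0.

Definition partial (R : realType) (W : normedModType R) (b : 'I_4)
  (f : 'cV[R]_4 -> W) (x : 'cV[R]_4) : W := 'D_(basis_vec R b) f x.

Definition jac (R : realType) (F : 'cV[R]_4 -> 'cV[R]_4) (x : 'cV[R]_4) :
  'M[R]_4 := \matrix_(a, b) (partial b F x) a 0.

(* A 4-dimensional smooth manifold presented by a smooth atlas.  The chart maps
   are total functions; their values off the domain are irrelevant.  Hausdorff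
   and connected are required separately in [spacetime_manifold]. *)
Record manifold4 (R : realType) := Manifold4 {
  points :> topologicalType ;
  chart : Type ;
  cdom : chart -> set points ;
  coords : chart -> points -> 'cV[R]_4 ;
  param : chart -> 'cV[R]_4 -> points ;
  cdom_open : forall i, open (cdom i) ;
  cdom_cover : forall p, exists i, cdom i p ;
  cimg_open : forall i, open (coords i @` cdom i) ;
  coordsK : forall i p, cdom i p -> param i (coords i p) = p ;
  coords_continuous : forall i p, cdom i p -> {for p, continuous (coords i)} ;
  param_continuous : forall i x, (coords i @` cdom i) x ->
    {for x, continuous (param i)} ;
  transition_smooth : forall i j,
    smooth_on (coords i @` (cdom i `&` cdom j)) (coords j \o param i)
}.

Definition cimg (R : realType) (M : manifold4 R) (i : chart M) :
  set 'cV[R]_4 := coords i @` cdom i.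

Definition transition (R : realType) (M : manifold4 R) (i j : chart M) :
  'cV[R]_4 -> 'cV[R]_4 := coords j \o param i.

Definition spacetime_manifold (R : realType) (M : manifold4 R) : Prop :=
  hausdorff_space M /\ connected [set: M].

Definition minkowski_mx (R : realType) : 'M[R]_4 :=
  diag_mx (\row_a (if a == 0 then -1 else 1)).

Definition lorentz_signature (R : realType) (G : 'M[R]_4) : Prop :=
  G^T = G /\ exists2 P, P \in unitmx & P^T *m G *m P = minkowski_mx R.

(* [metric_mx g i x] is the matrix g_ab of components in the chart [i] at the
   coordinate point [x]. *)
Record lorentz_metric (R : realType) (M : manifold4 R) := LorentzMetric {
  metric_mx :> chart M -> 'cV[R]_4 -> 'M[R]_4 ;
  metric_smooth : forall i, smooth_on (cimg i) (metric_mx i) ;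
  metric_lorentz : forall i x, cimg i x -> lorentz_signature (metric_mx i x) ;
  metric_transform : forall i j p, cdom i p -> cdom j p ->
    metric_mx i (coords i p) =
      (jac (transition i j) (coords i p))^T *m metric_mx j (coords j p)
        *m jac (transition i j) (coords i p)
}.

(* A smooth linear connection, given by its coefficients:
   [christoffel D i x a b c] is Gamma^a_{bc}, where
   nabla_{d_b} d_c = Gamma^a_{bc} d_a in the chart [i].  The last field is the
   usual inhomogeneous transformation law, with y = transition i j:
   d_b d_c y^a + Gamma'^a_{de}(y) d_b y^d d_c y^e = d_d y^a Gamma^d_{bc}. *)
Record connection (R : realType) (M : manifold4 R) := Connection {
  christoffel :> chart M -> 'cV[R]_4 -> 'I_4 -> 'I_4 -> 'I_4 -> R ;
  christoffel_smooth : forall i a b c,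
    smooth_on (cimg i) (fun x => christoffel i x a b c) ;
  christoffel_transform : forall i j p a b c, cdom i p -> cdom j p ->
    (partial b (partial c (transition i j)) (coords i p)) a 0
    + \sum_d \sum_e christoffel j (coords j p) a d e
        * jac (transition i j) (coords i p) d b
        * jac (transition i j) (coords i p) e c
    = \sum_d jac (transition i j) (coords i p) a d
        * christoffel i (coords i p) d b c
}.

Definition torsion_free (R : realType) (M : manifold4 R) (D : connection M) :
  Prop := forall i x a b c, cimg i x -> D i x a b c = D i x a c b.

Definition metric_compatible (R : realType) (M : manifold4 R)
  (g : lorentz_metric M) (D : connection M) : Prop :=
  forall i x a b c, cimg i x ->
    (partial c (g i) x) a b
    - \sum_d D i x d c a * g i x d b - \sum_d D i x d c b * g i x a d = 0.

Definition levi_civita (R : realType) (M : manifold4 R)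
  (g : lorentz_metric M) (D : connection M) : Prop :=
  torsion_free D /\ metric_compatible g D.

Definition same_connection (R : realType) (M : manifold4 R)
  (D D' : connection M) : Prop :=
  forall i x, cimg i x -> forall a b c, D i x a b c = D' i x a b c.

(* R^a_{bcd} *)
Definition riem (R : realType) (M : manifold4 R) (D : connection M)
  (i : chart M) (x : 'cV[R]_4) (a b c d : 'I_4) : R :=
  partial c (fun y => D i y a d b) x
  - partial d (fun y => D i y a c b) x
  + \sum_e (D i x a c e * D i x e d b - D i x a d e * D i x e c b).

Definition non_flat (R : realType) (M : manifold4 R) (D : connection M) :
  Prop :=
  forall O : set M, open O -> O !=set0 ->
    exists p i a b c d,
      [/\ O p, cdom i p & riem D i (coords i p) a b c d != 0].

(* The endomorphism w |-> Gamma^a_{bc} v^b w^c of the tangent space. *)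
Definition conn_mx (R : realType) (M : manifold4 R) (D : connection M)
  (i : chart M) (x v : 'cV[R]_4) : 'M[R]_4 :=
  \matrix_(a, c) \sum_b D i x a b c * v b 0.

Definition open_interval (R : realType) (I : set R) : Prop :=
  [/\ open I, is_interval I & I !=set0].

(* Affinely parametrised geodesic defined on the open interval [I]. *)
Definition geodesic (R : realType) (M : manifold4 R) (D : connection M)
  (I : set R) (c : R -> M) : Prop :=
  open_interval I /\ forall t, I t -> {for t, continuous c} /\
    forall i, cdom i (c t) ->
      let u := coords i \o c in
      [/\ derivable u t 1, derivable (derive1 u) t 1 &
          derive1 (derive1 u) t =
            - (conn_mx D i (u t) (derive1 u t) *m derive1 u t)].

(* [h] is a smooth diffeomorphism from the interval [J] onto [I]. *)
Definition reparametrisation (R : realType) (J I : set R) (h : R -> R) : Prop :=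
  [/\ smooth_on J h, forall t, J t -> derive1 h t != 0
    & h @` J = I].

(* [c], restricted to [I], is a parametrisation of a geodesic path of [D]. *)
Definition geodesic_path (R : realType) (M : manifold4 R) (D : connection M)
  (I : set R) (c : R -> M) : Prop :=
  exists J h, reparametrisation J I h /\ geodesic D J (c \o h).

Definition projectively_related (R : realType) (M : manifold4 R)
  (D D' : connection M) : Prop :=
  forall (I : set R) (c : R -> M), geodesic_path D I c <-> geodesic_path D' I c.

Definition near_unit_interval (R : realType) (e : R) : set R :=
  [set t | - e < t < 1 + e].

(* [transport D p i q j A]: [A] is the matrix, with respect to the coordinate
   bases of chart [i] at [p] and of chart [j] at [q], of the parallel transport
   T_pM -> T_qM along some piecewise smooth curve from [p] to [q].  Such a curve
   is a finite concatenation of smooth curves u : [0,1] -> M (smooth on a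
   neighbourhood of [0,1]) each lying in one coordinate domain, along which the
   transport is the value at 1 of the solution of
   X'^a_e + Gamma^a_{bc} u'^b X^c_e = 0, X(0) = 1; passing from one chart to
   another at a fixed point is the Jacobian of the transition map. *)
Inductive transport (R : realType) (M : manifold4 R) (D : connection M) :
    M -> chart M -> M -> chart M -> 'M[R]_4 -> Prop :=
  | transport_chart (p : M) (i j : chart M) :
      cdom i p -> cdom j p ->
      transport D p i p j (jac (transition i j) (coords i p))
  | transport_curve (i : chart M) (e : R) (u : R -> 'cV[R]_4)
      (X : R -> 'M[R]_4) :
      0 < e ->
      smooth_on (near_unit_interval e) u ->
      (forall t, near_unit_interval e t -> cimg i (u t)) ->
      (forall t, near_unit_interval e t ->
        is_derive t 1 X (- (conn_mx D i (u t) (derive1 u t) *m X t))) ->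
      X 0 = 1%:M ->
      transport D (param i (u 0)) i (param i (u 1)) i (X 1)
  | transport_comp (p q r : M) (i j k : chart M) (A B : 'M[R]_4) :
      transport D p i q j A -> transport D q j r k B ->
      transport D p i r k (B *m A).

(* The holonomy group at [m], acting on T_mM in the coordinates of chart [i]. *)
Definition holonomy_group (R : realType) (M : manifold4 R) (D : connection M)
  (m : M) (i : chart M) : set 'M[R]_4 := [set A | transport D m i m i A].

(* The tangent space at the identity: velocities at 0 of C^1 curves in the
   holonomy group through 1.  The holonomy group is an immersed, possibly not
   closed, Lie subgroup of GL(T_mM); a C^1 curve of matrices lying in it is also
   C^1 for its own Lie group structure, so no larger algebra (such as that of
   the closure) results. *)
Definition holonomy_algebra (R : realType) (M : manifold4 R) (D : connection M)
  (m : M) (i : chart M) : set 'M[R]_4 :=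
  [set A | exists (e : R) (c : R -> 'M[R]_4),
    [/\ 0 < e,
        Ck 1 [set t : R | - e < t < e] c,
        forall t : R, - e < t < e -> holonomy_group D m i (c t),
        c 0 = 1%:M & derive1 c 0 = A] ].

Definition inner (R : realType) (G : 'M[R]_4) (u v : 'cV[R]_4) : R :=
  (u^T *m G *m v) 0 0.

Definition null_tetrad (R : realType) (G : 'M[R]_4) (l n x y : 'cV[R]_4) :
  Prop :=
  [/\ basis_of fullv [:: l; n; x; y],
      [/\ inner G l n = 1, inner G x x = 1 & inner G y y = 1],
      [/\ inner G l l = 0, inner G n n = 0 & inner G x y = 0]
    & [/\ inner G l x = 0, inner G l y = 0, inner G n x = 0
        & inner G n y = 0]].

(* F^a_b = (p^a q^c - q^a p^c) g_cb *)
Definition wedge_mx (R : realType) (G : 'M[R]_4) (p q : 'cV[R]_4) : 'M[R]_4 :=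
  (p *m q^T - q *m p^T) *m G.

Variant holonomy_type := R2 | R3 | R4.

Definition holonomy_generator (R : realType) (T : holonomy_type) (G : 'M[R]_4)
  (l n x y : 'cV[R]_4) : 'M[R]_4 :=
  match T with
  | R2 => wedge_mx G l n
  | R3 => wedge_mx G l x
  | R4 => wedge_mx G x y
  end.

Definition of_holonomy_type (R : realType) (M : manifold4 R)
  (g : lorentz_metric M) (D : connection M) (T : holonomy_type) : Prop :=
  exists (m : M) (i : chart M) (l n x y : 'cV[R]_4),
    [/\ cdom i m, null_tetrad (g i (coords i m)) l n x y
      & holonomy_algebra D m i =
        [set k *: holonomy_generator T (g i (coords i m)) l n x y
          | k in [set: R]] ].

(* Main.v *)
Require Import Defs.
From HB Require Import structures.
From mathcomp Require Import all_boot all_order all_algebra.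
From mathcomp Require Import all_classical all_reals all_analysis.
From mathcomp Require Import ring lra.

Set Implicit Arguments.
Unset Strict Implicit.
Unset Printing Implicit Defensive.

Import Order.TTheory GRing.Theory Num.Theory.
Import numFieldNormedType.Exports.

Local Open Scope classical_set_scope.
Local Open Scope ring_scope.

(* Projective relatedness gives, by testing on geodesics in every direction, a
   covector psi with Gamma'^a_bc = Gamma^a_bc + delta^a_b psi_c + delta^a_c psi_b.
   Holonomies of small coordinate rectangles show that every linear form
   vanishing on the holonomy algebra vanishes on the curvature; hence
   R_cd = H_cd F, where F is a parallel transport of the generator of the
   holonomy algebra, and g' R'_cd is skew.  By the first Bianchi identity a
   kernel vector of F is one of H, and with
   R'_cd = R_cd + e_d Pi_c - e_c Pi_d this forces g' F to be skew wherever the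
   curvature does not vanish.  Differentiating this in a parallel frame gives
   psi(z) F z + psi(F z) z = 0 for all z, and, F being trace-free, psi = 0 on
   the dense set where the curvature does not vanish. *)

(** * Calculus of matrix-valued functions *)

(** The three types enter through what their generators share: each is nonzero, skew and singular. A
    skew matrix cannot have rank one, and this is what turns the Bianchi identity contracted with a
    kernel vector of [F] into a statement on [H]. The curvature is not itself a velocity of a curve
    of holonomies but a derivative of such velocities; a linear form vanishing on the velocities
    also vanishes on their derivative, hence the formulation by linear forms. It requires parallel
    transport to be differentiable with respect to a parameter, which is why differential equations
    are treated at length. The matrix norm is the largest absolute entry, and dimensions therefore
    appear as factors in the estimates. No parallel field extending the generator is constructed. At
    a point it is [B F B^-1] for a chosen transport [B], and near that point it is continued along
    coordinate lines by composing transports, so the dependence on paths is harmless. The change of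
    curvature also contains a multiple of the identity, the exterior derivative of psi, which is
    removed by taking traces. Agreement of the connections then spreads from a dense set by
    continuity. *)

Section MatrixCalculus.
Variable R : realType.

Lemma is_derive_mxP (V : normedModType R) m n (M : V -> 'M[R]_(m, n)) x v dM :
  is_derive x v M dM <->
  forall i j, is_derive x v (fun y => M y i j) (dM i j).
Proof.
split=> [[dMx <-] i j|dMx].
  have dij := (derivable_mxP _ _ _).1 dMx.
  by apply: DeriveDef; [exact: dij|rewrite derive_mx// mxE].
have dM1 : derivable M x v by apply/derivable_mxP => i j; have [] := dMx i j.
apply: DeriveDef => //; rewrite derive_mx//; apply/matrixP => i j; rewrite mxE.
by have [_ ->] := dMx i j.
Qed.

Lemma is_derive_ext (V W : normedModType R) (f h : V -> W) x v df dh :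
  is_derive x v f df -> f =1 h -> df = dh -> is_derive x v h dh.
Proof. by move=> H /funext <- <-. Qed.

Lemma is_derive_mulr (V : normedModType R) (f h : V -> R) x v df dh :
  is_derive x v f df -> is_derive x v h dh ->
  is_derive x v (fun y => f y * h y) (df * h x + f x * dh).
Proof.
move=> Hf Hh; have := @is_deriveM _ _ f h x v df dh Hf Hh.
by move=> H; apply: (is_derive_ext H) => //=; rewrite /GRing.scale /=; ring.
Qed.

Lemma is_derive_bigsum (V W : normedModType R) n (h : 'I_n -> V -> W) x v dh :
  (forall i, is_derive x v (h i) (dh i)) ->
  is_derive x v (fun y => \sum_i h i y) (\sum_i dh i).
Proof.
move=> H; have := @is_derive_sum _ _ _ n h x v dh H.
by move=> K; apply: (is_derive_ext K) => // y /=; rewrite fct_sumE.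
Qed.

Lemma is_derive_mulmx (V : normedModType R) m n p (A : V -> 'M[R]_(m, n))
    (B : V -> 'M[R]_(n, p)) x v dA dB :
  is_derive x v A dA -> is_derive x v B dB ->
  is_derive x v (fun y => A y *m B y) (dA *m B x + A x *m dB).
Proof.
move=> /is_derive_mxP HA /is_derive_mxP HB; apply/is_derive_mxP => i j.
have H := @is_derive_bigsum V R^o n (fun k y => A y i k * B y k j) x v _
  (fun k => is_derive_mulr (HA i k) (HB k j)).
by apply: (is_derive_ext H) => [y|]; rewrite !mxE // big_split.
Qed.

Lemma is_derive_trmx (V : normedModType R) m n (A : V -> 'M[R]_(m, n)) x v dA :
  is_derive x v A dA -> is_derive x v (fun y => (A y)^T) dA^T.
Proof.
move=> /is_derive_mxP HA; apply/is_derive_mxP => i j.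
by apply: (is_derive_ext (HA j i)) => [y|]; rewrite !mxE.
Qed.

Lemma mx_entry_le_norm m n (A : 'M[R]_(m, n)) i j : `|A i j| <= `|A|.
Proof.
rewrite [leRHS]/Num.Def.normr/= mx_normrE.
exact: (le_bigmax _ (fun k : 'I_m * 'I_n => `|A k.1 k.2|) (i, j)).
Qed.

Lemma mx_norm_le m n (A : 'M[R]_(m, n)) c :
  0 <= c -> (forall i j, `|A i j| <= c) -> `|A| <= c.
Proof.
move=> c0 H; rewrite /Num.Def.normr/= mx_normrE (bigmax_le _ c0)//= => i _.
Qed.

Lemma mx_norm_mul m n p (A : 'M[R]_(m, n)) (B : 'M[R]_(n, p)) :
  `|A *m B| <= n%:R * (`|A| * `|B|).
Proof.
apply: mx_norm_le => [|i j]; first by rewrite !mulr_ge0.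
rewrite mxE; apply: le_trans (ler_norm_sum _ _ _) _.
apply: (@le_trans _ _ (\sum_(k < n) `|A| * `|B|)).
  by apply: ler_sum => k _; rewrite normrM ler_pM// mx_entry_le_norm.
by rewrite sumr_const card_ord mulr_natl lexx.
Qed.

Lemma continuous_mxP (T : topologicalType) m n (M : T -> 'M[R]_(m, n)) x :
  {for x, continuous M} <-> forall i j, {for x, continuous (fun y => M y i j)}.
Proof.
split=> [cM i j|cM].
  apply: (@continuous_comp _ _ _ M (fun N : 'M[R]_(m, n) => N i j)) => //.
  exact: coord_continuous.
apply/cvgrPdist_le => /= e e0; near=> y.
apply: mx_norm_le => [|i j]; first exact: ltW.
move: i j; near: y; apply: filter_forall => i; apply: filter_forall => j.
by have /cvgrPdist_le/(_ e e0) := cM i j; apply: filterS => y; rewrite !mxE.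
Unshelve. all: by end_near. Qed.

Lemma continuous_bigsum (T : topologicalType) (W : normedModType R) n
    (h : 'I_n -> T -> W) x :
  (forall i, {for x, continuous (h i)}) ->
  {for x, continuous (fun y => \sum_i h i y)}.
Proof.
elim: n h => [|n IH] h ch.
  have -> : (fun y => \sum_i h i y) = cst 0.
    by apply/funext => y; rewrite big_ord0.
  exact: cvg_cst.
have -> : (fun y => \sum_i h i y) =
    (fun y => h ord0 y + \sum_i h (lift ord0 i) y).
  by apply/funext => y; rewrite big_ord_recl.
by apply: cvgD; [exact: ch|apply: IH => i; exact: ch].
Qed.

Lemma continuous_mulmx (T : topologicalType) m n p (A : T -> 'M[R]_(m, n))
    (B : T -> 'M[R]_(n, p)) x :
  {for x, continuous A} -> {for x, continuous B} ->
  {for x, continuous (fun y => A y *m B y)}.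
Proof.
move=> /continuous_mxP cA /continuous_mxP cB; apply/continuous_mxP => i j.
have -> : (fun y => (A y *m B y) i j) = (fun y => \sum_k A y i k * B y k j).
  by apply/funext => y; rewrite mxE.
apply: (@continuous_bigsum _ R^o) => k; apply: cvgM; [exact: cA|exact: cB].
Qed.

Lemma is_derive_continuous (W : normedModType R) (f : R -> W) (t : R) df :
  is_derive t 1 f df -> {for t, continuous f}.
Proof.
by move=> [df1 _]; apply/differentiable_continuous; apply/derivable1_diffP.
Qed.

(** The two difference quotients are the same function of [h]; along a line, the one-variable mean
    value theorem thus applies to directional derivatives. *)
Lemma is_derive_line (V W : normedModType R) (f : V -> W) x v (t : R) df :
  is_derive (t *: v + x) v f df ->
  is_derive t (1 : R) (fun s => f (s *: v + x)) df.
Proof.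
have E : (fun h : R => h^-1 *: ((f \o shift (t *: v + x)) (h *: v)
     - f (t *: v + x)))
  = (fun h : R => h^-1 *: (((fun s => f (s *: v + x)) \o shift t) (h *: 1)
     - f (t *: v + x))).
  by apply/funext => h /=; rewrite [h *: 1]mulr1 scalerDl addrA.
move=> [d1 d2]; apply: DeriveDef.
  by move: d1; rewrite /derivable E.
by move: d2; rewrite /derive E.
Qed.

Lemma mvt_norm (f df : R -> R) (a b : R) C :
  (forall x, Num.min a b <= x <= Num.max a b -> is_derive x 1 f (df x)) ->
  (forall x, Num.min a b <= x <= Num.max a b -> `|df x| <= C) ->
  `|f b - f a| <= C * `|b - a|.
Proof.
wlog ab : a b / a <= b => [hw|].
  case/orP: (le_total a b) => [/hw//|ba].
  rewrite minC maxC => H1 H2; rewrite distrC [`|b - a|]distrC.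
  by apply: hw.
rewrite (min_idPl ab) (max_idPr ab) => H1 H2.
have [c /itvP cab ->] : exists2 c, c \in `[a, b]%R & f b - f a = df c * (b - a).
  apply: MVT_segment => // [x /itvP xab|].
    by apply: H1; rewrite !xab.
  apply: derivable_within_continuous => x /itvP xab.
  by have [] := H1 x _; rewrite ?xab.
by rewrite normrM ler_wpM2r// H2// !cab.
Qed.

End MatrixCalculus.

Lemma continuous_near_eq (T U : topologicalType) (f h : T -> U) x :
  (\forall y \near x, f y = h y) -> {for x, continuous f} ->
  {for x, continuous h}.
Proof.
move=> fh; rewrite /prop_for /continuous_at -(nbhs_singleton fh).
by apply: cvg_trans; apply: near_eq_cvg.
Qed.

(** * Chain rule from continuous partial derivatives *)

Section ChainRule.
Variable R : realType.

Lemma is_derive_subr_lin (f : R -> R) (t c df : R) :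
  is_derive t 1 f df -> is_derive t 1 (fun s => f s - s * c) (df - c).
Proof.
move=> Hf; have H1 : is_derive t (1 : R) (fun s : R => s * c) c.
  have H := is_derive_mulr (is_derive_id t (1 : R)) (is_derive_cst c t (1 : R)).
  by apply: (is_derive_ext H) => //=; ring.
exact: (is_derive_ext (is_deriveB Hf H1)).
Qed.

(** The coordinates of [h] are switched on one at a time: [hk k] keeps the first [k] of them.
    Consecutive points differ along one axis, where the mean value inequality costs at most [e]
    times the norm of [h]. *)
Lemma C1_increment n (f : 'cV[R]_n -> R) (x : 'cV[R]_n) (r e : R) :
  (forall y (b : 'I_n), `|y - x| < r -> derivable f y (delta_mx b 0) /\
     `|'D_(delta_mx b 0) f y - 'D_(delta_mx b 0) f x| <= e) ->
  forall h, `|h| < r ->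
  `|f (x + h) - f x - \sum_b h b 0 * 'D_(delta_mx b 0) f x| <= n%:R * e * `|h|.
Proof.
move=> Hf h hr.
pose hk k : 'cV[R]_n := \col_b (if (b < k)%N then h b 0 else 0).
have H : forall k, (k <= n)%N -> `|f (x + hk k) - f x
    - \sum_(b < n | (b < k)%N) h b 0 * 'D_(delta_mx b 0) f x| <= k%:R * e * `|h|.
  elim=> [_|k IH kn].
    rewrite (_ : hk 0%N = 0) ?addr0 ?subrr ?sub0r; last first.
      by apply/matrixP => a b; rewrite !mxE.
    by rewrite big_pred0 ?oppr0 ?normr0 ?mul0r ?mulr0.
  have {IH} IH := IH (ltnW kn).
  pose kk := Ordinal kn.
  have hkS : hk k.+1 = h kk 0 *: delta_mx kk 0 + hk k.
    apply/matrixP => a b; rewrite !mxE !ord1 eqxx andbT ltnS leq_eqVlt.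
    have [->|ak] := eqVneq a kk; first by rewrite /= eqxx ltnn addr0 mulr1.
    rewrite mulr0 add0r.
    by have -> : (nat_of_ord a == k) = false by apply/negbTE; apply: contraNneq ak => ak; apply/eqP/val_inj.
  have sumS : \sum_(b < n | (b < k.+1)%N) h b 0 * 'D_(delta_mx b 0) f x =
     h kk 0 * 'D_(delta_mx kk 0) f x
     + \sum_(b < n | (b < k)%N) h b 0 * 'D_(delta_mx b 0) f x.
    rewrite (bigD1 kk) //=; congr (_ + _); apply: eq_bigl => a.
    rewrite ltnS [in RHS]ltn_neqAle andbC; congr (_ && _).
  pose g s := f (s *: delta_mx kk 0 + (x + hk k)).
  have dist s : Num.min 0 (h kk 0) <= s <= Num.max 0 (h kk 0) ->
      `|(s *: delta_mx kk 0 + (x + hk k)) - x| < r.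
    move=> sh; apply: le_lt_trans hr.
    rewrite addrCA [x + _]addrC addrK.
    have sh' : `|s| <= `|h kk 0|.
      move: sh; case: (leP 0 (h kk 0)) => h0 /andP[s1 s2].
        by rewrite !ger0_norm.
      by rewrite !ler0_norm ?lerN2 // ltW.
    apply: mx_norm_le => // a b; rewrite !mxE !ord1 eqxx andbT.
    have [->|ak] := eqVneq a kk.
      by rewrite ltnn addr0 mulr1 (le_trans sh')// mx_entry_le_norm.
    rewrite mulr0 add0r; case: ifP => _; rewrite ?normr0//.
    exact: mx_entry_le_norm.
  (* With the linear term subtracted, the derivative is the oscillation of the partial derivative,
     which is at most [e]. *)
  have := @mvt_norm R (fun s => g s - s * 'D_(delta_mx kk 0) f x)
    (fun s => 'D_(delta_mx kk 0) f (s *: delta_mx kk 0 + (x + hk k))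
              - 'D_(delta_mx kk 0) f x) 0 (h kk 0) e.
  move=> /(_ _)/wrap[].
    move=> s /dist sr; apply: is_derive_subr_lin; apply: is_derive_line.
    by apply: derivableP; have [] := Hf _ kk sr.
  move=> /(_ _)/wrap[]; first by move=> s /dist sr; have [] := Hf _ kk sr.
  rewrite mul0r !subr0 {1}/g {1}/g scale0r add0r => Hm.
  have -> : f (x + hk k.+1) - f x - \sum_(b < n | (b < k.+1)%N) h b 0 * 'D_(delta_mx b 0) f x
    = (f (h kk 0 *: delta_mx kk 0 + (x + hk k)) - h kk 0 * 'D_(delta_mx kk 0) f x
        - f (x + hk k)) + (f (x + hk k) - f x
        - \sum_(b < n | (b < k)%N) h b 0 * 'D_(delta_mx b 0) f x).
    by rewrite hkS sumS addrCA; ring.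
  apply: le_trans (ler_normD _ _) _.
  rewrite -natr1 mulrDl mul1r mulrDl addrC lerD//.
  apply: le_trans Hm _; rewrite ler_wpM2l// ?mx_entry_le_norm//.
  have [//|_] := Hf x kk _; first by rewrite subrr normr0 (le_lt_trans _ hr).
  exact: le_trans.
have := H n (leqnn n); rewrite (_ : hk n = h); last first.
  by apply/matrixP => a b; rewrite !mxE ltn_ord ord1.
by rewrite (eq_bigl predT)// => b; rewrite ltn_ord.
Qed.

Lemma differentiable_approx (V W : normedModType R) (f : V -> W)
    (df : {linear V -> W}) x :
  continuous df ->
  (forall e : R, 0 < e ->
    \forall h \near (0 : V), `|f (x + h) - f x - df h| <= e * `|h|) ->
  differentiable f x.
Proof.
move=> dc H; have key : f \o shift x = cst (f x) + df +o_ 0 id.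
  apply/eqaddoP => e /H; apply: filterS => h.
  by rewrite [x + h]addrC -addrA -opprD.
by apply/diff_locallyP; rewrite (diff_unique dc key); split.
Qed.

Lemma C1_differentiable n (f : 'cV[R]_n -> R) (O : set 'cV[R]_n) x :
  open O -> O x ->
  (forall y (b : 'I_n), O y -> derivable f y (delta_mx b 0)) ->
  (forall b : 'I_n, {for x, continuous (fun y => 'D_(delta_mx b 0) f y)}) ->
  differentiable f x.
Proof.
move=> Oop Ox Hd Hc.
pose d (h : 'cV[R]_n) : R := \sum_b h b 0 * 'D_(delta_mx b 0) f x.
have d_lin : linear d.
  move=> k u v; rewrite /d scaler_sumr -big_split /=; apply: eq_bigr => b _.
  by rewrite !mxE mulrDl -mulrA.
pose dM := GRing.isLinear.Build _ _ _ _ _ d_lin.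
pose dL : {linear _ -> _} := HB.pack d dM.
have dc : continuous dL.
  move=> y; apply: (@continuous_bigsum R _ R n
    (fun b (h : 'cV[R]_n) => h b 0 * 'D_(delta_mx b 0) f x)) => b.
  have H := @coord_continuous R n 1 b 0 y.
  exact: (cvgM H (cvg_cst _)).
apply: (differentiable_approx dc) => e e0.
  (* The [n] axes contribute one error each; the [+ 1] keeps the denominator positive when
     [n = 0]. *)
  have e1 : 0 < e / (n%:R + 1) by rewrite divr_gt0// ltr_wpDl.
  have : \forall y \near x, O y /\ forall b : 'I_n,
     `|'D_(delta_mx b 0) f y - 'D_(delta_mx b 0) f x| <= e / (n%:R + 1).
    apply: filterI; first exact: open_nbhs_nbhs.
    apply: (@filter_forall _ 'I_n (fun b y => `|'D_(delta_mx b 0) f y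
      - 'D_(delta_mx b 0) f x| <= e / (n%:R + 1)) (nbhs x)) => b; have /cvgrPdist_le/(_ _ e1) := Hc b.
    by apply: filterS => y; rewrite distrC.
  move=> /nbhs_normP[r /= r0 rO]; apply/nbhs_normP; exists r => //= h.
  rewrite /ball_ /= sub0r normrN => hr.
  have := @C1_increment n f x r (e / (n%:R + 1)) _ h hr.
  move=> /(_ _)/wrap[].
    move=> y b yr; have [Oy Hy] : O y /\ forall b : 'I_n,
     `|'D_(delta_mx b 0) f y - 'D_(delta_mx b 0) f x| <= e / (n%:R + 1).
      by apply: rO => /=; rewrite distrC.
    by split; [exact: Hd|].
  move=> H; apply: le_trans H _.
  rewrite ler_wpM2r//.
  by rewrite mulrCA ler_piMr ?(ltW e0)// ler_pdivrMr ?ltr_wpDl// mul1r lerDl.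
Qed.

(** [Ck] speaks of directional derivatives, which do not compose by themselves. Each entry is first
    shown to be Frechet differentiable, and the velocity [du] is then expanded in the standard
    basis. *)
Lemma is_derive_comp_curve n p q (f : 'cV[R]_n -> 'M[R]_(p, q))
    (O : set 'cV[R]_n) (u : R -> 'cV[R]_n) (t : R) du :
  open O -> O (u t) -> Ck 1 O f -> is_derive t 1 u du ->
  is_derive t 1 (fun s => f (u s))
    (\sum_b du b 0 *: 'D_(delta_mx b 0) f (u t)).
Proof.
move=> Oop Out [_ Hf] [du1 du2]; apply/is_derive_mxP => i j.
have dij y b : O y -> derivable (fun z => f z i j) y (delta_mx b 0).
  by move=> Oy; have [/(_ y Oy)/derivable_mxP] := Hf (delta_mx b 0).
have Dij y b : O y -> 'D_(delta_mx b 0) (fun z => f z i j) y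
    = 'D_(delta_mx b 0) f y i j.
  by move=> Oy; rewrite derive_mx ?mxE//; have [/(_ y Oy)] := Hf (delta_mx b 0).
have fd : differentiable (fun z => f z i j : R) (u t).
  apply: (@C1_differentiable n _ O) => // b.
  have [_ [/(_ _ Out)/continuous_mxP/(_ i j) Hc _]] := Hf (delta_mx b 0).
  apply: (continuous_near_eq _ Hc).
  by apply: filterS (open_nbhs_nbhs (conj Oop Out)) => z Oz; rewrite Dij.
have ud : differentiable u t by apply/derivable1_diffP.
have fud : differentiable (fun s => f (u s) i j : R) t.
  exact: (differentiable_comp ud fd).
apply: DeriveDef; first by apply/derivable1_diffP.
rewrite deriveE// (diff_comp ud fd) /=.
have -> : 'd u t 1 = du by rewrite -du2 -deriveE.
have {1}-> : du = \sum_b du b 0 *: delta_mx b 0.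
  by rewrite [LHS]matrix_sum_delta; apply: eq_bigr => b _; rewrite big_ord1.
rewrite linear_sum summxE; apply: eq_bigr => b _.
by rewrite linearZ /= mxE -Dij// deriveE.
Qed.

End ChainRule.

(** * Ordinary differential equations *)

Section Primitives.
Variable R : realType.

Lemma is_derive_reparam (W : normedModType R) (u : R -> W) (h : R -> R)
    (t dh : R) du :
  is_derive t 1 h dh -> is_derive (h t) 1 u du ->
  is_derive t 1 (fun s => u (h s)) (dh *: du).
Proof.
move=> [h1 h2] [u1 u2].
have hd : differentiable h t by apply/derivable1_diffP.
have ud : differentiable u (h t) by apply/derivable1_diffP.
have uhd : differentiable (u \o h) t by exact: differentiable_comp.
apply: DeriveDef; first by apply/derivable1_diffP.
rewrite deriveE//= -[fun s : R => _]/(u \o h) (diff_comp hd ud) /=.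
rewrite [X in 'd u (h t) X](_ : _ = dh *: 1); last first.
  by rewrite -h2 deriveE// [RHS]mulr1.
by rewrite linearZ /= -u2 deriveE.
Qed.

Lemma is_derive_affine (a b t : R) : is_derive t 1 (fun s => a * s + b) a.
Proof.
have H1 := is_derive_mulr (is_derive_cst a t (1 : R)) (is_derive_id t (1 : R)).
have H := is_deriveD H1 (is_derive_cst b t (1 : R)).
by apply: (is_derive_ext H) => //=; ring.
Qed.

Lemma primitive_on_ball (f : R -> R) (r : R) : continuous f ->
  exists F : R -> R,
    F 0 = 0 /\ forall t : R, `|t| < r -> is_derive t 1 F (f t).
Proof.
move=> cf; have [r0|r0] := leP r 0.
  by exists (cst 0); split=> // t /lt_le_trans/(_ r0); rewrite normr_lt0.
(* Starting the integral at [- r] makes every [t] in the ball an interior upper limit; subtracting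
   [G 0] afterwards normalises the primitive. *)
pose G (x : R) : R := (\int[@lebesgue_measure R]_(t in `[(- r), x]) f t)%R.
exists (fun t => G t - G 0); split; first by rewrite subrr.
move=> t; rewrite ltr_norml => /andP[rt tr].
have intf : lebesgue_measure.-integrable `[(- r), r] (EFin \o f).
  apply: continuous_compact_integrable; first exact: segment_compact.
  by apply: continuous_subspaceT => x; exact: cf.
have [dG GE] := @continuous_FTC1_closed R f (- r) t r tr intf rt (cf t).
have HG : is_derive t (1 : R) G (f t) by apply: DeriveDef => //; rewrite -derive1E.
have H := is_deriveB HG (is_derive_cst (G 0) t (1 : R)).
by apply: (is_derive_ext H) => //; rewrite subr0.
Qed.

Lemma eq_of_is_derive (F G f : R -> R) (r : R) :
  F 0 = G 0 ->
  (forall t : R, `|t| < r -> is_derive t 1 F (f t)) ->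
  (forall t : R, `|t| < r -> is_derive t 1 G (f t)) ->
  forall t, `|t| < r -> F t = G t.
Proof.
move=> FG0 HF HG t tr.
have : `|(F t - G t) - (F 0 - G 0)| <= 0 * `|t - 0|.
  apply: (@mvt_norm R (fun s => F s - G s) (fun s => f s - f s)) => s st.
    have sr : `|s| < r.
      apply: le_lt_trans tr; move: st; case: (leP 0 t) => h0 /andP[s1 s2].
        by rewrite !ger0_norm.
      by rewrite !ler0_norm ?lerN2 // ltW.
    exact: (is_deriveB (HF _ sr) (HG _ sr)).
  by rewrite subrr normr0.
by rewrite mul0r FG0 subrr subr0 normr_le0 subr_eq0 => /eqP.
Qed.

Lemma continuous_primitive (f : R -> R) : continuous f ->
  exists F : R -> R, F 0 = 0 /\ forall t : R, is_derive t 1 F (f t).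
Proof.
move=> cf.
have /choice[F HF] := fun n : nat => primitive_on_ball n.+1%:R cf.
pose tr (t : R) := Num.truncn `|t|.
exists (fun t => F (tr t) t); split; first by have [] := HF (tr 0).
(* [F n] is a primitive on the ball of radius [n.+1]. One index above [tr t] gives radius
   [(tr t).+2], enough to contain the ball of [F (tr s)] for every [s] at distance less than 1 from
   [t]. *)
move=> t; have [F0 Ft] := HF (tr t).+1.
apply: (near_eq_is_derive (f := F (tr t).+1)); last first.
  by apply: Ft; rewrite (lt_trans (truncnS_gt _))// ltr_nat.
have : \forall s \near t, `|t - s| < 1 by apply/nbhs_normP; exists 1 => //=.
apply: filterS => s ts; have [F1 Fs] := HF (tr s).
apply: (@eq_of_is_derive _ _ f (tr s).+1%:R); rewrite ?F0 ?F1//.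
  move=> x xs; apply: Ft; apply: lt_le_trans xs _; rewrite ler_nat ltnS.
  rewrite /tr truncn_le_nat; apply: (@lt_trans _ _ (`|t| + 1)).
    rewrite -{1}(subrK t s) addrC (le_lt_trans (ler_normD _ _))// ltrD2l.
    by rewrite distrC.
  by rewrite -natr1 ltrD2r truncnS_gt.
by rewrite truncnS_gt.
Qed.

Lemma continuous_primitive_mx m n (f : R -> 'M[R]_(m, n)) : continuous f ->
  exists F : R -> 'M[R]_(m, n),
    F 0 = 0 /\ forall t : R, is_derive t 1 F (f t).
Proof.
move=> cf.
have cfij (ij : 'I_m * 'I_n) : continuous (fun t => f t ij.1 ij.2).
  by move=> t; have /continuous_mxP := cf t; apply.
have /choice[F HF] := fun ij => continuous_primitive (cfij ij).
exists (fun t => \matrix_(i, j) F (i, j) t); split.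
  by apply/matrixP => i j; rewrite !mxE; have [] := HF (i, j).
move=> t; apply/is_derive_mxP => i j; have [_ H] := HF (i, j).
by apply: (is_derive_ext (H t)) => // s; rewrite mxE.
Qed.

Lemma is_derive_exp_scale (c K t : R) : K != 0 ->
  is_derive t 1 (fun s => c / K * expR (K * s)) (c * expR (K * t)).
Proof.
move=> K0; have H1 : is_derive t (1 : R) (fun s => K * s) K.
  by apply: (is_derive_ext (is_derive_affine K 0 t)) => // s; rewrite addr0.
have H2 := is_derive1_comp (is_derive_expR (K * t)) H1.
have H := is_derive_mulr (is_derive_cst (c / K) t (1 : R)) H2.
by apply: (is_derive_ext H) => //=; field.
Qed.

Lemma le_of_is_derive (v w dv dw : R -> R) (t : R) : 0 <= t ->
  (forall s : R, 0 <= s <= t -> is_derive s 1 v (dv s)) ->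
  (forall s : R, 0 <= s <= t -> is_derive s 1 w (dw s)) ->
  (forall s : R, 0 <= s <= t -> dv s <= dw s) ->
  v t - v 0 <= w t - w 0.
Proof.
move=> t0 Hv Hw Hle.
have [c /itvP ct E] : exists2 c, c \in `[0, t]%R &
    (fun s => w s - v s) t - (fun s => w s - v s) 0 = (dw c - dv c) * (t - 0).
  apply: (@MVT_segment R (fun s => w s - v s) (fun s => dw s - dv s)) => //.
    move=> s /itvP st; have st' : 0 <= s <= t by rewrite !st.
    exact: (is_deriveB (Hw _ st') (Hv _ st')).
  apply: derivable_within_continuous => s /itvP st.
  have st' : 0 <= s <= t by rewrite !st.
  by have [] := is_deriveB (Hw _ st') (Hv _ st').
have : 0 <= (dw c - dv c) * (t - 0).
  by rewrite mulr_ge0 ?subr0 ?subr_ge0 ?Hle ?ct.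
by rewrite -E /=; lra.
Qed.

(** Both [v] and [- v] are compared with [C / K * expR (K * s)], whose derivative is the given
    bound. The point is the gain of [1 / K]: integration contracts in an exponentially weighted
    norm. *)
Lemma exp_comparison_pos (v dv : R -> R) (C K t : R) :
  0 < K -> 0 <= C -> 0 <= t -> v 0 = 0 ->
  (forall s : R, 0 <= s <= t -> is_derive s 1 v (dv s)) ->
  (forall s : R, 0 <= s <= t -> `|dv s| <= C * expR (K * s)) ->
  `|v t| <= C / K * expR (K * t).
Proof.
move=> K0 C0 t0 v0 Hv Hb; have K1 : K != 0 by rewrite gt_eqF.
have CK : 0 <= C / K by rewrite divr_ge0// ltW.
rewrite ler_norml; apply/andP; split.
  have := @le_of_is_derive (fun s => - v s) _ (fun s => - dv s) _ t t0 _
    (fun s _ => @is_derive_exp_scale C K s K1).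
  move=> /(_ _)/wrap[]; first by move=> s /Hv ds; exact: is_deriveN.
  move=> /(_ _)/wrap[].
    by move=> s /Hb; rewrite ler_norml => /andP[]; rewrite lerNl.
  by rewrite v0 mulr0 expR0; lra.
have := @le_of_is_derive v _ dv _ t t0 Hv
    (fun s _ => @is_derive_exp_scale C K s K1).
move=> /(_ _)/wrap[]; first by move=> s /Hb; rewrite ler_norml => /andP[].
by rewrite v0 mulr0 expR0; lra.
Qed.

Lemma exp_comparison m n (v dv : R -> 'M[R]_(m, n)) (C K t : R) :
  0 < K -> 0 <= C -> v 0 = 0 ->
  (forall s : R, `|s| <= `|t| -> is_derive s 1 v (dv s)) ->
  (forall s : R, `|s| <= `|t| -> `|dv s| <= C * expR (K * `|s|)) ->
  `|v t| <= C / K * expR (K * `|t|).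
Proof.
move=> K0 C0 v0 Hv Hb.
apply: mx_norm_le => [|i j].
  by rewrite mulr_ge0 ?expR_ge0 ?divr_ge0// ltW.
have v0' : v 0 i j = 0 by rewrite v0 mxE.
have Hv' s : `|s| <= `|t| -> is_derive s (1 : R) (fun x => v x i j) (dv s i j).
  by move=> /Hv/is_derive_mxP.
have Hb' s : `|s| <= `|t| -> `|dv s i j| <= C * expR (K * `|s|).
  by move=> /Hb; apply: le_trans; exact: mx_entry_le_norm.
have [t0|t0] := leP 0 t.
  rewrite (ger0_norm t0).
  apply: (@exp_comparison_pos (fun x => v x i j) (fun x => dv x i j)) => //.
    by move=> s /andP[s0 st]; apply: Hv'; rewrite !ger0_norm.
  move=> s /andP[s0 st]; rewrite -{2}(ger0_norm s0).
  by apply: Hb'; rewrite !ger0_norm.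
rewrite (ltr0_norm t0).
have := @exp_comparison_pos (fun x => v (- x) i j) (fun x => - dv (- x) i j)
  C K (- t) K0 C0 _ _.
rewrite opprK; apply; [by rewrite lerNr oppr0 ltW|by rewrite oppr0| |].
  move=> s /andP[s0 st].
  have H1 : is_derive s (1 : R) (fun x : R => - x) (- 1).
    exact: (is_deriveNid s (1 : R)).
  have H2 : `|- s| <= `|t| by rewrite normrN ger0_norm// ltr0_norm.
  have := is_derive_reparam H1 (Hv' _ H2).
  by rewrite scaleN1r.
move=> s /andP[s0 st].
rewrite normrN -{2}(ger0_norm s0) -[in leRHS]normrN.
by apply: Hb'; rewrite normrN ger0_norm// ltr0_norm.
Qed.

Lemma geometric_small (D e : R) : 0 < e -> exists n : nat, D / 2 ^+ n < e.
Proof.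
move=> e0; exists (Num.truncn (D / e)).+1.
rewrite ltr_pdivrMr ?exprn_gt0// mulrC -ltr_pdivrMr//.
apply: lt_le_trans (truncnS_gt _) _.
by rewrite -natrX ler_nat ltnW// ltn_expl.
Qed.

Lemma geometric_limit (a : nat -> R) (D : R) :
  (forall n, `|a n.+1 - a n| <= D / 2 ^+ n) ->
  exists l, forall n, `|l - a n| <= 2 * D / 2 ^+ n.
Proof.
move=> Ha.
(* [2 * D / 2 ^+ n] is the sum of the tail of the series of [D / 2 ^+ k]. The intervals from [lo n]
   to [hi n] are therefore nested, and the supremum of their left ends lies in all of them. *)
pose lo n := a n - 2 * D / 2 ^+ n; pose hi n := a n + 2 * D / 2 ^+ n.
have half n : 2 * D / 2 ^+ n = 2 * D / 2 ^+ n.+1 + D / 2 ^+ n.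
  by rewrite exprS; field; rewrite expf_neq0.
have loS n : lo n <= lo n.+1.
  have := Ha n; rewrite ler_norml /lo [X in a n - X]half => /andP[]; lra.
have hiS n : hi n.+1 <= hi n.
  have := Ha n; rewrite ler_norml /hi [X in a n + X]half => /andP[]; lra.
have D0 : 0 <= D.
  by have := Ha 0%N; rewrite expr0 divr1; apply: le_trans.
have lohi n : lo n <= hi n.
  have : 0 <= 2 * D / 2 ^+ n by rewrite divr_ge0 ?mulr_ge0 ?exprn_ge0.
  by rewrite /lo /hi; lra.
have lom : {homo lo : p q / (p <= q)%N >-> p <= q}.
  by apply: homo_leq => // x y z; exact: le_trans.
have him p q : (p <= q)%N -> hi q <= hi p.
  move=> pq; have : {homo (fun n => - hi n) : p q / (p <= q)%N >-> p <= q}.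
    apply: homo_leq => [//|x y z|n]; first exact: le_trans.
    by rewrite lerN2.
  by move=> /(_ _ _ pq); rewrite lerN2.
have lohipq p q : lo p <= hi q.
  case/orP: (leq_total p q) => pq.
    by rewrite (le_trans (lom _ _ pq)).
  by rewrite (le_trans (lohi p)) ?him.
have hs : has_sup (range lo).
  split; first by exists (lo 0%N), 0%N.
  by exists (hi 0%N) => _ [p _ <-].
exists (sup (range lo)) => n; rewrite ler_norml; apply/andP; split.
  have : lo n <= sup (range lo) by apply: ub_le_sup; [case: hs|exists n].
  by rewrite /lo; lra.
have : sup (range lo) <= hi n.
  by apply: ge_sup; [case: hs|move=> _ [p _ <-]].
by rewrite /hi; lra.
Qed.

Lemma geometric_limit_mx m n (a : nat -> 'M[R]_(m, n)) (D : R) :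
  (forall k, `|a k.+1 - a k| <= D / 2 ^+ k) ->
  exists l, forall k, `|l - a k| <= 2 * D / 2 ^+ k.
Proof.
move=> Ha.
have D0 : 0 <= D.
  by have := Ha 0%N; rewrite expr0 divr1; apply: le_trans.
have Haij (ij : 'I_m * 'I_n) k :
    `|a k.+1 ij.1 ij.2 - a k ij.1 ij.2| <= D / 2 ^+ k.
  apply: le_trans (Ha k); have := mx_entry_le_norm (a k.+1 - a k) ij.1 ij.2.
  by rewrite !mxE.
have /choice[l Hl] := fun ij => geometric_limit (Haij ij).
exists (\matrix_(i, j) l (i, j)) => k; apply: mx_norm_le => [|i j].
  by rewrite divr_ge0 ?mulr_ge0 ?exprn_ge0.
by rewrite !mxE; exact: (Hl (i, j)).
Qed.

End Primitives.

(** * Picard iteration, Gronwall's inequality, linear equations on an interval *)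

Section OrdinaryDifferentialEquations.
Variable R : realType.

(* Successive Picard iterates contract by 1/2 in the weighted norm
   [sup |u t| exp(- 2 L |t|)]. *)
Lemma picard_lindelof m n (f : R -> 'M[R]_(m, n) -> 'M[R]_(m, n))
    (L B : R) (x0 : 'M[R]_(m, n)) :
  0 < L ->
  (forall t x y, `|f t x - f t y| <= L * `|x - y|) ->
  (forall u : R -> 'M[R]_(m, n), continuous u ->
     continuous (fun t => f t (u t))) ->
  (forall t, `|f t x0| <= B) ->
  exists u : R -> 'M[R]_(m, n),
    u 0 = x0 /\ forall t : R, is_derive t 1 u (f t (u t)).
Proof.
move=> L0 fL fc fB.
(* One choice of primitives serves all iterates. Its value means something only for continuous [g],
   a property that each iterate preserves. *)
have /choice[P HP] : forall g : R -> 'M[R]_(m, n), exists F,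
    continuous g -> F 0 = 0 /\ forall t : R, is_derive t 1 F (g t).
  move=> g; have [cg|ncg] := pselect (continuous g); last by exists g.
  by have [F HF] := continuous_primitive_mx cg; exists F.
pose next (u : R -> 'M[R]_(m, n)) t := x0 + P (fun s => f s (u s)) t.
have next_der u : continuous u -> forall t : R, is_derive t 1 (next u) (f t (u t)).
  move=> cu t; have [_ H] := HP _ (fc _ cu).
  have K := is_deriveD (is_derive_cst x0 t (1 : R)) (H t).
  by apply: (is_derive_ext K) => //; rewrite add0r.
have next_cont u : continuous u -> continuous (next u).
  by move=> cu t; exact: is_derive_continuous (next_der u cu t).
have next0 u : continuous u -> next u 0 = x0.
  by move=> cu; rewrite /next; have [-> _] := HP _ (fc _ cu); rewrite addr0.
pose u_ k := iter k next (cst x0).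
have uc k : continuous (u_ k).
  elim: k => [|k IH] /=; last exact: next_cont.
  by move=> t; exact: cvg_cst.
pose K := 2 * L; have K0 : 0 < K by rewrite mulr_gt0.
have B0 : 0 <= B by apply: le_trans (fB 0).
have [C CE] : exists C, C = B / K by exists (B / K).
have C0 : 0 <= C by rewrite CE divr_ge0// ltW.
pose E (t : R) : R := expR (K * `|t|).
have E1 t : 1 <= E t by rewrite -expR0 ler_expR mulr_ge0// ltW.
have comp u w (D : R) t : 0 <= D -> continuous u -> continuous w ->
    (forall s, `|f s (u s) - f s (w s)| <= D * E s) ->
    `|next u t - next w t| <= D / K * E t.
  move=> D0 cu cw H.
  apply: (@exp_comparison R m n (fun s => next u s - next w s)
    (fun s => f s (u s) - f s (w s))) => //; first by rewrite !next0// subrr.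
  by move=> s _; exact: (is_deriveB (next_der u cu s) (next_der w cw s)).
have step k t : `|u_ k.+1 t - u_ k t| <= C * E t / 2 ^+ k.
  elim: k t => [|k IH] t.
    rewrite expr0 divr1 /u_ /= CE.
    apply: (@exp_comparison R m n (fun s => next (cst x0) s - x0)
      (fun s => f s x0)) => //; first by rewrite next0 ?subrr// => ?; exact: cvg_cst.
      move=> s _; have H := is_deriveB (next_der _ (uc 0%N) s) (is_derive_cst x0 s (1 : R)).
      by apply: (is_derive_ext H) => //; rewrite subr0.
    by move=> s _; apply: le_trans (fB s) _; rewrite ler_peMr//; exact: E1.
  have D0 : 0 <= L * C / 2 ^+ k by rewrite divr_ge0 ?mulr_ge0 ?exprn_ge0 ?(ltW L0).
  have := @comp (u_ k.+1) (u_ k) _ t D0 (uc _) (uc _).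
  move=> /(_ _)/wrap[].
    move=> s; apply: le_trans (fL _ _ _) _.
    rewrite -2!mulrA ler_wpM2l ?(ltW L0)//; apply: le_trans (IH s) _.
    by rewrite le_eqVlt; apply/orP; left; apply/eqP; ring.
  move/le_trans; apply; rewrite le_eqVlt; apply/orP; left; apply/eqP.
  by rewrite /K exprS; field; rewrite expf_neq0//= gt_eqF.
have /choice[u Hu] := fun t => @geometric_limit_mx R m n (u_^~ t) _ (step^~ t).
(* The weight is at most [M] within distance 1 of [t], so the convergence is uniform there and the
   limit is continuous. *)
have ucont : continuous u.
  move=> t; apply/cvgrPdist_le => e e0.
  pose M : R := expR (K * (`|t| + 1)).
  have [k Hk] := geometric_small (2 * (C * M)) (divr_gt0 e0 (ltr0Sn R 2)).
  have := uc k t; move/cvgrPdist_le => /(_ _ (divr_gt0 e0 (ltr0Sn R 2))) N1.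
  have N2 : \forall s \near t, `|t - s| < 1.
    by apply/nbhs_normP; exists 1 => //=.
  have aux s : `|s| <= `|t| + 1 -> `|u s - u_ k s| <= e / 3.
    move=> st; apply: le_trans (Hu s k) _; apply: le_trans (ltW Hk).
    rewrite ler_wpM2r ?invr_ge0 ?exprn_ge0// ler_wpM2l// ler_wpM2l//.
    by rewrite ler_expR ler_wpM2l// ltW.
  apply: filterS2 N1 N2 => s N1 N2.
  have -> : u t - u s = (u t - u_ k t) + (u_ k t - u_ k s) + (u_ k s - u s).
    by rewrite !subrKA.
  apply: le_trans (ler_normD _ _) _.
  apply: (@le_trans _ _ (e / 3 + e / 3 + e / 3)); last by lra.
  rewrite lerD//.
    apply: le_trans (ler_normD _ _) _; rewrite lerD// aux// lerDl//.
  rewrite distrC aux// -{1}(subrK t s) addrC (le_trans (ler_normD _ _))//.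
  by rewrite lerD2l distrC ltW.
(* Both sides are close to [u_ k.+1]: the left one by the limit estimate, the right one by [comp]
   applied to [u] and [u_ k]. *)
have uE t : u t = next u t.
  apply/eqP; rewrite -subr_eq0 -normr_le0; apply/ler_addgt0Pl => e e0.
  rewrite addr0.
  have [k Hk] := geometric_small (2 * (C * E t)) e0.
  apply: le_trans (ltW Hk).
  have D0 : 0 <= L * (2 * C / 2 ^+ k).
    by rewrite mulr_ge0 ?divr_ge0 ?mulr_ge0 ?exprn_ge0 ?(ltW L0).
  have := @comp u (u_ k) _ t D0 ucont (uc _).
  move=> /(_ _)/wrap[].
    move=> s; apply: le_trans (fL _ _ _) _.
    rewrite -mulrA ler_wpM2l ?(ltW L0)//; apply: le_trans (Hu s k) _.
    by rewrite le_eqVlt; apply/orP; left; apply/eqP; ring.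
  move=> H1; have H2 := Hu t k.+1.
  have -> : u t - next u t = (u t - u_ k.+1 t) - (next u t - next (u_ k) t).
    by rewrite opprB subrKA.
  apply: le_trans (ler_normB _ _) _; apply: le_trans (lerD H2 H1) _.
  rewrite le_eqVlt; apply/orP; left; apply/eqP.
  by rewrite /K exprS; field; rewrite expf_neq0//= gt_eqF.
exists u; split; first by rewrite uE next0.
move=> t; apply: (is_derive_ext (next_der u ucont t)) => //.
Qed.

(** Let [N] be the maximum of the norm of [W s] weighted by [expR (- (2 * L * |s|))]. Integral
    comparison gives [N <= (L * N + e) / (2 * L)]; the factor 2 allows [N] to be absorbed, so that
    [N <= e / L]. *)
Lemma gronwall m n (W dW : R -> 'M[R]_(m, n)) (L e T : R) :
  0 < L -> 0 <= e -> W 0 = 0 ->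
  (forall s : R, `|s| <= T -> is_derive s 1 W (dW s)) ->
  (forall s : R, `|s| <= T -> `|dW s| <= L * `|W s| + e) ->
  forall t, `|t| <= T -> `|W t| <= e / L * expR (2 * L * `|t|).
Proof.
move=> L0 e0 W0 HW Hb t tT.
have T0 : 0 <= T by apply: le_trans tT.
pose K := 2 * L; have K0 : 0 < K by rewrite mulr_gt0.
pose h (s : R) : R := `|W s| * expR (- (K * `|s|)).
have hc s : `|s| <= T -> {for s, continuous h}.
  move=> /HW/is_derive_continuous cW; apply: cvgM.
    by apply: (@continuous_comp _ _ _ W Num.norm) => //; exact: norm_continuous.
  apply: (@continuous_comp _ _ _ (fun s => - (K * `|s|)) expR); last exact: continuous_expR.
  apply: continuousN; apply: cvgM; first exact: cvg_cst.
  exact: norm_continuous.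
have inT s : (s \in `[(- T), T]%R) = (`|s| <= T) by rewrite in_itv /= ler_norml.
have [c cT hmax] : exists2 c, c \in `[(- T), T]%R &
    forall s, s \in `[(- T), T]%R -> h s <= h c.
  apply: EVT_max; first by rewrite ge0_cp.
  by apply: continuous_in_subspaceT => s; rewrite inE /= inT => /hc.
rewrite inT in cT.
pose N := h c; have N0 : 0 <= N by rewrite mulr_ge0 ?expR_ge0.
have WN s : `|s| <= T -> `|W s| <= N * expR (K * `|s|).
  move=> sT; have := hmax s; rewrite inT => /(_ sT); rewrite -/N /h.
  by rewrite expRN ler_pdivrMr ?expR_gt0.
have bound s : `|s| <= T -> `|W s| <= (L * N + e) / K * expR (K * `|s|).
  move=> sT; apply: (@exp_comparison R m n W dW) => //.
  - by rewrite addr_ge0// mulr_ge0// ltW.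
  - by move=> s' /le_trans/(_ sT); exact: HW.
  move=> s' /le_trans/(_ sT) s'T; apply: le_trans (Hb _ s'T) _.
  rewrite mulrDl lerD//; first by rewrite -mulrA ler_wpM2l ?WN// ltW.
  by rewrite ler_peMr// -expR0 ler_expR mulr_ge0// ltW.
have : N <= (L * N + e) / K.
  by rewrite /N {1}/h expRN ler_pdivrMr ?expR_gt0 ?bound.
rewrite ler_pdivlMr // /K => HN.
have {}HN : N <= e / L by rewrite ler_pdivlMr//; lra.
apply: le_trans (WN _ tT) _; rewrite /K ler_wpM2r ?expR_ge0//.
Qed.

(** Projection onto the interval from [- r] to [r]. Composition with it extends coefficients known
    on that interval to the whole line, where the global existence theorem applies. *)
Definition clamp (r t : R) : R := Num.max (- r) (Num.min t r).

Lemma clamp_id r t : `|t| <= r -> clamp r t = t.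
Proof.
by rewrite ler_norml /clamp => /andP[h1 h2]; rewrite (min_idPl h2) (max_idPr h1).
Qed.

Lemma clamp_norm r t : 0 <= r -> `|clamp r t| <= r.
Proof.
move=> r0; rewrite /clamp ler_norml; case: (leP t r) => tr.
  by case: (leP (- r) t) => rt; rewrite ?rt ?tr//; lra.
by case: (leP (- r) r) => rt; lra.
Qed.

Lemma clamp_lipschitz r s t : `|clamp r s - clamp r t| <= `|s - t|.
Proof.
have maxl a x y : `|Num.max a x - Num.max a y| <= `|x - y| :> R.
  have := ler_norm (x - y); have := ler_norm (- (x - y)); rewrite normrN.
  set d := `|x - y|; rewrite ler_norml => h1 h2.
  by case: (leP a x) => ax; case: (leP a y) => ay; apply/andP; split; lra.
have minl a x y : `|Num.min x a - Num.min y a| <= `|x - y| :> R.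
  have := ler_norm (x - y); have := ler_norm (- (x - y)); rewrite normrN.
  set d := `|x - y|; rewrite ler_norml => h1 h2.
  by case: (leP x a) => ax; case: (leP y a) => ay; apply/andP; split; lra.
exact: le_trans (maxl _ _ _) (minl _ _ _).
Qed.

Lemma clamp_continuous r : continuous (clamp r).
Proof.
move=> t; apply/cvgrPdist_le => e e0; apply/nbhs_normP; exists e => //= s.
move=> /ltW; apply: le_trans; exact: clamp_lipschitz.
Qed.

Lemma affine_ode m n (A : R -> 'M[R]_m) (b : R -> 'M[R]_(m, n))
    (x0 : 'M[R]_(m, n)) (r C : R) :
  0 <= r ->
  (forall t : R, `|t| <= r -> {for t, continuous A}) ->
  (forall t : R, `|t| <= r -> {for t, continuous b}) ->
  (forall t : R, `|t| <= r -> `|A t| <= C) ->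
  (forall t : R, `|t| <= r -> `|b t| <= C) ->
  exists X : R -> 'M[R]_(m, n),
    X 0 = x0 /\ forall t : R, `|t| <= r -> is_derive t 1 X (A t *m X t + b t).
Proof.
move=> r0 cA cb bA bb; pose A' t := A (clamp r t); pose b' t := b (clamp r t).
have bA' t : `|A' t| <= C by apply: bA; exact: clamp_norm.
have bb' t : `|b' t| <= C by apply: bb; exact: clamp_norm.
have C0 : 0 <= C by apply: le_trans (bA' 0).
have cA' : continuous A'.
  move=> t; apply: continuous_comp; first exact: clamp_continuous.
  by apply: cA; exact: clamp_norm.
have cb' : continuous b'.
  move=> t; apply: continuous_comp; first exact: clamp_continuous.
  by apply: cb; exact: clamp_norm.
have fb t (x : 'M[R]_(m, n)) : `|A' t *m x| <= (m%:R * C + 1) * `|x|.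
  apply: le_trans (mx_norm_mul _ _) _; rewrite mulrDl mul1r ler_wpDr//.
  by rewrite -mulrA ler_wpM2l// ler_wpM2r.
(* The factor [m] comes from the norm of a matrix product, and the [+ 1] makes the Lipschitz
   constant positive. *)
have [||u cu|t|X [X0 HX]] := @picard_lindelof m n (fun t x => A' t *m x + b' t)
    (m%:R * C + 1) ((m%:R * C + 1) * `|x0| + C) x0.
- by rewrite ltr_wpDl// mulr_ge0.
- by move=> t x y; rewrite opprD addrACA subrr addr0 -mulmxBr.
- move=> t; apply: cvgD; last exact: cb'.
  by apply: continuous_mulmx; [exact: cA'|exact: cu].
- by apply: le_trans (ler_normD _ _) _; rewrite lerD.
by exists X; split=> // t tr; have := HX t; rewrite /A' /b' clamp_id.
Qed.

Lemma linear_ode m n (A : R -> 'M[R]_m) (x0 : 'M[R]_(m, n)) (r C : R) :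
  0 <= r -> (forall t : R, `|t| <= r -> {for t, continuous A}) ->
  (forall t : R, `|t| <= r -> `|A t| <= C) ->
  exists X : R -> 'M[R]_(m, n),
    X 0 = x0 /\ forall t : R, `|t| <= r -> is_derive t 1 X (A t *m X t).
Proof.
move=> r0 cA bA; have [||X [X0 HX]] := @affine_ode m n A (cst 0) x0 r C r0 cA _ bA.
- by move=> t _; exact: cvg_cst.
- by move=> t /bA; rewrite normr0; apply: le_trans.
by exists X; split=> // t /HX; rewrite addr0.
Qed.

End OrdinaryDifferentialEquations.

(** * Differentiable dependence of linear equations on a parameter *)

Section ParameterDependence.
Variable R : realType.

Lemma is_derive_quadratic (W : normedModType R) (f : R -> W) (t : R) d K :
  (\forall s \near t, `|f s - f t - (s - t) *: d| <= K * `|s - t| ^+ 2) ->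
  is_derive t 1 f d.
Proof.
move=> H; have [r0 /= r00 Hr] := (nbhs_normP _ _).1 H.
have key : (fun h : R => h^-1 *: ((f \o shift t) (h *: 1) - f t)) @ 0^' --> d.
  apply/cvgrPdist_le => e e0.
  have M0 : 0 < `|K| + 1 by rewrite ltr_wpDl.
  near=> h.
  have h0 : h != 0 by near: h; exact: nbhs_dnbhs_neq.
  have hr : `|h| < r0 by near: h; exact: dnbhs0_lt.
  have he : `|h| <= e / (`|K| + 1).
    by near: h; apply: dnbhs0_le; rewrite divr_gt0.
  have := Hr (h + t); rewrite /ball_ /= opprD addrCA subrr addr0 normrN.
  move=> /(_ hr); rewrite addrK => Hq.
  have -> : d - h^-1 *: (f (h *: 1 + t) - f t) =
      - (h^-1 *: (f (h + t) - f t - h *: d)).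
    by rewrite [h *: 1]mulr1 [in RHS]scalerBr scalerA mulVf// scale1r opprB.
  rewrite normrN normrZ normfV ler_pdivrMl ?normr_gt0//.
  apply: le_trans Hq _; rewrite expr2 mulrCA ler_wpM2l//.
  apply: (@le_trans _ _ ((`|K| + 1) * `|h|)).
    by rewrite ler_wpM2r//; have := ler_norm K; lra.
  by rewrite mulrC -ler_pdivlMr.
apply: DeriveDef; first by apply/cvg_ex; exists d.
exact: cvg_lim key.
Unshelve. all: by end_near. Qed.

Lemma lipschitz_continuous_at (W : normedModType R) (f : R -> W) (t : R) K :
  (\forall s \near t, `|f s - f t| <= K * `|s - t|) -> {for t, continuous f}.
Proof.
move=> H; apply/cvgrPdist_le => e e0.
have M0 : 0 < `|K| + 1 by rewrite ltr_wpDl.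
have : \forall s \near t, `|t - s| < e / (`|K| + 1).
  by apply/nbhs_normP; exists (e / (`|K| + 1)) => //=; rewrite divr_gt0.
apply: filterS2 H => s H1 H2; rewrite distrC; apply: le_trans H1 _.
apply: (@le_trans _ _ ((`|K| + 1) * `|s - t|)).
  by rewrite ler_wpM2r//; have := ler_norm K; lra.
by rewrite mulrC -ler_pdivlMr// distrC ltW.
Qed.

Lemma mx_norm1_le m : `|1%:M : 'M[R]_m| <= 1.
Proof. by apply: mx_norm_le => // i j; rewrite mxE; case: eqP; rewrite ?normr1 ?normr0. Qed.

(* A left inverse is found by solving the adjoint equation. *)
Lemma linear_ode_inverse m (A X : R -> 'M[R]_m) (r C : R) :
  0 < r -> (forall t : R, `|t| <= r -> {for t, continuous A}) ->
  (forall t : R, `|t| <= r -> `|A t| <= C) ->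
  X 0 = 1%:M -> (forall t : R, `|t| <= r -> is_derive t 1 X (A t *m X t)) ->
  exists Y : R -> 'M[R]_m,
    [/\ Y 0 = 1%:M,
        forall t : R, `|t| <= r -> is_derive t 1 Y (- (Y t *m A t))
      & forall t : R, `|t| < r -> Y t *m X t = 1%:M].
Proof.
move=> r0 cA bA X0 HX.
have [||Z [Z0 HZ]] := @linear_ode R m m (fun t => - (A t)^T) 1%:M r C (ltW r0).
- move=> t /cA/continuous_mxP cAt; apply: continuousN; apply/continuous_mxP => i j.
  have -> : (fun y => (A y)^T i j) = (fun y => A y j i).
    by apply/funext => y; rewrite mxE.
  exact: cAt.
- move=> t tr; rewrite normrN; apply: mx_norm_le => [|i j].
    by apply: le_trans (bA t tr).
  by rewrite mxE; apply: le_trans (bA t tr); exact: mx_entry_le_norm.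
exists (fun t => (Z t)^T); split; first by rewrite Z0 trmx1.
  move=> t tr; have H := is_derive_trmx (HZ t tr).
  by apply: (is_derive_ext H) => //; rewrite mulNmx linearN /= trmx_mul trmxK.
move=> t tr; apply/matrixP => i j.
apply: (@eq_of_is_derive R (fun s => ((Z s)^T *m X s) i j)
  (fun s => (1%:M : 'M[R]_m) i j) (fun=> 0) r) => //.
- by rewrite Z0 X0 trmx1 mulmx1.
move=> s /ltW sr; have H := is_derive_mulmx (is_derive_trmx (HZ s sr)) (HX s sr).
have := (is_derive_mxP _ _ _ _).1 H i j; move=> K; apply: (is_derive_ext K) => //.
by rewrite mulNmx linearN /= trmx_mul trmxK mulNmx mulmxA addNr mxE.
Qed.

(** [B] is the derivative of [A] in the parameter and [Z] solves the variational equation. Gronwall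
    bounds the first-order remainder of [X] quadratically in [z - y], which identifies [Z] as the
    derivative of [X]; the same method makes [Z] Lipschitz in the parameter. *)
Lemma linear_ode_param m (A B : R -> R -> 'M[R]_m) (r C : R) :
  0 < r ->
  (forall y t : R, `|y| <= r -> `|t| <= r ->
     {for t, continuous (A y)} /\ {for t, continuous (B y)}) ->
  (forall y t : R, `|y| <= r -> `|t| <= r -> `|A y t| <= C /\ `|B y t| <= C) ->
  (forall y z t : R, `|y| <= r -> `|z| <= r -> `|t| <= r ->
     [/\ `|A z t - A y t| <= C * `|z - y|, `|B z t - B y t| <= C * `|z - y|
       & `|A z t - A y t - (z - y) *: B y t| <= C * `|z - y| ^+ 2]) ->
  exists X Z : R -> R -> 'M[R]_m, forall y : R, `|y| < r ->
    [/\ X y 0 = 1%:M, Z y 0 = 0,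
       forall t : R, `|t| <= r -> is_derive t 1 (X y) (A y t *m X y t),
       forall t : R, `|t| <= r ->
         is_derive t 1 (Z y) (A y t *m Z y t + B y t *m X y t)
     & forall t : R, `|t| <= r -> is_derive y 1 (X^~ t) (Z y t)
         /\ {for y, continuous (Z^~ t)}].
Proof.
move=> r0 cAB bAB lAB; have r1 := ltW r0.
have bA y t : `|y| <= r -> `|t| <= r -> `|A y t| <= C.
  by move=> yr tr; have [] := bAB y t yr tr.
have bB y t : `|y| <= r -> `|t| <= r -> `|B y t| <= C.
  by move=> yr tr; have [] := bAB y t yr tr.
have /choice[X HX] : forall y : R, exists X : R -> 'M[R]_m, `|y| <= r ->
    X 0 = 1%:M /\ forall t : R, `|t| <= r -> is_derive t 1 X (A y t *m X t).
  move=> y; have [yr|_] := leP `|y| r; last by exists (fun=> 0).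
  have [||X HX] := @linear_ode R m m (A y) 1%:M r C r1.
  - by move=> t tr; have [] := cAB y t yr tr.
  - by move=> t; exact: bA.
  by exists X.
have C0 : 0 <= C.
  by apply: le_trans (bA 0 0 _ _) => //; rewrite normr0.
have [c cE] : exists c : R, c = m%:R * C by eexists.
have c0 : 0 <= c by rewrite cE mulr_ge0.
have [L LE] : exists L : R, L = c + 1 by eexists.
have L0 : 0 < L by rewrite LE ltr_wpDl.
have [G GE] : exists G : R, G = expR (2 * L * r) / L by eexists.
have G0 : 0 <= G by rewrite GE divr_ge0 ?expR_ge0// ltW.
have mulA n (M N : 'M[R]_m) (a b : R) : `|M| <= a -> `|N| <= b ->
    0 <= n -> m%:R * (a * b) <= n -> `|M *m N| <= n.
  move=> Ma Nb n0; apply: le_trans; apply: le_trans (mx_norm_mul _ _) _.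
  by rewrite ler_wpM2l// ler_pM.
(* All estimates below have this shape: a solution starting at 0 is at most [G] times its source. It
   remains each time to find the source. *)
have gw (W S : R -> 'M[R]_m) y e : `|y| <= r -> 0 <= e -> W 0 = 0 ->
    (forall s : R, `|s| <= r -> is_derive s 1 W (A y s *m W s + S s)) ->
    (forall s : R, `|s| <= r -> `|S s| <= e) ->
    forall t, `|t| <= r -> `|W t| <= e * G.
  move=> yr e0 W0 HW HS t tr.
  have := @gronwall R m m W (fun s => A y s *m W s + S s) L e r L0 e0 W0 HW _ t tr.
  move=> /(_ _)/wrap[].
    move=> s sr; apply: le_trans (ler_normD _ _) _; rewrite lerD ?HS//.
    apply: le_trans (mx_norm_mul _ _) _.
    apply: (@le_trans _ _ (c * `|W s|)).
      by rewrite cE -mulrA ler_wpM2l// ler_wpM2r// bA.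
    by rewrite ler_wpM2r// LE lerDl.
  move/le_trans; apply; rewrite GE mulrA [leRHS]mulrAC.
  apply: ler_wpM2l; first by rewrite divr_ge0// ltW.
  by rewrite ler_expR; apply: ler_wpM2l => //; rewrite mulr_ge0// ltW.
have [K1 K1E] : exists K1 : R, K1 = C * G + 1 by eexists.
have K10 : 0 <= K1 by rewrite K1E addr_ge0// mulr_ge0.
have bX y t : `|y| <= r -> `|t| <= r -> `|X y t| <= K1.
  move=> yr tr; have [X0 dX] := HX y yr.
  have : `|X y t - 1%:M| <= C * G.
    apply: (@gw (fun s => X y s - 1%:M) (A y) y) => //.
    - by rewrite X0 subrr.
    - move=> s sr; have H := is_deriveB (dX s sr) (is_derive_cst 1%:M s (1 : R)).
      apply: (is_derive_ext H) => //.
      by rewrite subr0 mulmxBr mulmx1 subrK.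
    by move=> s sr; exact: bA.
  move=> H; rewrite -[X y t](subrK 1%:M); apply: le_trans (ler_normD _ _) _.
  by rewrite K1E lerD// mx_norm1_le.
have bBX y t : `|y| <= r -> `|t| <= r -> `|B y t *m X y t| <= c * K1.
  move=> yr tr; apply: (mulA _ _ _ C K1); rewrite ?bB ?bX ?mulr_ge0//.
  by rewrite cE mulrA.
have /choice[Z HZ] : forall y : R, exists Z : R -> 'M[R]_m, `|y| <= r ->
    Z 0 = 0 /\ forall t : R, `|t| <= r ->
      is_derive t 1 Z (A y t *m Z t + B y t *m X y t).
  move=> y; have [yr|_] := leP `|y| r; last by exists (fun=> 0).
  have [||||Z HZ] := @affine_ode R m m (A y) (fun t => B y t *m X y t) 0 r (C + c * K1) r1.
  - by move=> t tr; have [] := cAB y t yr tr.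
  - move=> t tr; apply: continuous_mulmx; first by have [] := cAB y t yr tr.
    by have [_ /(_ t tr)/is_derive_continuous] := HX y yr.
  - by move=> t tr; rewrite ler_wpDr ?bA// mulr_ge0.
  - by move=> t tr; rewrite ler_wpDl// bBX.
  by exists Z.
have [K2 K2E] : exists K2 : R, K2 = c * K1 * G by eexists.
have K20 : 0 <= K2 by rewrite K2E !mulr_ge0.
have lX y z t : `|y| <= r -> `|z| <= r -> `|t| <= r ->
    `|X z t - X y t| <= K2 * `|z - y|.
  move=> yr zr tr; have [X0 dX] := HX y yr; have [X0' dX'] := HX z zr.
  have := @gw (fun s => X z s - X y s) (fun s => (A z s - A y s) *m X y s) z
    (c * K1 * `|z - y|) zr.
  rewrite !mulr_ge0// => /(_ isT) H.
  rewrite (_ : K2 * _ = c * K1 * `|z - y| * G); last by rewrite K2E; ring.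
  apply: H => //; first by rewrite X0 X0' subrr.
    move=> s sr; have H := is_deriveB (dX' s sr) (dX s sr).
    apply: (is_derive_ext H) => //.
    by rewrite mulmxBr mulmxBl addrA subrK.
  move=> s sr; have [h1 _ _] := lAB y z s yr zr sr.
  apply: (mulA _ _ _ _ _ h1 (bX y s yr sr)); rewrite ?mulr_ge0//.
  by rewrite cE le_eqVlt; apply/orP; left; apply/eqP; ring.
have bZ y t : `|y| <= r -> `|t| <= r -> `|Z y t| <= K2.
  move=> yr tr; have [Z0 dZ] := HZ y yr.
  rewrite K2E; apply: (@gw (Z y) (fun s => B y s *m X y s) y (c * K1)) => //.
    by rewrite mulr_ge0.
  by move=> s; exact: bBX.
pose K3 : R := c * (K1 + K2) * G.
have qX y z t : `|y| <= r -> `|z| <= r -> `|t| <= r ->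
    `|X z t - X y t - (z - y) *: Z y t| <= K3 * `|z - y| ^+ 2.
  move=> yr zr tr; have [X0 dX] := HX y yr; have [X0' dX'] := HX z zr.
  have [Z0 dZ] := HZ y yr.
  (* Both sources are quadratic in [z - y]: the first is a product of two Lipschitz differences, the
     second contains the Taylor remainder of [A]. *)
  have := @gw (fun s => X z s - X y s - (z - y) *: Z y s)
    (fun s => (A z s - A y s) *m (X z s - X y s)
       + (A z s - A y s - (z - y) *: B y s) *m X y s) y
    (c * (K1 + K2) * `|z - y| ^+ 2) yr.
  rewrite !mulr_ge0 ?addr_ge0 ?exprn_ge0// => /(_ isT) H.
  rewrite (_ : K3 * _ = c * (K1 + K2) * `|z - y| ^+ 2 * G); last by rewrite /K3; ring.
  apply: H => //; first by rewrite X0 X0' Z0 subrr scaler0 subrr.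
    move=> s sr; have H := is_deriveB (is_deriveB (dX' s sr) (dX s sr))
      (is_deriveZ (z - y) (dZ s sr)).
    apply: (is_derive_ext H) => //.
    rewrite !mulmxBl !mulmxBr -!scalemxAr -!scalemxAl scalerDr.
    move: (A z s *m _) (A z s *m _) (A y s *m _) (A y s *m _)
      (_ *: (A y s *m _)) (_ *: (B y s *m _)) => a1 a2 a3 a4 a5 a6.
    by apply/matrixP => i j; rewrite !mxE; ring.
  move=> s sr; have [h1 _ h3] := lAB y z s yr zr sr.
  rewrite (_ : c * _ * _ = c * K2 * `|z - y| ^+ 2 + c * K1 * `|z - y| ^+ 2); last by ring.
  apply: le_trans (ler_normD _ _) _; rewrite lerD//.
    apply: (mulA _ _ _ _ _ h1 (lX y z s yr zr sr)); rewrite ?mulr_ge0 ?exprn_ge0//.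
    by rewrite cE le_eqVlt; apply/orP; left; apply/eqP; ring.
  apply: (mulA _ _ _ _ _ h3 (bX y s yr sr)); rewrite ?mulr_ge0 ?exprn_ge0//.
  by rewrite cE le_eqVlt; apply/orP; left; apply/eqP; ring.
pose K4 : R := c * (K1 + 2 * K2) * G.
have lZ y z t : `|y| <= r -> `|z| <= r -> `|t| <= r ->
    `|Z z t - Z y t| <= K4 * `|z - y|.
  move=> yr zr tr; have [Z0 dZ] := HZ y yr; have [Z0' dZ'] := HZ z zr.
  have := @gw (fun s => Z z s - Z y s) (fun s => (A z s - A y s) *m Z y s
      + (B z s *m (X z s - X y s) + (B z s - B y s) *m X y s)) z
    (c * (K1 + 2 * K2) * `|z - y|) zr.
  rewrite !mulr_ge0 ?addr_ge0 ?mulr_ge0// => /(_ isT) H.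
  rewrite (_ : K4 * _ = c * (K1 + 2 * K2) * `|z - y| * G); last by rewrite /K4; ring.
  apply: H => //; first by rewrite Z0 Z0' subrr.
    move=> s sr; have H := is_deriveB (dZ' s sr) (dZ s sr).
    apply: (is_derive_ext H) => //.
    rewrite !mulmxBl !mulmxBr.
    move: (A z s *m _) (A z s *m _) (A y s *m _) (B z s *m _) (B z s *m _)
      (B y s *m _) => a1 a2 a3 a4 a5 a6.
    by apply/matrixP => i j; rewrite !mxE; ring.
  move=> s sr; have [h1 h2 _] := lAB y z s yr zr sr.
  rewrite (_ : c * _ * _ = c * K2 * `|z - y| + (c * K2 * `|z - y| + c * K1 * `|z - y|)); last by ring.
  apply: le_trans (ler_normD _ _) _; rewrite lerD//.
    apply: (mulA _ _ _ _ _ h1 (bZ y s yr sr)); rewrite ?mulr_ge0//.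
    by rewrite cE le_eqVlt; apply/orP; left; apply/eqP; ring.
  apply: le_trans (ler_normD _ _) _; rewrite lerD//.
    apply: (mulA _ _ _ _ _ (bB z s zr sr) (lX y z s yr zr sr)); rewrite ?mulr_ge0//.
    by rewrite cE le_eqVlt; apply/orP; left; apply/eqP; ring.
  apply: (mulA _ _ _ _ _ h2 (bX y s yr sr)); rewrite ?mulr_ge0//.
  by rewrite cE le_eqVlt; apply/orP; left; apply/eqP; ring.
exists X, Z => y yr; have [X0 dX] := HX y (ltW yr); have [Z0 dZ] := HZ y (ltW yr).
have ynear : \forall z \near y, `|z| <= r.
  apply/nbhs_normP; exists (r - `|y|); rewrite /= ?subr_gt0// => z /= /ltW yz.
  rewrite -[z](subrK y) (le_trans (ler_normD _ _))//.
  by rewrite -lerBrDr distrC.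
split=> // t tr; split.
  apply: (@is_derive_quadratic _ _ _ _ K3).
  by apply: filterS ynear => z zr; apply: qX => //; exact: ltW.
apply: (@lipschitz_continuous_at _ _ _ K4).
by apply: filterS ynear => z zr; apply: lZ => //; exact: ltW.
Qed.

End ParameterDependence.

(** * Parallel transport *)

Section Transport.
Variables (R : realType) (M : manifold4 R).

Lemma cimg_coords (i : chart M) p : cdom i p -> cimg i (coords i p).
Proof. by move=> ip; exists p. Qed.

Lemma paramK (i : chart M) x : cimg i x -> coords i (param i x) = x.
Proof. by move=> [p ip <-]; rewrite coordsK. Qed.

Lemma cdom_param (i : chart M) x : cimg i x -> cdom i (param i x).
Proof. by move=> [p ip <-]; rewrite coordsK. Qed.

Lemma open_cimg (i : chart M) : open (cimg i).
Proof. exact: cimg_open. Qed.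

Lemma overlap_coords (i j : chart M) x :
  (coords i @` (cdom i `&` cdom j)) x <-> cimg i x /\ cdom j (param i x).
Proof.
split=> [[p [ip jp] <-]|[ix jx]]; first by rewrite coordsK//; split=> //; exists p.
by exists (param i x); [split=> //; exact: cdom_param|exact: paramK].
Qed.

Lemma open_overlap_coords (i j : chart M) :
  open (coords i @` (cdom i `&` cdom j)).
Proof.
rewrite openE => x /overlap_coords[ix jx].
have N1 : nbhs x (cimg i) by apply: open_nbhs_nbhs; split=> //; exact: open_cimg.
have N2 : nbhs x (param i @^-1` cdom j).
  apply: (param_continuous ix); apply: open_nbhs_nbhs; split=> //.
  exact: cdom_open.
by apply: filterS2 N1 N2 => y iy jy; apply/overlap_coords.
Qed.

Lemma transition_Ck (i j : chart M) k :
  Ck k (coords i @` (cdom i `&` cdom j)) (transition i j).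
Proof. exact: transition_smooth. Qed.

Definition conn_basis (D : connection M) (i : chart M) (b : 'I_4)
  (x : 'cV[R]_4) : 'M[R]_4 := \matrix_(a, c) D i x a b c.

Lemma conn_mxE (D : connection M) (i : chart M) x v :
  conn_mx D i x v = \sum_b v b 0 *: conn_basis D i b x.
Proof.
apply/matrixP => a c; rewrite mxE summxE; apply: eq_bigr => b _.
by rewrite !mxE mulrC.
Qed.

Lemma conn_mxZ (D : connection M) (i : chart M) x k v :
  conn_mx D i x (k *: v) = k *: conn_mx D i x v.
Proof.
by rewrite !conn_mxE scaler_sumr; apply: eq_bigr => b _; rewrite mxE scalerA.
Qed.

Lemma conn_mx_basis (D : connection M) (i : chart M) x b :
  conn_mx D i x (delta_mx b 0) = conn_basis D i b x.
Proof.
rewrite conn_mxE (bigD1 b)//= big1 => [|c cb]; rewrite !mxE ?eqxx ?scale1r ?addr0//.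
by rewrite (negbTE cb) scale0r.
Qed.

Lemma conn_basis_continuous (D : connection M) (i : chart M) b x :
  cimg i x -> {for x, continuous (conn_basis D i b)}.
Proof.
move=> ix; apply/continuous_mxP => a c.
have -> : (fun y => conn_basis D i b y a c) = (fun y => D i y a b c).
  by apply/funext => y; rewrite mxE.
by have [/(_ x ix)] := christoffel_smooth D i a b c 0%N.
Qed.

Lemma conn_mx_continuous (D : connection M) (i : chart M) v x :
  cimg i x -> {for x, continuous (fun y => conn_mx D i y v)}.
Proof.
move=> ix; have -> : (fun y => conn_mx D i y v) =
    (fun y => \sum_b v b 0 *: conn_basis D i b y).
  by apply/funext => y; rewrite conn_mxE.
apply: continuous_bigsum => b.
exact: (continuousZl_tmp (conn_basis_continuous (D := D) (b := b) ix)).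
Qed.

Lemma is_derive_coord_curve (u : R -> 'cV[R]_4) (t : R) p q
    (f : 'cV[R]_4 -> 'M[R]_(p, q)) (O : set 'cV[R]_4) du :
  open O -> O (u t) -> Ck 1 O f -> is_derive t 1 u du ->
  is_derive t 1 (fun s => f (u s)) (\sum_b du b 0 *: partial b f (u t)).
Proof. exact: is_derive_comp_curve. Qed.

Lemma lorentz_unitmx (G : 'M[R]_4) : lorentz_signature G -> G \in unitmx.
Proof.
move=> [_ [P _ PG]].
have : minkowski_mx R \in unitmx.
  rewrite unitmxE det_diag unitfE; apply/prodf_neq0 => a _; rewrite mxE.
  by case: ifP => _; rewrite ?oppr_eq0 oner_eq0.
by rewrite -PG !unitmx_mul => /andP[/andP[]].
Qed.

Variables (g : lorentz_metric M) (D : connection M).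
Hypothesis gD : metric_compatible g D.

Lemma metric_unitmx i x : cimg i x -> g i x \in unitmx.
Proof. by move=> /(metric_lorentz g)/lorentz_unitmx. Qed.

Lemma metric_sym i x : cimg i x -> (g i x)^T = g i x.
Proof. by move=> /(metric_lorentz g)[]. Qed.

Lemma partial_metric i x c : cimg i x ->
  partial c (g i) x = (conn_basis D i c x)^T *m g i x + g i x *m conn_basis D i c x.
Proof.
move=> ix; apply/matrixP => a b; have := @gD i x a b c ix.
rewrite !mxE => /eqP; rewrite -addrA -opprD subr_eq0 => /eqP ->.
congr (_ + _); apply: eq_bigr => d _; rewrite !mxE// mulrC//.
Qed.

Lemma is_derive_metric_curve i (u : R -> 'cV[R]_4) (t : R) du :
  cimg i (u t) -> is_derive t 1 u du ->
  is_derive t 1 (fun s => g i (u s))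
    ((conn_mx D i (u t) du)^T *m g i (u t) + g i (u t) *m conn_mx D i (u t) du).
Proof.
move=> iu Hu.
have H := is_derive_coord_curve (@open_cimg i) iu (@metric_smooth _ _ g i 1%N) Hu.
apply: (is_derive_ext H) => //; rewrite conn_mxE linear_sum /= mulmx_suml mulmx_sumr.
rewrite -big_split /=; apply: eq_bigr => b _.
by rewrite partial_metric// scalerDr linearZ /= -scalemxAl -scalemxAr.
Qed.

(* Covariant derivative along a curve, computed in a frame [X] parallel for
   [D0]. *)
Lemma is_derive_metric_frame (D0 : connection M) i (u : R -> 'cV[R]_4)
    (X : R -> 'M[R]_4) (t : R) du :
  cimg i (u t) -> is_derive t 1 u du ->
  is_derive t 1 X (- (conn_mx D0 i (u t) du *m X t)) ->
  is_derive t 1 (fun s => (X s)^T *m g i (u s) *m X s)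
   ((X t)^T *m ((conn_mx D i (u t) du - conn_mx D0 i (u t) du)^T *m g i (u t)
      + g i (u t) *m (conn_mx D i (u t) du - conn_mx D0 i (u t) du)) *m X t).
Proof.
move=> iu Hu HX.
have H := is_derive_mulmx (is_derive_mulmx (is_derive_trmx HX)
   (is_derive_metric_curve iu Hu)) HX.
apply: (is_derive_ext H) => //.
move: (conn_mx D i _ _) (conn_mx D0 i _ _) (g i _) (X t) => N N0 G Y.
rewrite !linearN /= !linearB /= trmx_mul !mulmxDr !mulmxDl !mulmxN !mulNmx !mulmxA.
rewrite !mulmxDr !mulmxDl !mulmxN !mulNmx !mulmxA.
rewrite ?mulmxDr ?mulmxDl ?mulmxN ?mulNmx ?mulmxA.
move: (_ *m Y) (_ *m Y) (_ *m Y) (_ *m Y) => a1 a2 a3 a4.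
by rewrite addrA; apply/matrixP => k l; rewrite !mxE; ring.
Qed.

(** Along a curve, [X^T g X] is constant because its derivative involves only the difference of the
    two connections in [is_derive_metric_frame], here both [D]. Changes of chart use the
    transformation law of the metric. *)
Lemma transport_metric p i q j A : transport D p i q j A ->
  [/\ cdom i p, cdom j q & A^T *m g j (coords j q) *m A = g i (coords i p)].
Proof.
elim=> {p i q j A} [p i j ip jp|i e u X e0 su uc dX X0|
    p q r i j k A B _ [ip jq HA] _ [_ kr HB]].
- by split=> //; rewrite -metric_transform.
- have c01 t : 0 <= t <= 1 -> near_unit_interval e t.
    by rewrite /near_unit_interval /= => /andP[t0 t1]; lra.
  have c0 : cimg i (u 0) by apply/uc/c01; rewrite lexx ler01.
  have c1 : cimg i (u 1) by apply/uc/c01; rewrite lexx ler01.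
  split; [exact: cdom_param|exact: cdom_param|].
  rewrite !paramK//; apply/eqP; rewrite -subr_eq0; apply/eqP/matrixP => a b.
  rewrite [RHS]mxE; apply/eqP; rewrite -normr_le0.
  have := @mvt_norm R (fun t => ((X t)^T *m g i (u t) *m X t) a b) (fun=> 0) 0 1 0.
  rewrite (min_idPl ler01) (max_idPr ler01) mul0r X0 trmx1 mul1mx mulmx1.
  rewrite !mxE; apply; last by rewrite normr0.
  move=> t /c01 tu; have [_ /(_ 1)[/(_ t tu)/derivableP Hu _]] := su 1%N.
  have Ht := dX t tu; rewrite derive1E in Ht.
  have H := is_derive_metric_frame (uc t tu) Hu Ht.
  have := (is_derive_mxP _ _ _ _).1 H a b => K; apply: (is_derive_ext K) => //.
  by rewrite subrr trmx0 mulmx0 mul0mx addr0 mulmx0 mul0mx mxE.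
split=> //; rewrite -HA -HB trmx_mul !mulmxA//.
Qed.

Lemma transport_unitmx p i q j A : transport D p i q j A -> A \in unitmx.
Proof.
move=> /transport_metric[ip jq HA].
have := metric_unitmx (cimg_coords ip).
by rewrite -HA unitmx_mul => /andP[].
Qed.

Lemma jac_transition_unitmx (i j : chart M) p : cdom i p -> cdom j p ->
  jac (transition i j) (coords i p) \in unitmx.
Proof. by move=> ip jp; apply: transport_unitmx (transport_chart D ip jp). Qed.

Lemma jac_curve (F : 'cV[R]_4 -> 'cV[R]_4) x (du : 'cV[R]_4) :
  \sum_b du b 0 *: partial b F x = jac F x *m du.
Proof.
apply/matrixP => a c; rewrite summxE mxE; apply: eq_bigr => b _.
by rewrite !mxE mulrC !ord1.
Qed.

Lemma is_derive_line_id (x v : 'cV[R]_4) (t : R) :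
  is_derive t 1 (fun s : R => s *: v + x) v.
Proof. exact: (@is_derive_line R _ _ id x v t v). Qed.

(** The two transition maps compose to the identity near the point; this is differentiated along
    each coordinate line. *)
Lemma jac_transitionK (i j : chart M) p : cdom i p -> cdom j p ->
  jac (transition j i) (coords j p) *m jac (transition i j) (coords i p) = 1%:M.
Proof.
move=> ip jp; apply/matrixP => a b.
pose x := coords i p; pose u (s : R) : 'cV[R]_4 := s *: delta_mx b 0 + x.
have u0 : u 0 = x by rewrite /u scale0r add0r.
have Hu : is_derive (0 : R) 1 u (delta_mx b 0) by exact: is_derive_line_id.
have Ox : (coords i @` (cdom i `&` cdom j)) (u 0) by rewrite u0; exists p.
have H1 := is_derive_coord_curve (@open_overlap_coords i j) Ox
  (@transition_Ck i j 1%N) Hu.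
rewrite jac_curve in H1.
have Tx : transition i j (u 0) = coords j p by rewrite u0 /transition /= coordsK.
have Oy : (coords j @` (cdom j `&` cdom i)) (transition i j (u 0)).
  by rewrite Tx; exists p.
have H2 := is_derive_coord_curve (u := fun s => transition i j (u s))
  (@open_overlap_coords j i) Oy (@transition_Ck j i 1%N) H1.
rewrite jac_curve Tx u0 in H2.
have E : \forall s \near (0 : R), transition j i (transition i j (u s)) = u s.
  have : \forall s \near (0 : R), (coords i @` (cdom i `&` cdom j)) (u s).
    apply: (is_derive_continuous Hu); apply: open_nbhs_nbhs; split=> //.
    exact: open_overlap_coords.
  apply: filterS => s /overlap_coords[iu ju].
  by rewrite /transition /= coordsK// paramK.
have [_ H3] := near_eq_is_derive E H2; have [_ H4] := Hu.
have := H3; rewrite H4 mulmxA -colE => /matrixP/(_ a 0).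
by rewrite [X in X = _ -> _]mxE [X in _ = X -> _]mxE eqxx andbT => <-; rewrite [RHS]mxE.
Qed.

Lemma Ck_ext (V W : normedModType R) k (O : set V) (f h : V -> W) :
  open O -> (forall x, O x -> f x = h x) -> Ck k O f -> Ck k O h.
Proof.
move=> Oop; elim: k f h => [|k IH] f h fh [Hc H].
  split=> // x Ox; apply: (continuous_near_eq _ (Hc x Ox)).
  by apply: filterS (open_nbhs_nbhs (conj Oop Ox)).
split=> [x Ox|v].
  apply: (continuous_near_eq _ (Hc x Ox)).
  by apply: filterS (open_nbhs_nbhs (conj Oop Ox)).
have [H1 H2] := H v; split=> [x Ox|].
  apply: (near_eq_derivable _ (H1 x Ox)).
  by apply: filterS (open_nbhs_nbhs (conj Oop Ox)).
apply: IH H2 => x Ox; apply: near_eq_derive.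
by apply: filterS (open_nbhs_nbhs (conj Oop Ox)).
Qed.

Lemma Ck_cst (V W : normedModType R) k (O : set V) (c : W) :
  Ck k O (fun _ : V => c).
Proof.
elim: k c => [|k IH] c.
  by split=> // x _; exact: cvg_cst.
split=> [x _|v]; first exact: cvg_cst.
split=> [x _|]; first exact: derivable_cst.
have -> : (fun x : V => 'D_v (fun=> c) x) = (fun=> 0).
  by apply/funext => x; exact: derive_cst.
exact: IH.
Qed.

Lemma smooth_affine (W : normedModType R) (O : set R) (h : R) (v x : W) :
  smooth_on O (fun s => (h * s) *: v + x).
Proof.
have dl (w t : R) : is_derive t w (fun s => (h * s) *: v + x) ((h * w) *: v).
  have -> : (fun s : R => (h * s) *: v + x) = (fun s : R => s *: (h *: v) + x).
    by apply/funext => s; rewrite scalerA mulrC.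
  rewrite mulrC -scalerA.
  have H1 : is_derive t w (fun s : R => s *: (h *: v)) (w *: (h *: v)).
    have := is_diff_scalel t (h *: v); move=> [d1 d2].
    split; first exact: diff_derivable.
    by rewrite deriveE// d2.
  have H := is_deriveD H1 (is_derive_cst x t w).
  by apply: (is_derive_ext H) => //; rewrite addr0.
have cl (t : R) : {for t, continuous (fun s => (h * s) *: v + x)}.
  exact: is_derive_continuous (dl 1 t).
case=> [|k]; split=> // w; split=> [t _|]; first by have [] := dl w t.
have -> : (fun t : R => 'D_w (fun s => (h * s) *: v + x) t) = (fun=> (h * w) *: v).
  by apply/funext => t; have [] := dl w t.
exact: Ck_cst.
Qed.

End Transport.

(** * Reversal of transports, transport along segments, existence between any two points *)

Section TransportExistence.
Variables (R : realType) (M : manifold4 R).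

Lemma left_inverse_unique n (A B : 'M[R]_n) : B *m A = 1%:M -> B = invmx A.
Proof.
move=> BA; have Au : A \in unitmx by have [_] := mulmx1_unit BA.
by rewrite -[LHS]mulmx1 -(mulmxV Au) mulmxA BA mul1mx.
Qed.

Lemma growth_rate_flip (W : normedModType R) (f : R -> W) (a s w : R) :
  (fun h : R => h^-1 *: (((fun t => f (a - t)) \o shift s) (h *: w) - f (a - s)))
  = (fun h : R => h^-1 *: ((f \o shift (a - s)) (h *: (- w)) - f (a - s))).
Proof.
apply/funext => h /=; congr (_ *: (f _ - _)).
by rewrite scalerN opprD; ring.
Qed.

(** Needed to run a curve backwards. Reversal replaces the direction [w] by [- w], so the induction
    uses the hypothesis for all directions. *)
Lemma Ck_flip (W : normedModType R) k (O O' : set R) (f : R -> W) (a : R) :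
  (forall s, O' s -> O (a - s)) -> Ck k O f -> Ck k O' (fun s => f (a - s)).
Proof.
move=> HO; elim: k f => [|k IH] f [Hc H].
  split=> // s /HO/Hc cf; apply: (@continuous_comp _ _ _ (fun s => a - s) f) => //.
  by apply: cvgB; [exact: cvg_cst|exact: cvg_id].
split=> [s /HO/Hc cf|w].
  apply: (@continuous_comp _ _ _ (fun s => a - s) f) => //.
  by apply: cvgB; [exact: cvg_cst|exact: cvg_id].
have [H1 H2] := H (- w); split=> [s /HO/H1|].
  by rewrite /derivable growth_rate_flip.
have -> : (fun s : R => 'D_w (fun t => f (a - t)) s) =
    (fun s : R => (fun t => 'D_(- w) f t) (a - s)).
  by apply/funext => s; rewrite /derive growth_rate_flip.
exact: (IH _ H2).
Qed.

Lemma is_derive_flip (W : normedModType R) (f : R -> W) (a s : R) df :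
  is_derive (a - s) 1 f df -> is_derive s 1 (fun t => f (a - t)) (- df).
Proof.
move=> H; have H1 : is_derive s (1 : R) (fun t : R => a - t) (- 1).
  have K := is_deriveB (is_derive_cst a s (1 : R)) (is_derive_id s (1 : R)).
  by apply: (is_derive_ext K) => //; rewrite sub0r.
by have := is_derive_reparam H1 H; rewrite scaleN1r.
Qed.

Lemma locally_bounded (T : topologicalType) (W : normedModType R) (f : T -> W) x :
  {for x, continuous f} -> \forall y \near x, `|f y| <= `|f x| + 1.
Proof.
move=> /cvgrPdist_le/(_ 1 ltr01); apply: filterS => y fy.
rewrite -[f y](subrK (f x)) (le_trans (ler_normD _ _))// addrC lerD2l//.
by rewrite distrC.
Qed.

Lemma conn_mx_norm (D : connection M) i x v C :
  (forall b, `|conn_basis D i b x| <= C) -> `|conn_mx D i x v| <= 4 * `|v| * C.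
Proof.
move=> HC; rewrite conn_mxE; apply: le_trans (ler_norm_sum _ _ _) _.
apply: (@le_trans _ _ (\sum_(b < 4) `|v| * C)).
  apply: ler_sum => b _; rewrite normrZ ler_pM//.
  exact: mx_entry_le_norm.
by rewrite sumr_const card_ord -[leRHS]mulrA mulr_natl lexx.
Qed.

Lemma conn_locally_bounded (D : connection M) i x : cimg i x ->
  exists r C : R, 0 < r /\ forall y, `|y - x| < r ->
    cimg i y /\ forall b, `|conn_basis D i b y| <= C.
Proof.
move=> ix; pose C : R := \sum_b (`|conn_basis D i b x| + 1).
have : \forall y \near x, cimg i y /\ forall b, `|conn_basis D i b y| <= C.
  apply: filterI; first by apply: open_nbhs_nbhs; split=> //; exact: open_cimg.
  apply: (@filter_forall _ 'I_4 (fun b y => `|conn_basis D i b y| <= C) (nbhs x)) => b.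
  have := locally_bounded (conn_basis_continuous (D := D) (b := b) ix).
  apply: filterS => y H; apply: le_trans H _.
  by rewrite /C (bigD1 b)//= lerDl sumr_ge0// => c _; rewrite addr_ge0.
move=> /nbhs_normP[r /= r0 Hr]; exists r, C; split=> // y yr.
by apply: Hr; rewrite /= distrC.
Qed.

Lemma line_frame (D : connection M) i x v (r C : R) :
  0 < r ->
  (forall t, `|t| <= r -> cimg i (t *: v + x)) ->
  (forall t, `|t| <= r -> `|conn_mx D i (t *: v + x) v| <= C) ->
  exists X : R -> 'M[R]_4, X 0 = 1%:M /\ forall t : R, `|t| <= r ->
    is_derive t 1 X (- (conn_mx D i (t *: v + x) v *m X t)).
Proof.
move=> r0 Hc Hb.
have [||X [X0 HX]] := @linear_ode R 4 4 (fun t => - conn_mx D i (t *: v + x) v)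
    1%:M r C (ltW r0).
- move=> t tr; apply: continuousN.
  apply: (@continuous_comp _ _ _ (fun t : R => t *: v + x) (fun y => conn_mx D i y v)).
    exact: is_derive_continuous (is_derive_line_id x v t).
  by apply: conn_mx_continuous; exact: Hc.
- by move=> t tr; rewrite normrN; exact: Hb.
by exists X; split=> // t tr; have := HX t tr; rewrite mulNmx.
Qed.

Lemma line_transport (D : connection M) i x v (r : R) (X : R -> 'M[R]_4) :
  (forall t, `|t| <= r -> cimg i (t *: v + x)) -> X 0 = 1%:M ->
  (forall t : R, `|t| <= r ->
    is_derive t 1 X (- (conn_mx D i (t *: v + x) v *m X t))) ->
  forall t, `|t| < r -> transport D (param i x) i (param i (t *: v + x)) i (X t).
Proof.
move=> Hc X0 HX t tr; have r0 : 0 < r by apply: le_lt_trans tr.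
(* [transport_curve] wants the unit interval with a margin. The segment is run at speed [t], and
   this margin gives [|t| * (1 + e) <= r], so the curve stays where the frame is defined. *)
pose e := (r - `|t|) / r; have e0 : 0 < e by rewrite divr_gt0 ?subr_gt0.
have te s : near_unit_interval e s -> `|t * s| <= r.
  rewrite /near_unit_interval /= => /andP[s1 s2].
  have : `|s| <= 1 + e by rewrite ler_norml; lra.
  move=> se; rewrite normrM; apply: (@le_trans _ _ (`|t| * (1 + e))).
    by rewrite ler_wpM2l.
  have re : r * e = r - `|t| by rewrite /e; field; rewrite gt_eqF.
  have : `|t| * e <= r * e by rewrite ler_wpM2r// ltW// ltW.
  by rewrite re; lra.
have := @transport_curve R M D i e (fun s => (t * s) *: v + x) (fun s => X (t * s)) e0.
rewrite mulr0 mulr1 scale0r add0r; apply=> //.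
- exact: smooth_affine.
- by move=> s /te; exact: Hc.
move=> s /te ts.
have H1 : is_derive s (1 : R) (fun s => t * s) t.
  by apply: (is_derive_ext (is_derive_affine t 0 s)) => // y; rewrite addr0.
have -> : derive1 (fun s => (t * s) *: v + x) s = t *: v.
  have H := is_derive_reparam H1 (is_derive_line_id x v (t * s)).
  by rewrite derive1E; have [_ ->] := H.
have := is_derive_reparam H1 (HX _ ts).
by rewrite conn_mxZ -scalemxAl scalerN.
Qed.

Variables (g : lorentz_metric M) (D : connection M).
Hypothesis gD : metric_compatible g D.

(** A chart change is undone by the opposite one and a curve by its reversal. Preservation of the
    nondegenerate metric makes the matrices invertible. *)
Lemma transport_inv p i q j A :
  transport D p i q j A -> transport D q j p i (invmx A).
Proof.
elim=> {p i q j A} [p i j ip jp|i e u X e0 su uc dX X0|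
    p q r i j k A B TA IA TB IB].
- rewrite -(left_inverse_unique (jac_transitionK ip jp)).
  exact: transport_chart.
- have flip t : near_unit_interval e t -> near_unit_interval e (1 - t).
    by rewrite /near_unit_interval /= => /andP[h1 h2]; lra.
  have Xu : X 1 \in unitmx.
    exact: (transport_unitmx gD (@transport_curve R M D i e u X e0 su uc dX X0)).
  (* Along the reversed curve, right multiplication by [invmx (X 1)] normalises the reversed frame
     to the identity at its start. *)
  have := @transport_curve R M D i e (fun s => u (1 - s))
    (fun s => X (1 - s) *m invmx (X 1)) e0.
  rewrite subr0 subrr X0 mul1mx; apply.
  + by move=> k; apply: Ck_flip (su k).
  + by move=> t /flip; exact: uc.
  + move=> t /flip tu; have [_ /(_ 1)[/(_ _ tu)/derivableP Hu _]] := su 1%N.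
    have := dX _ tu; rewrite derive1E => dXt.
    have -> : derive1 (fun s => u (1 - s)) t = (- 1) *: 'D_1 u (1 - t).
      by rewrite derive1E; have [_ ->] := is_derive_flip Hu; rewrite scaleN1r.
    rewrite conn_mxZ -scalemxAl scaleN1r opprK.
    have H := is_derive_mulmx (is_derive_flip dXt)
      (is_derive_cst (invmx (X 1)) t (1 : R)).
    by apply: (is_derive_ext H) => //; rewrite mulmx0 addr0 opprK mulmxA.
  + by rewrite mulmxV.
have Au := transport_unitmx gD TA; have Bu := transport_unitmx gD TB.
have -> : invmx (B *m A) = invmx A *m invmx B.
  apply/esym/left_inverse_unique.
  by rewrite mulmxA -[_ *m invmx B *m B]mulmxA mulVmx// mulmx1 mulVmx.
exact: transport_comp IB IA.
Qed.

Lemma local_transport p : exists2 i, cdom i p &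
  \forall q \near p, exists A, transport D p i q i A.
Proof.
have [i ip] := cdom_cover p; exists i => //; pose x := coords i p.
have [r [C [r0 Hr]]] := conn_locally_bounded D (cimg_coords ip).
have N1 : \forall q \near p, cdom i q.
  by apply: open_nbhs_nbhs; split=> //; exact: cdom_open.
have N2 : \forall q \near p, `|x - coords i q| < r / 2.
  have N0 : \forall y \near x, `|x - y| < r / 2.
    by apply/nbhs_normP; exists (r / 2) => //=; rewrite divr_gt0.
  exact: (coords_continuous ip N0).
apply: filterS2 N1 N2 => q iq xq; pose v := coords i q - x.
(* Any bound above 1 would leave room beyond the endpoint [t = 1]; with [v] shorter than [r / 2],
   the bound 3/2 keeps the segment within [3 r / 4] of [x]. *)
have tv t : `|t| <= 3 / 2 -> `|(t *: v + x) - x| < r.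
  move=> tr; rewrite addrK normrZ; apply: (@le_lt_trans _ _ (3 / 2 * `|v|)).
    by rewrite ler_wpM2r.
  have : `|v| < r / 2 by rewrite /v distrC.
  by lra.
have [|||X [X0 HX]] := @line_frame D i x v (3 / 2) (4 * `|v| * C).
- by lra.
- by move=> t /tv/Hr[].
- by move=> t /tv/Hr[_]; exact: conn_mx_norm.
exists (X 1); have := @line_transport D i x v (3 / 2) X _ X0 HX 1.
rewrite normr1 scale1r subrK !coordsK//; apply; last by lra.
by move=> t /tv/Hr[].
Qed.

(** The points reachable from [m] form a nonempty set that is open and closed, hence everything by
    connectedness. *)
Lemma transport_exists (m : M) i p j : connected [set: M] ->
  cdom i m -> cdom j p -> exists A, transport D m i p j A.
Proof.
move=> conM im jp.
pose S := [set q | exists k A, transport D m i q k A].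
suff : S = setT.
  move=> /seteqP[_ /(_ p I)[k [A TA]]].
  have [_ kp _] := transport_metric gD TA.
  by exists (jac (transition k j) (coords k p) *m A); apply: transport_comp TA _;
    exact: transport_chart.
have Sop : open S.
  rewrite openE => q [k [A TA]]; have [l lq] := local_transport q.
  apply: filterS => q' [B TB]; exists l, (B *m (jac (transition k l) (coords k q) *m A)).
  have [_ kq _] := transport_metric gD TA.
  by apply: transport_comp TB; apply: transport_comp TA _; exact: transport_chart.
apply: conM.
- exists m, i, (jac (transition i i) (coords i m)).
  exact: transport_chart.
- by exists S; rewrite ?setTI.
(* For closedness, a reachable point near [q] would make [q] reachable by reversing the local
   transport. *)
exists S; rewrite ?setTI// -openC openE => q nSq.
have [l lq] := local_transport q; apply: filterS => q' [B TB] [k [A TA]].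
have [_ kq' _] := transport_metric gD TA; have [_ lq' _] := transport_metric gD TB.
apply: nSq; exists l, (invmx B *m (jac (transition k l) (coords k q') *m A)).
apply: transport_comp (transport_inv TB).
by apply: transport_comp TA _; exact: transport_chart.
Qed.

End TransportExistence.

(** * Curvature and holonomy *)

Section Curvature.
Variables (R : realType) (M : manifold4 R).

Definition riem_mx (D : connection M) (i : chart M) (x : 'cV[R]_4)
  (c d : 'I_4) : 'M[R]_4 := \matrix_(a, b) riem D i x a b c d.

Definition partial_conn (D : connection M) (i : chart M) (c d : 'I_4)
  (x : 'cV[R]_4) : 'M[R]_4 := \matrix_(a, b) partial c (fun y => D i y a d b) x.

Lemma riem_mxE (D : connection M) i x c d :
  riem_mx D i x c d = partial_conn D i c d x - partial_conn D i d c x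
    + (conn_basis D i c x *m conn_basis D i d x
       - conn_basis D i d x *m conn_basis D i c x).
Proof.
apply/matrixP => a b; rewrite !mxE /riem; congr (_ + _).
by rewrite sumrB; congr (_ - _); apply: eq_bigr => e _; rewrite !mxE.
Qed.

Lemma partial_conn_continuous (D : connection M) i c d x :
  cimg i x -> {for x, continuous (partial_conn D i c d)}.
Proof.
move=> ix; apply/continuous_mxP => a b.
have -> : (fun y => partial_conn D i c d y a b) =
    (fun y => 'D_(basis_vec R c) (fun y => D i y a d b) y).
  by apply/funext => y; rewrite mxE.
have [_ /(_ (basis_vec R c))[_ [H _]]] := christoffel_smooth D i a d b 1%N.
exact: H.
Qed.

Lemma riem_mx_continuous (D : connection M) i c d x :
  cimg i x -> {for x, continuous (fun y => riem_mx D i y c d)}.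
Proof.
move=> ix; have -> : (fun y => riem_mx D i y c d) =
    (fun y => partial_conn D i c d y - partial_conn D i d c y
    + (conn_basis D i c y *m conn_basis D i d y
       - conn_basis D i d y *m conn_basis D i c y)).
  by apply/funext => y; rewrite riem_mxE.
have h1 a b := partial_conn_continuous (D := D) (c := a) (d := b) ix.
have h2 a := conn_basis_continuous (D := D) (b := a) ix.
exact: (continuousD (continuousB (h1 c d) (h1 d c))
  (continuousB (continuous_mulmx (h2 c) (h2 d)) (continuous_mulmx (h2 d) (h2 c)))).
Qed.

Lemma is_derive_linear_form m n (l : 'M[R]_(m, n) -> R) (A : R -> 'M[R]_(m, n))
    (t : R) dA :
  (forall a A B, l (a *: A + B) = a * l A + l B) ->
  is_derive t 1 A dA -> is_derive t 1 (fun s => l (A s)) (l dA).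
Proof.
move=> lin HA.
have l0 : l 0 = 0.
  by have := lin (-1) 0 0; rewrite scaler0 addr0; lra.
have lD A1 B1 : l (A1 + B1) = l A1 + l B1.
  by have := lin 1 A1 B1; rewrite scale1r mul1r.
have lsum I s (F : I -> 'M[R]_(m, n)) : l (\sum_(i <- s) F i) = \sum_(i <- s) l (F i).
  by elim: s => [|x s IH]; rewrite ?big_nil// !big_cons lD IH.
have lE A1 : l A1 = \sum_i \sum_j A1 i j * l (delta_mx i j).
  rewrite {1}(matrix_sum_delta A1) lsum; apply: eq_bigr => i _.
  rewrite lsum; apply: eq_bigr => j _.
  by rewrite -[_ *: _]addr0 lin l0 addr0.
have H : is_derive t 1 (fun s => \sum_i \sum_j A s i j * l (delta_mx i j))
   (\sum_i \sum_j dA i j * l (delta_mx i j)).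
  apply: (@is_derive_bigsum R _ R) => i; apply: (@is_derive_bigsum R _ R) => j.
  have K := is_derive_mulr ((is_derive_mxP _ _ _ _).1 HA i j)
    (is_derive_cst (l (delta_mx i j)) t (1 : R)).
  by apply: (is_derive_ext K) => //; rewrite mulr0 addr0.
by apply: (is_derive_ext H) => // s; rewrite lE.
Qed.

(** [Ck] asks for derivatives in every direction [w]; on the line these are [w] times the ordinary
    derivative. *)
Lemma Ck1_curve (W : normedModType R) (O : set R) (f df : R -> W) :
  open O -> (forall t : R, O t -> is_derive t 1 f (df t)) ->
  (forall t, O t -> {for t, continuous df}) -> Ck 1 O f.
Proof.
move=> Oop Hf Hc; split=> [t /Hf/is_derive_continuous//|w].
have dw t : O t -> is_derive t w f (w *: df t).
  move=> /Hf[f1 f2]; have fd : differentiable f t by apply/derivable1_diffP.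
  split; first exact: diff_derivable.
  rewrite deriveE// -f2 deriveE//.
  by rewrite -{1}[w]mulr1 -[w * 1]/(w *: (1 : R)) linearZ.
split=> [t /dw[]//|]; split=> // t Ot.
have cw := continuousZl_tmp (k := w) (Hc t Ot).
apply: (continuous_near_eq _ cw).
apply: filterS (open_nbhs_nbhs (conj Oop Ot)) => s Os.
by have [_ ->] := dw s Os.
Qed.

(** These are the three estimates that [linear_ode_param] demands of its coefficients. The last
    applies the mean value inequality to [f] minus its linear part, whose derivative is bounded by
    the second estimate. *)
Lemma taylor_line (f : 'cV[R]_4 -> R) (x v : 'cV[R]_4) (y z C : R) :
  (forall s, Num.min y z <= s <= Num.max y z ->
     [/\ derivable f (s *: v + x) v, derivable ('D_v f) (s *: v + x) v,
         `|'D_v f (s *: v + x)| <= C & `|'D_v ('D_v f) (s *: v + x)| <= C]) ->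
  [/\ `|f (z *: v + x) - f (y *: v + x)| <= C * `|z - y|,
      `|'D_v f (z *: v + x) - 'D_v f (y *: v + x)| <= C * `|z - y|
    & `|f (z *: v + x) - f (y *: v + x) - (z - y) * 'D_v f (y *: v + x)|
       <= C * `|z - y| ^+ 2].
Proof.
move=> H.
have d1 s : Num.min y z <= s <= Num.max y z ->
    is_derive s 1 (fun s => f (s *: v + x)) ('D_v f (s *: v + x)).
  by move=> /H[h _ _ _]; apply: is_derive_line; exact: derivableP.
have d2 s : Num.min y z <= s <= Num.max y z ->
    is_derive s 1 (fun s => 'D_v f (s *: v + x)) ('D_v ('D_v f) (s *: v + x)).
  by move=> /H[_ h _ _]; exact: (@is_derive_line R _ _ ('D_v f) x v s _ (derivableP h)).
have b s : Num.min y z <= s <= Num.max y z -> Num.min y s >= Num.min y z /\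
   Num.max y s <= Num.max y z.
  by case: (leP y z) => yz; case: (leP y s) => ys /andP[h1 h2]; split; lra.
split.
- by apply: (@mvt_norm R (fun s => f (s *: v + x))) d1 _ => s /H[].
- by apply: (@mvt_norm R (fun s => 'D_v f (s *: v + x))) d2 _ => s /H[].
have -> : f (z *: v + x) - f (y *: v + x) - (z - y) * 'D_v f (y *: v + x) =
    (f (z *: v + x) - z * 'D_v f (y *: v + x)) -
    (f (y *: v + x) - y * 'D_v f (y *: v + x)) by ring.
rewrite expr2 mulrA.
apply: (@mvt_norm R (fun s => f (s *: v + x) - s * 'D_v f (y *: v + x))
  (fun s => 'D_v f (s *: v + x) - 'D_v f (y *: v + x))).
  by move=> s /d1; exact: is_derive_subr_lin.
move=> s sI; have [bs1 bs2] := b s sI.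
have sI' s' : Num.min y s <= s' <= Num.max y s -> Num.min y z <= s' <= Num.max y z.
  by move=> /andP[h1 h2]; rewrite (le_trans bs1 h1) (le_trans h2 bs2).
apply: (@le_trans _ _ (C * `|s - y|)).
  apply: (@mvt_norm R (fun s => 'D_v f (s *: v + x))
    (fun s => 'D_v ('D_v f) (s *: v + x))).
    by move=> s' /sI'; exact: d2.
  by move=> s' /sI'/H[].
have C0 : 0 <= C by have [_ _ + _] := H s sI; apply: le_trans.
rewrite ler_wpM2l//; move: sI; case: (leP y z) => yz /andP[h1 h2].
  by rewrite !ger0_norm; lra.
by rewrite !ler0_norm; lra.
Qed.

End Curvature.

(** * Curvature as the second-order holonomy of small rectangles *)

Section HolonomyCurvature.
Variables (R : realType) (M : manifold4 R).
Variables (g : lorentz_metric M) (D : connection M).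
Hypothesis gD : metric_compatible g D.

(** The pure second derivative in direction [d] controls the Taylor remainder of the
    [c]-coefficients when a side parallel to [c] is moved in direction [d]. *)
Let second_partial i c d (x : 'cV[R]_4) : 'M[R]_4 :=
  \matrix_(a, b) partial d (partial d (fun y => D i y a c b)) x.

Let second_partial_continuous i c d x :
  cimg i x -> {for x, continuous (second_partial i c d)}.
Proof.
move=> ix; apply/continuous_mxP => a b.
have -> : (fun y => second_partial i c d y a b) =
    (fun y => 'D_(basis_vec R d) ('D_(basis_vec R d) (fun y => D i y a c b)) y).
  by apply/funext => y; rewrite mxE.
have [_ /(_ (basis_vec R d))[_ [_ /(_ (basis_vec R d))[_ [H _]]]]] :=
  christoffel_smooth D i a c b 2%N.
exact: H.
Qed.

Let jet_bounded i c d x : cimg i x -> exists r C : R, 0 < r /\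
  forall y, `|y - x| < r -> [/\ cimg i y, forall b, `|conn_basis D i b y| <= C,
    `|partial_conn D i d c y| <= C & `|second_partial i c d y| <= C].
Proof.
move=> ix; have [r1 [C1 [r10 H1]]] := conn_locally_bounded D ix.
pose C2 := `|partial_conn D i d c x| + 1; pose C3 := `|second_partial i c d x| + 1.
have C10 : 0 <= C1.
  have x1 : `|x - x| < r1 by rewrite subrr normr0.
  by have [_ /(_ 0)] := H1 x x1; apply: le_trans.
have [h2 h3] : 0 <= C2 /\ 0 <= C3 by split; rewrite addr_ge0.
have N : \forall y \near x, `|partial_conn D i d c y| <= C2
    /\ `|second_partial i c d y| <= C3.
  have n1 := locally_bounded (partial_conn_continuous (D := D) (c := d) (d := c) ix).
  have n2 := locally_bounded (second_partial_continuous (c := c) (d := d) ix).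
  by apply: filterS2 n1 n2.
have [r2 /= r20 H2] := (nbhs_normP _ _).1 N.
exists (Num.min r1 r2), (C1 + C2 + C3); split; first by rewrite lt_min r10.
move=> y; rewrite lt_min => /andP[y1 y2]; have [iy yC] := H1 y y1.
have [k2 k3] : `|partial_conn D i d c y| <= C2 /\ `|second_partial i c d y| <= C3.
  by apply: H2; rewrite /= distrC.
split=> // [b||]; last by lra.
  by have := yC b; lra.
by lra.
Qed.

Lemma delta_mx_norm_le (b : 'I_4) : `|delta_mx b 0 : 'cV[R]_4| <= 1.
Proof.
by apply: mx_norm_le => // i j; rewrite mxE; case: (_ && _); rewrite ?normr1 ?normr0.
Qed.

(* The holonomy of the coordinate rectangle with sides [s] and [t], as a curve
   in [t], has velocity [A s] at [t = 0], and [A] has derivative the curvature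
   at [s = 0]. *)
Lemma holonomy_curvature p j c d (l : 'M[R]_4 -> R) :
  cdom j p -> (forall a A B, l (a *: A + B) = a * l A + l B) ->
  (forall A, holonomy_algebra D p j A -> l A = 0) ->
  l (riem_mx D j (coords j p) c d) = 0.
Proof.
move=> jp lin lhol; pose x0 := coords j p.
pose ec : 'cV[R]_4 := delta_mx c 0; pose ed : 'cV[R]_4 := delta_mx d 0.
pose pt (x y : R) : 'cV[R]_4 := y *: ed + (x *: ec + x0).
have ptE x y : pt x y = x *: ec + (y *: ed + x0) by rewrite /pt addrCA.
have [r' [C [r'0 Hjet]]] := jet_bounded c d (cimg_coords jp).
(* Two sides of length at most [r] move a point by at most [r' / 2], strictly inside the ball of
   bounded coefficients. *)
pose r := r' / 4; have r0 : 0 < r by rewrite divr_gt0.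
have near_pt x y : `|x| <= r -> `|y| <= r -> `|pt x y - x0| < r'.
  move=> xr yr; rewrite /pt addrA addrK.
  apply: le_lt_trans (ler_normD _ _) _; rewrite !normrZ.
  have h1 : `|y| * `|ed| <= r by rewrite -[leRHS]mulr1 ler_pM// delta_mx_norm_le.
  have h2 : `|x| * `|ec| <= r by rewrite -[leRHS]mulr1 ler_pM// delta_mx_norm_le.
  by move: h1 h2 r'0; rewrite /r; lra.
have Hpt x y : `|x| <= r -> `|y| <= r -> [/\ cimg j (pt x y),
    forall b, `|conn_basis D j b (pt x y)| <= C, `|partial_conn D j d c (pt x y)| <= C
    & `|second_partial j c d (pt x y)| <= C].
  by move=> xr yr; apply: Hjet; exact: near_pt.
have n0 : `|0 : R| <= r by rewrite normr0 ltW.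
have n0' : `|0 : R| < r by rewrite normr0.
have C0 : 0 <= C by have [_ /(_ 0) + _ _] := Hpt 0 0 n0 n0; apply: le_trans.
have cpt_x y t (W : normedModType R) (f : 'cV[R]_4 -> W) :
    {for pt t y, continuous f} -> {for t, continuous (fun s => f (pt s y))}.
  move=> cf; apply: (@continuous_comp _ _ _ (fun s => pt s y) f); last exact: cf.
  have -> : (fun s => pt s y) = (fun s => s *: ec + (y *: ed + x0)).
    by apply/funext => s; rewrite ptE.
  exact: is_derive_continuous (is_derive_line_id _ _ _).
have cpt_y x t (W : normedModType R) (f : 'cV[R]_4 -> W) :
    {for pt x t, continuous f} -> {for t, continuous (fun s => f (pt x s))}.
  move=> cf; apply: (@continuous_comp _ _ _ (fun s => pt x s) f); last exact: cf.
  exact: is_derive_continuous (is_derive_line_id _ _ _).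
(* [A y] is the coefficient of transport along the side in direction [c] at height [y], and [B y]
   its derivative in [y]. The height of this side is what varies along the curve of loops, so its
   transport must be differentiated in [y]. *)
pose A y t := - conn_basis D j c (pt t y).
pose B y t := - partial_conn D j d c (pt t y).
have taylor y z t a b : `|y| <= r -> `|z| <= r -> `|t| <= r ->
  let f := fun x => D j x a c b in
  [/\ `|f (pt t z) - f (pt t y)| <= C * `|z - y|,
      `|'D_ed f (pt t z) - 'D_ed f (pt t y)| <= C * `|z - y|
    & `|f (pt t z) - f (pt t y) - (z - y) * 'D_ed f (pt t y)| <= C * `|z - y| ^+ 2].
  move=> yr zr tr f; apply: taylor_line => s sI.
  have sr : `|s| <= r.
    move: sI yr zr; rewrite !ler_norml => /andP[s1 s2] /andP[y1 y2] /andP[z1 z2].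
    by move: s1 s2; case: (leP y z) => yz s1 s2; apply/andP; split; lra.
  have [jx _ h1 h2] := Hpt t s tr sr.
  have [_ /(_ ed)[f1 [_ /(_ ed)[f2 _]]]] := christoffel_smooth D j a c b 2%N.
  split; [exact: f1|exact: f2| |].
    by apply: le_trans h1; have := mx_entry_le_norm (partial_conn D j d c (pt t s)) a b; rewrite mxE.
  by apply: le_trans h2; have := mx_entry_le_norm (second_partial j c d (pt t s)) a b; rewrite mxE.
have [|||X [Z HXZ]] := @linear_ode_param R 4 A B r C r0.
- move=> y t yr tr; have [jx _ _ _] := Hpt t y tr yr; split.
    exact: (continuousN (cpt_x y t _ _ (conn_basis_continuous (D := D) (b := c) jx))).
  exact: (continuousN (cpt_x y t _ _ (partial_conn_continuous (D := D) (c := d) (d := c) jx))).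
- by move=> y t yr tr; have [_ h1 h2 _] := Hpt t y tr yr; rewrite !normrN.
- move=> y z t yr zr tr; rewrite /A /B; split; (apply: mx_norm_le => [|a b];
    first by rewrite ?mulr_ge0 ?exprn_ge0); have [h1 h2 h3] := taylor y z t a b yr zr tr;
    rewrite !mxE ?mulrN -normrN ?opprB.
  + by apply: le_trans h1; rewrite le_eqVlt; apply/orP; left; apply/eqP; congr (`|_|); ring.
  + by apply: le_trans h2; rewrite le_eqVlt; apply/orP; left; apply/eqP; congr (`|_|); rewrite /partial; ring.
  + by apply: le_trans h3; rewrite le_eqVlt; apply/orP; left; apply/eqP; congr (`|_|); rewrite /partial; ring.
(* [V s] transports along the side in direction [d] at abscissa [s]. Its inverse [Y s] is obtained
   as a solution of the adjoint equation, so that its derivative is known. *)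
have /choice[V HV] : forall s : R, exists V : R -> 'M[R]_4, `|s| <= r ->
    V 0 = 1%:M /\ forall t : R, `|t| <= r ->
      is_derive t 1 V (- (conn_mx D j (pt s t) ed *m V t)).
  move=> s; have [sr|_] := leP `|s| r; last by exists (fun=> 0).
  have [||V HV] := @line_frame R M D j (s *: ec + x0) ed r C r0.
  - by move=> t tr; have [] := Hpt s t sr tr.
  - by move=> t tr; rewrite conn_mx_basis; have [_ + _ _] := Hpt s t sr tr.
  by exists V.
have /choice[Y HY] : forall s : R, exists Y : R -> 'M[R]_4, `|s| <= r ->
    [/\ Y 0 = 1%:M, forall t : R, `|t| <= r ->
      is_derive t 1 Y (Y t *m conn_basis D j d (pt s t))
     & forall t : R, `|t| < r -> Y t *m V s t = 1%:M].
  move=> s; have [sr|_] := leP `|s| r; last by exists (fun=> 0).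
  have [V0 dV] := HV s sr.
  have [||//|t tr|Y [Y0 dY YV]] := @linear_ode_inverse R 4
    (fun t => - conn_basis D j d (pt s t)) (V s) r C r0.
  - move=> t tr; have [jx _ _ _] := Hpt s t sr tr.
    exact: (continuousN (cpt_y s t _ _ (conn_basis_continuous (D := D) (b := d) jx))).
  - by move=> t tr; rewrite normrN; have [_ + _ _] := Hpt s t sr tr.
  - by have := dV t tr; rewrite conn_mx_basis mulNmx.
  by exists Y; split=> // t tr; have := dY t tr; rewrite mulmxN opprK.
have [X00 Z00 dX0 dZ0 _] := HXZ 0 n0'.
have cA0 (t : R) : `|t| <= r -> {for t, continuous (A 0)}.
  move=> tr; have [jx _ _ _] := Hpt t 0 tr n0.
  exact: (continuousN (cpt_x 0 t _ _ (conn_basis_continuous (D := D) (b := c) jx))).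
have bA0 (t : R) : `|t| <= r -> `|A 0 t| <= C.
  by move=> tr; rewrite normrN; have [_ + _ _] := Hpt t 0 tr n0.
have [Q [Q0 dQ QX]] := linear_ode_inverse r0 cA0 bA0 X00 dX0.
(* Read from the right: up the side through the base point, across the top, down the far side by
   [Y], and back along the bottom by [Q]. *)
pose loop s t := Q s *m (Y s t *m (X t s *m V 0 t)).
pose dloop s t := Q s *m (Y s t *m conn_basis D j d (pt s t) *m (X t s *m V 0 t)
   + Y s t *m (Z t s *m V 0 t + X t s *m - (conn_basis D j d (pt 0 t) *m V 0 t))).
have loop_der (s t : R) : `|s| < r -> `|t| < r -> is_derive t 1 (loop s) (dloop s t).
  move=> sr tr; have [_ _ _ _ /(_ s (ltW sr))[dX _]] := HXZ t tr.
  have [_ dV] := HV 0 n0; have [_ dY _] := HY s (ltW sr).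
  have dVt := dV t (ltW tr); rewrite conn_mx_basis in dVt.
  have H1 := is_derive_mulmx (dY t (ltW tr)) (is_derive_mulmx dX dVt).
  have H := is_derive_mulmx (is_derive_cst (Q s) t (1 : R)) H1.
  by apply: (is_derive_ext H) => //; rewrite mul0mx add0r.
have loop_cont (s t : R) : `|s| < r -> `|t| < r -> {for t, continuous (dloop s)}.
  move=> sr tr; have [_ _ _ _ /(_ s (ltW sr))[dX cZ]] := HXZ t tr.
  have [_ dV] := HV 0 n0; have [_ dY _] := HY s (ltW sr).
  have cV := is_derive_continuous (dV t (ltW tr)).
  have cY := is_derive_continuous (dY t (ltW tr)).
  have cX := is_derive_continuous dX.
  have [jx _ _ _] := Hpt s t (ltW sr) (ltW tr).
  have [jx0 _ _ _] := Hpt 0 t n0 (ltW tr).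
  have cG := cpt_y s t _ _ (conn_basis_continuous (D := D) (b := d) jx).
  have cG0 := cpt_y 0 t _ _ (conn_basis_continuous (D := D) (b := d) jx0).
  have cQ : {for t, continuous (fun _ : R => Q s)} by exact: cvg_cst.
  exact: (continuous_mulmx cQ (continuousD
    (continuous_mulmx (continuous_mulmx cY cG) (continuous_mulmx cX cV))
    (continuous_mulmx cY (continuousD (continuous_mulmx cZ cV)
      (continuous_mulmx cX (continuousN (continuous_mulmx cG0 cV))))))).
have param0 : param j x0 = p by rewrite coordsK.
have loop_hol (s t : R) : `|s| < r -> `|t| < r -> holonomy_group D p j (loop s t).
  move=> sr tr; rewrite /holonomy_group /=.
  have [V00 dV0] := HV 0 n0; have [V0 dV] := HV s (ltW sr).
  have [_ _ YV] := HY s (ltW sr); have [Xt0 _ dXt _ _] := HXZ t tr.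
  have T1 : transport D p j (param j (t *: ed + x0)) j (V 0 t).
    have := @line_transport R M D j x0 ed r (V 0) _ V00 _ t tr.
    rewrite param0; apply.
      by move=> t' t'r; have [] := Hpt 0 t' n0 t'r; rewrite /pt scale0r add0r.
    by move=> t' t'r; have := dV0 t' t'r; rewrite /pt scale0r add0r.
  have T2 : transport D (param j (t *: ed + x0)) j (param j (pt s t)) j (X t s).
    rewrite ptE; apply: (@line_transport R M D j (t *: ed + x0) ec r (X t)) => //.
      by move=> s' s'r; have [] := Hpt s' t s'r (ltW tr); rewrite ptE.
    by move=> s' s'r; have := dXt s' s'r; rewrite conn_mx_basis -ptE mulNmx.
  have T3 : transport D (param j (s *: ec + x0)) j (param j (pt s t)) j (V s t).
    apply: (@line_transport R M D j (s *: ec + x0) ed r (V s)) => //.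
      by move=> t' t'r; have [] := Hpt s t' (ltW sr) t'r.
  have T4 : transport D p j (param j (s *: ec + x0)) j (X 0 s).
    have := @line_transport R M D j x0 ec r (X 0) _ X00 _ s sr.
    rewrite param0; apply.
      by move=> s' s'r; have [] := Hpt s' 0 s'r n0; rewrite ptE scale0r add0r.
    move=> s' s'r; have := dX0 s' s'r.
    by rewrite /A ptE scale0r add0r conn_mx_basis mulNmx.
  rewrite /loop (left_inverse_unique (QX s sr)) (left_inverse_unique (YV t tr)).
  apply: transport_comp (transport_inv gD T4).
  apply: transport_comp (transport_inv gD T3).
  exact: transport_comp T1 T2.
(* At height 0 the rectangle is degenerate and its holonomy is the identity. For fixed [s] the loops
   thus form an admissible curve for [holonomy_algebra], with velocity [dloop s 0]. *)
have lA (s : R) : `|s| < r -> l (dloop s 0) = 0.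
  move=> sr; apply: lhol; exists r, (loop s).
  have Iop : open [set t : R | - r < t < r].
    have -> : [set t : R | - r < t < r] = `](- r), r[%classic.
      by apply/seteqP; split=> t /=; rewrite in_itv.
    exact: interval_open.
  have nr (t : R) : - r < t < r -> `|t| < r by rewrite ltr_norml.
  split; first exact: r0.
  - apply: (@Ck1_curve R _ _ (loop s) (dloop s) Iop) => t /= /nr tr.
      exact: loop_der.
    exact: loop_cont.
  - by move=> t /nr; exact: loop_hol.
  - have [V00 _] := HV 0 n0; have [Y0 _ _] := HY s (ltW sr).
    by rewrite /loop V00 Y0 mulmx1 mul1mx QX.
  by rewrite derive1E; have [_ ->] := loop_der s 0 sr n0'.
have pt00 : pt 0 0 = x0 by rewrite /pt !scale0r !add0r.
pose A_ s := Q s *m (conn_basis D j d (pt s 0) *m X 0 s + (Z 0 s - X 0 s *m conn_basis D j d x0)).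
have lA_ (s : R) : `|s| < r -> l (A_ s) = 0.
  move=> sr; rewrite -(lA s sr); congr l.
  have [V00 _] := HV 0 n0; have [Y0 _ _] := HY s (ltW sr).
  by rewrite /A_ /dloop V00 Y0 !mulmx1 !mul1mx mulmxN pt00.
have dG : is_derive (0 : R) 1 (fun s => conn_basis D j d (pt s 0)) (partial_conn D j c d x0).
  apply/is_derive_mxP => a b.
  have [_ /(_ ec)[/(_ x0 (cimg_coords jp))/derivableP H _]] := christoffel_smooth D j a d b 1%N.
  have E : x0 = 0 *: ec + x0 by rewrite scale0r add0r.
  rewrite {1}E in H; have K := @is_derive_line R _ _ _ x0 ec 0 _ H.
  apply: (is_derive_ext K); last by rewrite mxE.
  by move=> s; rewrite !mxE ptE scale0r add0r.
have dA_ := is_derive_mulmx (dQ 0 n0) (is_deriveD (is_derive_mulmx dG (dX0 0 n0))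
  (is_deriveB (dZ0 0 n0) (is_derive_mulmx (dX0 0 n0)
     (is_derive_cst (conn_basis D j d x0) (0 : R) (1 : R))))).
have dl := is_derive_linear_form lin dA_.
have E : \forall s \near (0 : R), l (A_ s) = (fun=> 0 : R) s.
  have : \forall s \near (0 : R), `|s| < r.
    by apply/nbhs_normP; exists r => //= s; rewrite /= sub0r normrN.
  by apply: filterS => s; exact: lA_.
have [_ dl0] := near_eq_is_derive E dl.
rewrite derive_cst in dl0; rewrite [RHS]dl0; congr l.
rewrite Q0 X00 Z00 /A /B pt00 riem_mxE.
rewrite !mulmx1 !mul1mx !mulmx0 !mulmxN !mulNmx /cst /=.
(* The factor multiplying the derivative of [Q] is the velocity at [s = 0], which is 0 because the
   rectangle has no width; what remains is the curvature. *)
rewrite [X in - - (_ *m X)](_ : _ = 0); last first.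
  rewrite -[LHS]/(conn_basis D j d (pt 0 0) *m X 0 0
    + (Z 0 0 - X 0 0 *m conn_basis D j d x0)).
  by rewrite pt00 X00 Z00 mulmx1 mul1mx sub0r subrr.
rewrite mulmx0 -/x0.
move: (_ *m _) (_ *m _) (partial_conn _ _ _ _ _) (partial_conn _ _ _ _ _) => a1 a2 a3 a4.
by apply/matrixP => a b; rewrite !mxE; ring.
Qed.

End HolonomyCurvature.

(** * Geodesics *)

Section LocalSolutions.
Variable R : realType.

(** Projection onto the ball of radius [r] around [S0] in the maximum norm. It truncates a locally
    Lipschitz field to a globally Lipschitz one. *)
Definition clampmx m n (r : R) (S0 S : 'M[R]_(m, n)) : 'M[R]_(m, n) :=
  \matrix_(i, j) (S0 i j + clamp r (S i j - S0 i j)).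

Lemma clampmx_norm m n (r : R) (S0 S : 'M[R]_(m, n)) :
  0 <= r -> `|clampmx r S0 S - S0| <= r.
Proof.
move=> r0; apply: mx_norm_le => // i j.
by rewrite !mxE addrC addKr clamp_norm.
Qed.

Lemma clampmx_id m n (r : R) (S0 S : 'M[R]_(m, n)) :
  `|S - S0| <= r -> clampmx r S0 S = S.
Proof.
move=> Sr; apply/matrixP => i j; rewrite mxE clamp_id; first by rewrite addrC subrK.
by apply: le_trans Sr; have := mx_entry_le_norm (S - S0) i j; rewrite !mxE.
Qed.

Lemma clampmx_lipschitz m n (r : R) (S0 S S' : 'M[R]_(m, n)) :
  `|clampmx r S0 S - clampmx r S0 S'| <= `|S - S'|.
Proof.
apply: mx_norm_le => // i j; rewrite !mxE opprD addrACA subrr add0r.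
apply: le_trans (clamp_lipschitz _ _ _) _.
rewrite opprB subrKA.
by have := mx_entry_le_norm (S - S') i j; rewrite !mxE.
Qed.

(** The truncated field has a global solution, which by continuity stays in the ball for a short
    time, and there the truncation does nothing. *)
Lemma autonomous_ode m n (f : 'M[R]_(m, n) -> 'M[R]_(m, n))
    (S0 : 'M[R]_(m, n)) (r L : R) :
  0 < r ->
  (forall S S', `|S - S0| <= r -> `|S' - S0| <= r ->
     `|f S - f S'| <= L * `|S - S'|) ->
  exists (e : R) (S : R -> 'M[R]_(m, n)), [/\ 0 < e, S 0 = S0
    & forall t : R, `|t| < e -> `|S t - S0| <= r /\ is_derive t 1 S (f (S t))].
Proof.
move=> r0 fL; pose F S := f (clampmx r S0 S).
have L0 : 0 < `|L| + 1 by rewrite ltr_wpDl.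
have FL S S' : `|F S - F S'| <= (`|L| + 1) * `|S - S'|.
  apply: le_trans (fL _ _ _ _) _; rewrite ?clampmx_norm ?(ltW r0)//.
  apply: (@le_trans _ _ ((`|L| + 1) * `|clampmx r S0 S - clampmx r S0 S'|)).
    by rewrite ler_wpM2r//; have := ler_norm L; lra.
  by rewrite ler_wpM2l ?clampmx_lipschitz// ltW.
have [||u cu t||S [SE dS]] := @picard_lindelof R m n (fun _ => F) (`|L| + 1) (`|F S0|) S0.
- exact: L0.
- by move=> _ x y; exact: FL.
- apply/cvgrPdist_le => e e0.
  have e1 : 0 < e / (`|L| + 1) by rewrite divr_gt0.
  have /cvgrPdist_le/(_ _ e1) := cu t; apply: filterS => s us.
  by apply: le_trans (FL _ _) _; rewrite mulrC -ler_pdivlMr.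
- by [].
have /cvgrPdist_le/(_ _ r0) := is_derive_continuous (dS 0).
move=> /nbhs_normP[e /= e0 He]; exists e, S; split=> // t te.
have Sr : `|S t - S0| <= r.
  by rewrite distrC -SE; apply: He; rewrite /= sub0r normrN.
by split=> //; have := dS t; rewrite /F clampmx_id.
Qed.

(** A bound is carried along with the Lipschitz estimate because products of Lipschitz functions are
    Lipschitz only when the factors are bounded. *)
Definition bdd_lipschitz (E : normedModType R) (S0 : E) (r : R) (f : E -> R) :=
  exists2 L : R, 0 <= L & forall S S', `|S - S0| <= r -> `|S' - S0| <= r ->
    `|f S| <= L /\ `|f S - f S'| <= L * `|S - S'|.

Lemma bdd_lipschitzD (E : normedModType R) (S0 : E) r f h :
  bdd_lipschitz S0 r f -> bdd_lipschitz S0 r h ->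
  bdd_lipschitz S0 r (fun S => f S + h S).
Proof.
move=> [L L0 Hf] [K K0 Hh]; exists (L + K) => [|S S' Sr S'r]; first exact: addr_ge0.
have [f1 f2] := Hf S S' Sr S'r; have [h1 h2] := Hh S S' Sr S'r; split.
  by apply: le_trans (ler_normD _ _) _; rewrite lerD.
by rewrite opprD addrACA mulrDl; apply: le_trans (ler_normD _ _) _; rewrite lerD.
Qed.

Lemma bdd_lipschitzM (E : normedModType R) (S0 : E) r f h :
  bdd_lipschitz S0 r f -> bdd_lipschitz S0 r h ->
  bdd_lipschitz S0 r (fun S => f S * h S).
Proof.
move=> [L L0 Hf] [K K0 Hh]; exists (L * K + L * K) => [|S S' Sr S'r].
  by rewrite addr_ge0 ?mulr_ge0.
have [f1 f2] := Hf S S' Sr S'r; have [h1 h2] := Hh S S' Sr S'r.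
have [f3 _] := Hf S' S' S'r S'r; split.
  by rewrite normrM ler_wpDl ?mulr_ge0// ler_pM.
have -> : f S * h S - f S' * h S' = (f S - f S') * h S + f S' * (h S - h S').
  by ring.
rewrite [leRHS]mulrDl; apply: le_trans (ler_normD _ _) _; rewrite !normrM lerD//.
  by rewrite [leRHS]mulrAC ler_pM.
by rewrite -[leRHS]mulrA ler_pM.
Qed.

Lemma bdd_lipschitz_cst (E : normedModType R) (S0 : E) r c :
  bdd_lipschitz S0 r (fun=> c).
Proof.
by exists `|c| => // S S' _ _; rewrite subrr normr0 mulr_ge0.
Qed.

Lemma bdd_lipschitz_sum (E : normedModType R) (S0 : E) r n (f : 'I_n -> E -> R) :
  (forall i, bdd_lipschitz S0 r (f i)) ->
  bdd_lipschitz S0 r (fun S => \sum_i f i S).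
Proof.
elim: n f => [|n IH] f Hf.
  have -> : (fun S => \sum_i f i S) = (fun=> 0).
    by apply/funext => S; rewrite big_ord0.
  exact: bdd_lipschitz_cst.
have -> : (fun S => \sum_i f i S) =
    (fun S => f ord0 S + \sum_i f (lift ord0 i) S).
  by apply/funext => S; rewrite big_ord_recl.
by apply: bdd_lipschitzD => //; exact: IH.
Qed.

Lemma bdd_lipschitz_coord m n (S0 : 'M[R]_(m, n)) r i j : 0 <= r ->
  bdd_lipschitz S0 r (fun S : 'M[R]_(m, n) => S i j).
Proof.
move=> r0; exists (1 + `|S0| + r) => [|S S' Sr _]; first by rewrite !addr_ge0.
split.
  apply: le_trans (mx_entry_le_norm _ _ _) _; rewrite -[S](subrK S0).
  by apply: le_trans (ler_normD _ _) _; lra.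
apply: (@le_trans _ _ (`|S - S'|)).
  by have := mx_entry_le_norm (S - S') i j; rewrite !mxE.
by rewrite ler_peMl// -addrA lerDl addr_ge0.
Qed.

Lemma bdd_lipschitz_mx (m n p q : nat) (S0 : 'M[R]_(m, n)) r
    (f : 'M[R]_(m, n) -> 'M[R]_(p, q)) :
  (forall i j, bdd_lipschitz S0 r (fun S => f S i j)) ->
  exists L : R, forall S S', `|S - S0| <= r -> `|S' - S0| <= r ->
     `|f S - f S'| <= L * `|S - S'|.
Proof.
move=> H.
have /choice[L HL] : forall ij : 'I_p * 'I_q, exists L : R, 0 <= L /\
    forall S S', `|S - S0| <= r -> `|S' - S0| <= r ->
    `|f S ij.1 ij.2 - f S' ij.1 ij.2| <= L * `|S - S'|.
  move=> [i j]; have [L L0 HL] := H i j; exists L; split=> // S S' Sr S'r.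
  by have [] := HL S S' Sr S'r.
exists (\sum_ij L ij) => S S' Sr S'r; apply: mx_norm_le => [|i j].
  by rewrite mulr_ge0// sumr_ge0// => ij _; have [] := HL ij.
rewrite !mxE; have [_ /(_ S S' Sr S'r)/le_trans] := HL (i, j); apply.
rewrite ler_wpM2r// (bigD1 (i, j))//= lerDl sumr_ge0// => ij _.
by have [] := HL ij.
Qed.

Lemma Ck_mx (V : normedModType R) m n k (O : set V) (f : V -> 'M[R]_(m, n)) :
  open O -> (forall i j, Ck k O (fun x => f x i j)) -> Ck k O f.
Proof.
move=> Oop; elim: k f => [|k IH] f Hf.
  by split=> // x Ox; apply/continuous_mxP => i j; have [/(_ x Ox)] := Hf i j.
split=> [x Ox|v].
  by apply/continuous_mxP => i j; have [/(_ x Ox)] := Hf i j.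
have df x : O x -> derivable f x v.
  move=> Ox; apply/derivable_mxP => i j.
  by have [_ /(_ v)[/(_ x Ox)]] := Hf i j.
split=> //; apply: IH => i j.
have [_ /(_ v)[_ H]] := Hf i j; apply: (Ck_ext Oop _ H) => x Ox.
by rewrite derive_mx ?mxE//; exact: df.
Qed.

Lemma C1_bdd_lipschitz n (f : 'cV[R]_n -> R) (O : set 'cV[R]_n) x0 r (C : R) :
  open O -> (forall x, `|x - x0| <= r -> O x) -> Ck 1 O f ->
  (forall x, `|x - x0| <= r -> `|f x| <= C) ->
  (forall x (b : 'I_n), `|x - x0| <= r -> `|'D_(delta_mx b 0) f x| <= C) ->
  0 <= C -> bdd_lipschitz x0 r f.
Proof.
move=> Oop HO Hf Hb Hd C0.
exists (C + n%:R * C) => [|x y xr yr]; first by rewrite addr_ge0 ?mulr_ge0.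
split; first by rewrite ler_wpDr ?Hb// mulr_ge0.
(* The chain rule is stated for matrix values, so the scalar function is viewed as a 1 by 1 matrix
   and followed along the segment from [y] to [x]. *)
pose F (z : 'cV[R]_n) : 'M[R]_1 := (f z)%:M.
have F1 : Ck 1 O F.
  apply: (Ck_mx Oop) => i j; apply: (Ck_ext Oop _ Hf) => z _.
  by rewrite !ord1 mxE eqxx mulr1n.
pose u (s : R) : 'cV[R]_n := s *: (x - y) + y.
have ur (s : R) : 0 <= s <= 1 -> `|u s - x0| <= r.
  move=> /andP[s0 s1].
  have -> : u s - x0 = s *: (x - x0) + (1 - s) *: (y - x0).
    by rewrite /u; apply/matrixP => i j; rewrite !mxE; ring.
  apply: le_trans (ler_normD _ _) _; rewrite !normrZ !ger0_norm ?subr_ge0//.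
  have h1 : s * `|x - x0| <= s * r by rewrite ler_wpM2l.
  have h2 : (1 - s) * `|y - x0| <= (1 - s) * r by rewrite ler_wpM2l// subr_ge0.
  by lra.
pose df s := \sum_b (x - y) b 0 * 'D_(delta_mx b 0) f (u s).
have du (s : R) : 0 <= s <= 1 -> is_derive s 1 (fun s => f (u s)) (df s).
  move=> sI; have Hu : is_derive s 1 u (x - y).
    exact: (@is_derive_line R _ _ id y (x - y) s (x - y)).
  have Ous : O (u s) by apply: HO; exact: ur.
  have H := is_derive_comp_curve Oop Ous F1 Hu.
  have := (is_derive_mxP _ _ _ _).1 H 0 0 => K.
  apply: (is_derive_ext K); first by move=> z; rewrite mxE eqxx mulr1n.
  rewrite summxE; apply: eq_bigr => b _; rewrite mxE; congr (_ * _).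
  have [_ /(_ (delta_mx b 0))[/(_ _ Ous) dF _]] := F1.
  rewrite derive_mx// mxE; congr ('D__ _ _).
  by apply/funext => z; rewrite mxE eqxx mulr1n.
have E1 : u 1 = x by rewrite /u scale1r subrK.
have E0 : u 0 = y by rewrite /u scale0r add0r.
rewrite -{1}E1 -{1}E0.
apply: (@le_trans _ _ (n%:R * C * `|x - y| * `|1 - 0 : R|)).
  apply: (@mvt_norm R (fun s => f (u s)) df).
    by move=> s; rewrite (min_idPl ler01) (max_idPr ler01); exact: du.
  move=> s; rewrite (min_idPl ler01) (max_idPr ler01) => sI.
  apply: le_trans (ler_norm_sum _ _ _) _.
  apply: (@le_trans _ _ (\sum_(b < n) C * `|x - y|)).
    apply: ler_sum => b _; rewrite normrM mulrC ler_pM//.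
      by apply: Hd; exact: ur.
    exact: mx_entry_le_norm.
  by rewrite sumr_const card_ord -mulrA mulr_natl lexx.
by rewrite subr0 normr1 mulr1 ler_wpM2r// lerDr.
Qed.

End LocalSolutions.

(** * Existence of geodesics and their comparison under projective equivalence *)

Section Geodesics.
Variables (R : realType) (M : manifold4 R).

(** The geodesic equation as a first-order system: column 0 is the position, column 1 the
    velocity. *)
Let geodesic_field (D : connection M) i (S : 'M[R]_(4, 2)) : 'M[R]_(4, 2) :=
  \matrix_(a, k) (if k == 0 then S a 1
    else - (\sum_b \sum_c D i (col 0 S) a b c * (S b 1 * S c 1))).

Let geodesic_field_lipschitz (D : connection M) i (S0 : 'M[R]_(4, 2)) :
  cimg i (col 0 S0) -> exists r L : R,
  [/\ 0 < r, forall S, `|S - S0| <= r -> cimg i (col 0 S)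
   & forall S S', `|S - S0| <= r -> `|S' - S0| <= r ->
     `|geodesic_field D i S - geodesic_field D i S'| <= L * `|S - S'|].
Proof.
set x := col 0 S0 => ix.
have [r1 [C1 [r10 H1]]] := conn_locally_bounded D ix.
pose C2 : R := \sum_(bc : 'I_4 * 'I_4) (`|partial_conn D i bc.1 bc.2 x| + 1).
have N : \forall y \near x, forall bc : 'I_4 * 'I_4,
    `|partial_conn D i bc.1 bc.2 y| <= C2.
  apply: (@filter_forall _ ('I_4 * 'I_4)%type
    (fun bc y => `|partial_conn D i bc.1 bc.2 y| <= C2) (nbhs x)) => -[b c] /=.
  have := locally_bounded (partial_conn_continuous (D := D) (c := b) (d := c) ix).
  apply: filterS => y H; apply: le_trans H _.
  rewrite /C2 (bigD1 (b, c)) //=; apply: ler_wpDr => //.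
  by apply: sumr_ge0 => bc _; exact: addr_ge0.
have [r2 /= r20 H2] := (nbhs_normP _ _).1 N.
pose r := Num.min r1 r2 / 2.
have r0 : 0 < r by rewrite divr_gt0// lt_min r10.
have rr1 : r < r1 by rewrite /r; case: (leP r1 r2) => h; lra.
have rr2 : r < r2 by rewrite /r; case: (leP r1 r2) => h; lra.
have colr (S S' : 'M[R]_(4, 2)) : `|col 0 S - col 0 S'| <= `|S - S'|.
  apply: mx_norm_le => // a b; rewrite !mxE.
  by have := mx_entry_le_norm (S - S') a 0; rewrite !mxE.
have [C10 C20] : 0 <= C1 /\ 0 <= C2.
  have x1 : `|x - x| < r1 by rewrite subrr normr0.
  split; first by have [_ /(_ 0)] := H1 x x1; apply: le_trans.
  by apply: sumr_ge0 => bc _; exact: addr_ge0.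
have Gl a b c : bdd_lipschitz S0 r (fun S => D i (col 0 S) a b c).
  have [|||||L L0 HL] := @C1_bdd_lipschitz R 4 (fun y => D i y a b c) (cimg i) x r
      (C1 + C2) (@open_cimg R M i).
  - by move=> y yr; have [] := H1 y (le_lt_trans yr rr1).
  - exact: christoffel_smooth.
  - move=> y yr; have [_ /(_ b) H] := H1 y (le_lt_trans yr rr1).
    apply: (@le_trans _ _ C1); last by rewrite lerDl.
    by apply: le_trans H; have := mx_entry_le_norm (conn_basis D i b y) a c; rewrite mxE.
  - move=> y e yr; have H : forall bc : 'I_4 * 'I_4, `|partial_conn D i bc.1 bc.2 y| <= C2.
      by apply: H2; rewrite /= distrC (le_lt_trans yr rr2).
    apply: (@le_trans _ _ C2); last by rewrite lerDr.
    apply: le_trans (H (e, b)).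
    by have := mx_entry_le_norm (partial_conn D i e b y) a c; rewrite mxE.
  - by rewrite addr_ge0.
  exists L => // S S' Sr S'r.
  have [h1 h2] := HL (col 0 S) (col 0 S') (le_trans (colr _ _) Sr) (le_trans (colr _ _) S'r).
  by split=> //; apply: le_trans h2 _; rewrite ler_wpM2l.
have := @bdd_lipschitz_mx R 4 2 4 2 S0 r (geodesic_field D i).
move=> /(_ _)/wrap[].
  move=> a k; have [k0|k0] := boolP (k == 0).
    have -> : (fun S => geodesic_field D i S a k) = (fun S => S a 1).
      by apply/funext => S; rewrite mxE k0.
    by apply: bdd_lipschitz_coord; exact: ltW.
  have -> : (fun S => geodesic_field D i S a k) = (fun S => - 1 *
      \sum_b \sum_c D i (col 0 S) a b c * (S b 1 * S c 1)).
    by apply/funext => S; rewrite mxE (negbTE k0) mulN1r.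
  apply: bdd_lipschitzM; first exact: bdd_lipschitz_cst.
  apply: bdd_lipschitz_sum => b; apply: bdd_lipschitz_sum => c.
  apply: bdd_lipschitzM; first exact: Gl.
  by apply: bdd_lipschitzM; apply: bdd_lipschitz_coord; exact: ltW.
move=> [L HL]; exists r, L; split=> // S Sr.
by have [] := H1 (col 0 S) (le_lt_trans (le_trans (colr _ _) Sr) rr1).
Qed.

Lemma conn_mx_mulE (D : connection M) i x v (a : 'I_4) :
  (conn_mx D i x v *m v) a 0 = \sum_b \sum_c D i x a b c * (v b 0 * v c 0).
Proof.
rewrite mxE exchange_big /=; apply: eq_bigr => c _; rewrite mxE mulr_suml.
by apply: eq_bigr => b _; rewrite mulrA.
Qed.

Lemma geodesic_solution (D : connection M) i x v : cimg i x ->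
  exists (e : R) (u w : R -> 'cV[R]_4), [/\ 0 < e, u 0 = x, w 0 = v
    & forall t : R, `|t| < e -> [/\ cimg i (u t), is_derive t 1 u (w t)
      & is_derive t 1 w (- (conn_mx D i (u t) (w t) *m w t))]].
Proof.
move=> ix; pose S0 : 'M[R]_(4, 2) := \matrix_(a, k) (if k == 0 then x a 0 else v a 0).
have S00 : col 0 S0 = x by apply/matrixP => a b; rewrite !mxE ord1.
have [|r [L [r0 Hi HL]]] := @geodesic_field_lipschitz D i S0; first by rewrite S00.
have [e [S [e0 SE HS]]] := autonomous_ode r0 HL.
exists e, (fun t => col 0 (S t)), (fun t => col 1 (S t)); split=> //.
- by rewrite SE.
- by rewrite SE; apply/matrixP => a b; rewrite !mxE ord1.
move=> t /HS[Sr /is_derive_mxP dS]; split; first exact: Hi.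
  apply/is_derive_mxP => a b; apply: (is_derive_ext (dS a 0)).
    by move=> s; rewrite mxE.
  by rewrite !mxE.
apply/is_derive_mxP => a b; apply: (is_derive_ext (dS a 1)).
  by move=> s; rewrite mxE.
rewrite [RHS]mxE ord1 conn_mx_mulE mxE /=; congr (- _).
by apply: eq_bigr => c _; apply: eq_bigr => d _; rewrite !mxE.
Qed.

Lemma is_derive_scalemx (m n : nat) (k : R -> R) (A : R -> 'M[R]_(m, n))
    (t : R) dk dA :
  is_derive t 1 k dk -> is_derive t 1 A dA ->
  is_derive t 1 (fun s => k s *: A s) (dk *: A t + k t *: dA).
Proof.
move=> Hk /is_derive_mxP HA; apply/is_derive_mxP => i j.
by apply: (is_derive_ext (is_derive_mulr Hk (HA i j))) => [s|]; rewrite !mxE.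
Qed.

(** This is the inhomogeneous transformation law of the coefficients contracted twice with [w]: the
    second derivatives of the transition map account exactly for the change of the acceleration. *)
Lemma transition_acceleration (D : connection M) (i j : chart M) p
    (w : 'cV[R]_4) : cdom i p -> cdom j p ->
  let J := jac (transition i j) (coords i p) in
  \sum_b \sum_c (w b 0 * w c 0) *:
      partial c (partial b (transition i j)) (coords i p)
  = J *m (conn_mx D i (coords i p) w *m w)
    - conn_mx D j (coords j p) (J *m w) *m (J *m w).
Proof.
move=> ip jp J; apply/matrixP => a z; rewrite !ord1 summxE.
have E1 : (J *m (conn_mx D i (coords i p) w *m w)) a 0 =
    \sum_b \sum_c (\sum_d J a d * D i (coords i p) d c b) * (w b 0 * w c 0).
  rewrite mxE; transitivity (\sum_d \sum_b \sum_c
      J a d * D i (coords i p) d c b * (w b 0 * w c 0)).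
    apply: eq_bigr => d _; rewrite conn_mx_mulE mulr_sumr exchange_big /=.
    apply: eq_bigr => b _; rewrite mulr_sumr; apply: eq_bigr => c _.
    by rewrite mulrA [w c 0 * _]mulrC.
  rewrite exchange_big /=; apply: eq_bigr => b _; rewrite exchange_big /=.
  by apply: eq_bigr => c _; rewrite mulr_suml.
have E2 : (conn_mx D j (coords j p) (J *m w) *m (J *m w)) a 0 =
    \sum_b \sum_c (\sum_d \sum_e D j (coords j p) a d e * J d c * J e b)
      * (w b 0 * w c 0).
  rewrite conn_mx_mulE.
  transitivity (\sum_d \sum_e \sum_b \sum_c
     D j (coords j p) a d e * J d c * J e b * (w b 0 * w c 0)).
    apply: eq_bigr => d _; apply: eq_bigr => e _.
    rewrite !mxE mulr_suml mulr_sumr exchange_big /=; apply: eq_bigr => c _.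
    rewrite mulr_sumr mulr_sumr; apply: eq_bigr => b _; ring.
  transitivity (\sum_d \sum_b \sum_e \sum_c
     D j (coords j p) a d e * J d c * J e b * (w b 0 * w c 0)).
    by apply: eq_bigr => d _; rewrite exchange_big.
  rewrite exchange_big /=; apply: eq_bigr => b _.
  transitivity (\sum_d \sum_c \sum_e
     D j (coords j p) a d e * J d c * J e b * (w b 0 * w c 0)).
    by apply: eq_bigr => d _; rewrite exchange_big.
  rewrite exchange_big /=; apply: eq_bigr => c _; rewrite mulr_suml.
  by apply: eq_bigr => d _; rewrite mulr_suml.
rewrite [RHS]mxE E1 mxE E2 -sumrB; apply: eq_bigr => b _.
rewrite summxE -sumrB; apply: eq_bigr => c _.
rewrite -mulrBl mxE mulrC; congr (_ * _).
rewrite -(christoffel_transform D a c b ip jp); ring.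
Qed.

(** The solution is constructed in one chart, whereas [geodesic] asks for the equation in every
    chart around the point; [transition_acceleration] carries it over. *)
Lemma geodesic_of_solution (D : connection M) i (u w : R -> 'cV[R]_4) (e : R) :
  0 < e -> (forall t : R, `|t| < e -> [/\ cimg i (u t), is_derive t 1 u (w t)
      & is_derive t 1 w (- (conn_mx D i (u t) (w t) *m w t))]) ->
  geodesic D [set t : R | `|t| < e] (fun t => param i (u t)).
Proof.
move=> e0 H.
have IE : [set t : R | `|t| < e] = `](- e), e[%classic.
  by apply/seteqP; split=> t /=; rewrite in_itv /= ltr_norml.
have Iop : open [set t : R | `|t| < e] by rewrite IE; exact: interval_open.
split.
  split; [exact: Iop| |by exists 0; rewrite /= normr0].
  by rewrite IE; exact: interval_is_interval.
move=> t te; have [iu du dw] := H t te; have cu := is_derive_continuous du.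
have cc : {for t, continuous (fun t => param i (u t))}.
  by apply: (@continuous_comp _ _ _ u (param i)) => //; exact: param_continuous iu.
split=> // j jct; cbv zeta; set T := transition i j.
pose O := coords i @` (cdom i `&` cdom j).
have Oop : open O by exact: open_overlap_coords.
have Nt : \forall s \near t, `|s| < e /\ O (u s).
  apply: filterI; first exact: open_nbhs_nbhs.
  apply: cu; apply: open_nbhs_nbhs; split=> //.
  by apply/overlap_coords.
have d1 s : `|s| < e -> O (u s) ->
    is_derive s 1 (coords j \o (fun t => param i (u t))) (jac T (u s) *m w s).
  move=> se Ous; have [ius dus _] := H s se.
  have K := is_derive_coord_curve Oop Ous (@transition_Ck R M i j 1%N) dus.
  by rewrite jac_curve in K; exact: K.
have [_ Out] := nbhs_singleton Nt.
have D1 : \forall s \near t, \sum_b w s b 0 *: partial b T (u s) =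
    derive1 (coords j \o (fun t => param i (u t))) s.
  apply: filterS Nt => s [se Ous].
  by rewrite derive1E; have [_ ->] := d1 s se Ous; rewrite jac_curve.
have d2 : is_derive t 1 (fun s => \sum_b w s b 0 *: partial b T (u s))
   (\sum_b ((- (conn_mx D i (u t) (w t) *m w t)) b 0 *: partial b T (u t)
     + w t b 0 *: \sum_c w t c 0 *: partial c (partial b T) (u t))).
  apply: is_derive_bigsum => b; apply: is_derive_scalemx.
    exact: ((is_derive_mxP _ _ _ _).1 dw b 0).
  apply: (is_derive_coord_curve Oop Out) du.
  by have [_ /(_ (basis_vec R b))[_ +]] := @transition_Ck R M i j 2%N.
have d3 := near_eq_is_derive D1 d2.
have d1t := d1 t te Out.
split; [by have [] := d1t|by have [] := d3|].
rewrite [LHS]derive1E; have [_ ->] := d3.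
rewrite derive1E; have [_ ->] := d1t.
rewrite big_split /= jac_curve mulmxN.
have [p [ip jp] pu] := Out.
have pE : param i (u t) = p by rewrite -pu coordsK.
rewrite /= pE -pu.
have := transition_acceleration D (w t) ip jp; cbv zeta => E.
under eq_bigr do rewrite scaler_sumr.
under eq_bigr do under eq_bigr do rewrite scalerA.
by rewrite E addrA addNr add0r.
Qed.

Variables D D' : connection M.
Hypothesis proj : projectively_related D D'.

(** The [D]-geodesic with velocity [v] becomes a [D']-geodesic after a reparametrisation [h].
    Comparing accelerations at its base point gives [h'^2 (Gamma' - Gamma)(v, v) = - h'' v], so
    [k = - h'' / h'^2]. *)
Lemma projective_parallel i x v : cimg i x ->
  exists k : R, conn_mx D' i x v *m v - conn_mx D i x v *m v = k *: v.
Proof.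
move=> ix; have [e [u [w [e0 u0 w0 H]]]] := geodesic_solution D v ix.
pose I := [set t : R | `|t| < e]; pose c t := param i (u t).
have G : geodesic D I c by exact: geodesic_of_solution e0 H.
have P : geodesic_path D I c.
  exists I, id; split; last exact: G.
  have idE : (fun s : R => (1 * s) *: (1 : R) + 0) = id.
    by apply/funext => s; rewrite mul1r addr0 [LHS]mulr1.
  split; first by rewrite -idE; exact: smooth_affine.
    by move=> t _; rewrite derive1_id oner_neq0.
  by rewrite image_id.
have /proj[J [h [[hs hn hI] [[Jop Jint _] HG]]]] := P.
have [s0 Js0 hs0] : (h @` J) 0 by rewrite hI /I /= normr0.
have hJ s : J s -> `|h s| < e.
  by move=> Js; have : I (h s) by rewrite -hI; exists s.
have dh (s : R) : J s -> is_derive s 1 h (derive1 h s).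
  by move=> Js; rewrite derive1E; apply: derivableP; have [_ /(_ 1)[+ _]] := hs 1%N; apply.
have ch0 : c (h s0) = param i x by rewrite hs0 /c u0.
have [_ /(_ i)] := HG s0 Js0; rewrite /= ch0 => /(_ (cdom_param ix)).
set U := coords i \o (c \o h); move=> [_ _].
have UE s : J s -> U s = u (h s).
  by move=> /hJ/H[iu _ _]; rewrite /U /= paramK.
have dU (s : R) : J s -> is_derive s 1 U (derive1 h s *: w (h s)).
  move=> Js; have [_ du _] := H _ (hJ s Js).
  apply: (near_eq_is_derive _ (is_derive_reparam (dh s Js) du)).
  by apply: filterS (open_nbhs_nbhs (conj Jop Js)) => s' /UE.
have D1 : \forall s \near s0, derive1 h s *: w (h s) = derive1 U s.
  apply: filterS (open_nbhs_nbhs (conj Jop Js0)) => s Js.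
  by rewrite [RHS]derive1E; have [_ ->] := dU s Js.
have [_ _ dw] := H _ (hJ s0 Js0).
have dwh := is_derive_reparam (dh s0 Js0) dw.
have ddh : is_derive s0 1 (derive1 h) ('D_1 (derive1 h) s0).
  apply: derivableP.
  have [_ /(_ 1)[_ [_ /(_ 1)[/(_ s0 Js0) + _]]]] := hs 2%N.
  have -> // : (fun y : R => 'D_1 h y) = derive1 h by apply/funext => y; rewrite derive1E.
have dd := near_eq_is_derive D1 (is_derive_scalemx ddh dwh).
rewrite [in X in X -> _]derive1E; have [_ ->] := dd.
rewrite (_ : derive1 U s0 = derive1 h s0 *: v); last first.
  by rewrite [LHS]derive1E; have [_ ->] := dU s0 Js0; rewrite hs0 w0.
rewrite paramK// hs0 u0 w0 => E.
have k0 := hn s0 Js0; move: E k0.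
move: (derive1 h s0) ('D_1 _ s0) => k k' E k0.
exists (- (k' / k ^+ 2)).
have : k ^+ 2 *: (conn_mx D' i x v *m v - conn_mx D i x v *m v) = - (k' *: v).
  rewrite conn_mxZ -scalemxAl -scalemxAr in E.
  move: (_ *m v) (_ *m v) E => b a /matrixP E; apply/matrixP => p q.
  by have := E p q; rewrite !mxE expr2; lra.
move=> E2; rewrite scaleNr [k' / _]mulrC -scalerA -scalerN -E2 scalerA.
by rewrite mulVf ?scale1r// expf_neq0.
Qed.

End Geodesics.

(** * Linear algebra *)

Section Algebra.
Variable R : realType.
Implicit Types (G F : 'M[R]_4) (z w : 'cV[R]_4) (psi : 'rV[R]_4).

Lemma sum_delta_scale (V : lmodType R) (N : 'I_4 -> V) (b : 'I_4) :
  \sum_d (delta_mx b 0 : 'cV[R]_4) d 0 *: N d = N b.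
Proof.
rewrite (bigD1 b)//= big1 ?addr0 => [|d db]; rewrite !mxE ?eqxx ?scale1r//.
by rewrite (negbTE db) scale0r.
Qed.

(* Testing on [e_b] and [e_b +- e_c] determines the whole bilinear map. *)
Lemma parallel_quadratic (N : 'I_4 -> 'M[R]_4) :
  (forall a b c, N b a c = N c a b) ->
  (forall v : 'cV[R]_4, exists k, (\sum_b v b 0 *: N b) *m v = k *: v) ->
  forall b, N b = (N b b b / 2)%:M + delta_mx b 0 *m \row_c (N c c c / 2).
Proof.
move=> sym par.
have mulE (A : 'M[R]_4) a c : (A *m (delta_mx c 0 : 'cV[R]_4)) a 0 = A a c.
  by rewrite -colE mxE.
have diag b : exists k, forall a, N b a b = k * (a == b)%:R.
  have [k /matrixP E] := par (delta_mx b 0); exists k => a.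
  by have := E a 0; rewrite sum_delta_scale mulE !mxE eqxx andbT.
have comb b c (s : R) : exists k, forall a,
    N b a b + s * (2 * N b a c) + s * s * N c a c = k * ((a == b)%:R + s * (a == c)%:R).
  have [k /matrixP E] := par (delta_mx b 0 + s *: delta_mx c 0); exists k => a.
  have := E a 0.
  under eq_bigr do rewrite mxE scalerDl [X in _ + X *: _]mxE -scalerA.
  rewrite big_split /= -scaler_sumr !sum_delta_scale.
  rewrite mulmxDl !mulmxDr -!scalemxAl -!scalemxAr.
  rewrite [X in X = _ -> _]mxE [X in X + _ = _]mxE [X in _ + X = _]mxE.
  rewrite [X in _ + X + _ = _]mxE [X in _ + (X + _) = _]mxE [X in _ + (_ + X) = _]mxE.
  rewrite [X in _ + (_ + _ * X) = _]mxE !mulE (sym a c b) => H.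
  have -> : k * ((a == b)%:R + s * (a == c)%:R)
      = (k *: (delta_mx b 0 + s *: delta_mx c 0 : 'cV[R]_4)) a 0.
    by rewrite !mxE eqxx !andbT.
  by rewrite -H; ring.
have off a b : a != b -> N b a b = 0.
  by move=> ab; have [k ->] := diag b; rewrite (negbTE ab) mulr0.
(* For each sign the components at [b] and [c] share the same factor [k]. Eliminating it leaves two
   linear equations, whose sum and difference give the two values. *)
have key b c : b != c -> N b b c = N c c c / 2 /\ N b c c = N b b b / 2.
  move=> bc; have cb : c != b by rewrite eq_sym.
  have [k1 E1] := comb b c 1; have [k2 E2] := comb b c (-1).
  have := (E1 b, E1 c); have := (E2 b, E2 c).
  rewrite !eqxx (negbTE bc) (negbTE cb) (off b c bc) (off c b cb) /=.
  by move=> [e1 e2] [e3 e4]; split; lra.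
move=> b; apply/matrixP => a c.
have -> : ((N b b b / 2)%:M + delta_mx b 0 *m \row_c (N c c c / 2)) a c
    = N b b b / 2 *+ (a == c) + (a == b)%:R * (N c c c / 2).
  by rewrite !mxE big_ord1 !mxE eqxx andbT.
have [ab|ab] := eqVneq a b; have [ac|ac] := eqVneq a c.
- by rewrite -ac ab mulr1n mul1r; lra.
- by rewrite mulr0n add0r mul1r ab; have [|-> _] := key b c; rewrite -?ab.
- rewrite mulr1n mul0r addr0 ac; have [|_ ->//] := key b c.
  by rewrite -ac eq_sym.
rewrite mulr0n mul0r addr0; have [->|cb] := eqVneq c b; first exact: off.
have [k E] := comb b c 1; have := E a.
by rewrite (negbTE ab) (negbTE ac) !off//=; lra.
Qed.


Lemma trmx11 (A : 'M[R]_1) : A 0 0 = A^T 0 0.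
Proof. by rewrite mxE. Qed.

Lemma row_neq0 (h : 'rV[R]_4) : h != 0 -> exists w, (h *m w) 0 0 != 0.
Proof.
move=> /eqP/rowP/existsNP[b]; rewrite mxE => /eqP hb.
by exists (delta_mx b 0); rewrite -colE mxE.
Qed.

Lemma form_entry (A : 'M[R]_4) (a b : 'I_4) :
  ((delta_mx a 0 : 'cV[R]_4)^T *m A *m (delta_mx b 0 : 'cV[R]_4)) 0 0 = A a b.
Proof. by rewrite -colE trmx_delta -rowE !mxE. Qed.

Lemma formD (A : 'M[R]_4) (s : R) z w :
  ((z + s *: w)^T *m A *m (z + s *: w)) 0 0 = (z^T *m A *m z) 0 0
   + s * ((z^T *m A *m w) 0 0 + (w^T *m A *m z) 0 0) + s ^+ 2 * (w^T *m A *m w) 0 0.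
Proof.
have -> : (z + s *: w)^T = z^T + s *: w^T by apply/matrixP => i j; rewrite !mxE.
rewrite !mulmxDl !mulmxDr -!scalemxAl -!scalemxAr.
move: (z^T *m A *m z) (z^T *m A *m w) (w^T *m A *m z) (w^T *m A *m w) => a1 a2 a3 a4.
by rewrite !mxE; ring.
Qed.

Lemma skew_of_form (A : 'M[R]_4) :
  (forall z, (z^T *m A *m z) 0 0 = 0) -> A + A^T = 0.
Proof.
move=> H; apply/matrixP => a b; rewrite !mxE.
have := H (delta_mx a 0 + 1 *: delta_mx b 0); rewrite formD !H !form_entry.
by rewrite mul1r mulr0 addr0 add0r.
Qed.

Lemma form_of_skew (A : 'M[R]_4) z : A + A^T = 0 -> (z^T *m A *m z) 0 0 = 0.
Proof.
move=> H; have E : (z^T *m A *m z) 0 0 = (z^T *m A^T *m z) 0 0.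
  by rewrite [RHS]trmx11 !trmx_mul !trmxK mulmxA.
have : (z^T *m (A + A^T) *m z) 0 0 = 0 by rewrite H mulmx0 mul0mx mxE.
by rewrite mulmxDr mulmxDl mxE -E; lra.
Qed.

(** If [h] kills [z], then [w + s z] lies off the hyperplane for every [s]. The quadratic polynomial
    in [s] vanishes at 0, 1 and -1, so its leading coefficient, the form at [z], is 0. *)
Lemma form_density (A : 'M[R]_4) (h : 'rV[R]_4) w :
  (h *m w) 0 0 != 0 ->
  (forall z, (h *m z) 0 0 != 0 -> (z^T *m A *m z) 0 0 = 0) ->
  forall z, (z^T *m A *m z) 0 0 = 0.
Proof.
move=> hw H z; have [hz|] := eqVneq ((h *m z) 0 0) 0; last exact: H.
have hws s : (h *m (w + s *: z)) 0 0 != 0.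
  by rewrite mulmxDr -scalemxAr mxE [X in _ + X]mxE hz mulr0 addr0.
have := H _ (hws 1); have := H _ (hws (-1)); rewrite !formD (H w hw).
by rewrite expr2 mulrNN mulr1; lra.
Qed.

(** Conjugation by [G] turns [A] into [- A^T]. *)
Lemma skew_trace0 G (A : 'M[R]_4) : G^T = G -> G \in unitmx ->
  G *m A + (G *m A)^T = 0 -> \tr A = 0.
Proof.
move=> Gs Gu /eqP; rewrite addr_eq0 trmx_mul Gs => /eqP E.
have : \tr A = - \tr A.
  rewrite -[in LHS](mulKmx Gu A) E mulmxN linearN /= mxtrace_mulC.
  by rewrite -mulmxA mulmxV// mulmx1 mxtrace_tr.
by lra.
Qed.

(** Skew matrices have even rank. Concretely, where [h] has a nonzero entry [b], the diagonal entry
    of the product kills coordinate [b] of [G f], and the entries in column [b] then kill the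
    others. *)
Lemma rank_one_skew G F (f : 'cV[R]_4) (h : 'rV[R]_4) : G \in unitmx ->
  G *m F + (G *m F)^T = 0 -> F = f *m h -> F = 0.
Proof.
move=> Gu /matrixP E FE.
have [h0|] := eqVneq h 0; first by rewrite FE h0 mulmx0.
move=> /eqP/rowP/existsNP[b]; rewrite mxE => /eqP hb.
have e a c : (G *m f) a 0 * h 0 c + (G *m f) c 0 * h 0 a = 0.
  by have := E a c; rewrite FE mulmxA; move: (G *m f) => q; rewrite !mxE !big_ord1.
have gb : (G *m f) b 0 = 0.
  by have /eqP := e b b; rewrite -mulr2n mulrn_eq0 /= mulf_eq0 (negbTE hb) orbF => /eqP.
have gf : G *m f = 0.
  apply/colP => a; rewrite [RHS]mxE; have /eqP := e a b.
  by rewrite gb mul0r addr0 mulf_eq0 (negbTE hb) orbF => /eqP.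
by rewrite FE -(mulKmx Gu f) gf mulmx0 mul0mx.
Qed.

(** Contracting the cyclic identity with [k] removes the first term and leaves
    [h c *: col d F = h d *: col c F]. A nonzero [h] would make all columns multiples of one,
    against the rank hypothesis. *)
Lemma bianchi_kernel F (H : 'I_4 -> 'I_4 -> R) (k : 'cV[R]_4) :
  (forall (f : 'cV[R]_4) (h : 'rV[R]_4), F <> f *m h) -> F *m k = 0 ->
  (forall c d, H c d = - H d c) ->
  (forall b c d, H c d *: col b F + H d b *: col c F + H b c *: col d F = 0) ->
  forall d, \sum_b k b 0 * H b d = 0.
Proof.
move=> rk Fk Hanti cyc; pose h d := \sum_b k b 0 * H b d.
have Fk' : \sum_b k b 0 *: col b F = 0.
  transitivity (F *m k); last exact: Fk.
  apply/colP => a; rewrite summxE [RHS]mxE; apply: eq_bigr => b _.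
  by rewrite !mxE mulrC.
have E c d : h c *: col d F = h d *: col c F.
  have : \sum_b k b 0 *: (H c d *: col b F + H d b *: col c F + H b c *: col d F) = 0.
    by apply: big1 => b _; rewrite cyc scaler0.
  under eq_bigr do rewrite !scalerDr.
  rewrite !big_split /=.
  have -> : \sum_b k b 0 *: (H c d *: col b F) = 0.
    under eq_bigr do rewrite scalerA mulrC -scalerA.
    by rewrite -scaler_sumr Fk' scaler0.
  have -> : \sum_b k b 0 *: (H d b *: col c F) = - (h d *: col c F).
    rewrite /h scaler_suml -sumrN; apply: eq_bigr => b _.
    by rewrite (Hanti d b) scaleNr scalerN scalerA.
  have -> : \sum_b k b 0 *: (H b c *: col d F) = h c *: col d F.
    by rewrite /h scaler_suml; apply: eq_bigr => b _; rewrite scalerA.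
  by rewrite add0r addrC => /eqP; rewrite subr_eq0 => /eqP.
move=> d; apply/eqP/negP => /negP; rewrite -/(h d) => hd.
apply: (rk ((h d)^-1 *: col d F) (\row_c h c)); apply/matrixP => a c.
rewrite !mxE big_ord1 !mxE.
have /colP/(_ a) := E c d; rewrite !mxE => e.
by rewrite -mulrA [F a d * _]mulrC e mulKf.
Qed.

(** Write [s] for the form of [G F] and [gam] for the covector of [z]. Skewness reads [H c d * s +
    gam d * Pi c - gam c * Pi d = 0] at [z]. Contraction with [k], which kills [H], makes [Pi]
    proportional to [gam] when [k] and [z] are not orthogonal; the last two terms then cancel and
    [s = 0]. Density covers the remaining [z]. *)
Lemma generator_skew G F (H : 'I_4 -> 'I_4 -> R) (k : 'cV[R]_4)
    (Pi : 'I_4 -> 'rV[R]_4) c0 d0 :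
  G^T = G -> G \in unitmx -> k != 0 -> H c0 d0 != 0 ->
  (forall d, \sum_b k b 0 * H b d = 0) ->
  (forall c d, let A := G *m (H c d *: F + delta_mx d 0 *m Pi c
     - delta_mx c 0 *m Pi d) in A + A^T = 0) ->
  G *m F + (G *m F)^T = 0.
Proof.
move=> Gs Gu k0 H0 kH Hsk.
pose gam c z := (z^T *m G *m (delta_mx c 0 : 'cV[R]_4)) 0 0.
pose s z := (z^T *m (G *m F) *m z) 0 0.
have E c d z : H c d * s z + gam d z * (Pi c *m z) 0 0 - gam c z * (Pi d *m z) 0 0 = 0.
  have := form_of_skew z (Hsk c d).
  have -> : z^T *m (G *m (H c d *: F + delta_mx d 0 *m Pi c - delta_mx c 0 *m Pi d)) *m z
    = H c d *: (z^T *m (G *m F) *m z) + (z^T *m G *m delta_mx d 0) *m (Pi c *m z)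
      - (z^T *m G *m delta_mx c 0) *m (Pi d *m z).
    rewrite 2!mulmxBr 2!mulmxDr mulmxBl mulmxDl -scalemxAr -scalemxAr.
    by rewrite -scalemxAl !mulmxA.
  rewrite /s /gam; move: (z^T *m (G *m F) *m z) (_ *m delta_mx d 0) (_ *m delta_mx c 0)
    (Pi c *m z) (Pi d *m z) => a1 a2 a3 a4 a5.
  by rewrite !mxE !big_ord1.
have kc z : (k^T *m G *m z) 0 0 = \sum_c k c 0 * gam c z.
  have -> : (k^T *m G *m z) 0 0 = (z^T *m G *m k) 0 0.
    by rewrite [RHS]trmx11 !trmx_mul Gs trmxK mulmxA.
  rewrite mxE; apply: eq_bigr => c _; rewrite mulrC; congr (_ * _).
  by rewrite /gam -colE [RHS]mxE.
apply: skew_of_form.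
have [w hw] : exists w, (k^T *m G *m w) 0 0 != 0.
  apply: row_neq0; apply: contraNneq k0 => kG.
  by rewrite -[k]trmxK -(mulmxK Gu k^T) kG mul0mx trmx0.
apply: (form_density hw) => z hz.
have Ek d : gam d z * \sum_c k c 0 * (Pi c *m z) 0 0 = (k^T *m G *m z) 0 0 * (Pi d *m z) 0 0.
  have : \sum_c k c 0 * (H c d * s z + gam d z * (Pi c *m z) 0 0
      - gam c z * (Pi d *m z) 0 0) = 0 by apply: big1 => c _; rewrite E mulr0.
  under eq_bigr do rewrite mulrBr mulrDr.
  rewrite sumrB big_split /=.
  have -> : \sum_b k b 0 * (H b d * s z) = 0.
    under eq_bigr do rewrite mulrA.
    by rewrite -mulr_suml kH mul0r.
  rewrite add0r => /eqP; rewrite subr_eq0 => /eqP e.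
  rewrite mulr_sumr kc mulr_suml.
  transitivity (\sum_c k c 0 * (gam d z * (Pi c *m z) 0 0)).
    by apply: eq_bigr => c _; ring.
  by rewrite e; apply: eq_bigr => c _; ring.
have := E c0 d0 z; have := Ek c0; have := Ek d0; rewrite -/(s z).
move: (\sum_c _) ((Pi c0 *m z) 0 0) ((Pi d0 *m z) 0 0) hz => S p q.
move: ((k^T *m G *m z) 0 0) (gam c0 z) (gam d0 z) (s z) (H c0 d0) H0
  => t u v x y y0 t0 e1 e2 e3.
have : t * (y * x) = 0.
  transitivity (t * (y * x + v * p - u * q)); last by rewrite e3 mulr0.
  have -> : t * (y * x + v * p - u * q) = t * (y * x) + (v * (t * p) - u * (t * q)) by ring.
  by rewrite -e1 -e2; ring.
by move=> /eqP; rewrite !mulf_eq0 (negbTE t0) (negbTE y0) => /eqP.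
Qed.

(* Taking the trace of the polarised identity forces [psi F = 0]. *)
Lemma covector_zero F psi : \tr F = 0 -> F != 0 ->
  (forall z, (psi *m z) 0 0 *: (F *m z) + (psi *m F *m z) 0 0 *: z = 0) ->
  psi = 0.
Proof.
move=> tF F0 H.
have eD (h : 'rV[R]_4) z w : (h *m (z + w)) 0 0 = (h *m z) 0 0 + (h *m w) 0 0.
  by rewrite mulmxDr mxE.
have pol z w : (psi *m z) 0 0 *: (F *m w) + (psi *m w) 0 0 *: (F *m z)
    + (psi *m F *m z) 0 0 *: w + (psi *m F *m w) 0 0 *: z = 0.
  have := H (z + w); rewrite !eD [F *m (_ + _)]mulmxDr.
  have := H z; have := H w.
  move: (F *m z) (F *m w) ((psi *m z) 0 0) ((psi *m w) 0 0) ((psi *m F *m z) 0 0)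
    ((psi *m F *m w) 0 0) => a b c d e f /colP h1 /colP h2 /colP h3.
  by apply/colP => i; have := h1 i; have := h2 i; have := h3 i; rewrite !mxE; lra.
have pF z : (psi *m F *m z) 0 0 = 0.
  have mxz : (psi *m z) 0 0 *: F + (F *m z) *m psi + ((psi *m F *m z) 0 0)%:M
      + z *m (psi *m F) = 0.
    apply/matrixP => a b; have := pol z (delta_mx b 0); rewrite -!colE.
    move: ((psi *m z) 0 0) ((psi *m F *m z) 0 0) (psi *m F) (F *m z) => s t q y.
    by move=> /colP/(_ a); rewrite !mxE !big_ord1 eqxx andbT; case: (a == b) => /=; lra.
  (* The four terms have traces 0, [psi F z], [4 psi F z] and [psi F z], hence [6 psi F z = 0]. *)
  have := congr1 (@mxtrace R 4) mxz.
  rewrite !linearD /= linearZ /= tF mulr0 add0r [\tr (_ *m psi)]mxtrace_mulC.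
  rewrite [\tr (z *m _)]mxtrace_mulC mxtrace_scalar linear0 !mulmxA.
  by rewrite /mxtrace !big_ord1; lra.
have pz z : (psi *m z) 0 0 *: (F *m z) = 0.
  by have := H z; rewrite pF scale0r addr0.
apply/eqP/negP => /negP psi0; move/negP: F0; apply; apply/eqP.
move: psi0 => /eqP/rowP/existsNP[b]; rewrite mxE => /eqP pb.
have Fz z : (psi *m z) 0 0 != 0 -> F *m z = 0.
  by move=> h; have /eqP := pz z; rewrite scaler_eq0 (negbTE h) => /eqP.
have pe : (psi *m (delta_mx b 0 : 'cV[R]_4)) 0 0 != 0 by rewrite -colE mxE.
(* A vector killed by [psi] is the difference of two vectors that are not, and [F] vanishes on
   those. *)
have F0 z : F *m z = 0.
  have [hz|] := eqVneq ((psi *m z) 0 0) 0; last exact: Fz.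
  have := Fz (z + delta_mx b 0); rewrite mulmxDr mxE hz add0r pe => /(_ isT).
  by rewrite mulmxDr (Fz _ pe) addr0.
by apply/matrixP => a c; have /colP/(_ a) := F0 (delta_mx c 0); rewrite -colE !mxE.
Qed.

End Algebra.

(** * Curvature under a projective change *)

Section HolonomyAlgebra.
Variables (R : realType) (M : manifold4 R).
Variables (g : lorentz_metric M) (D : connection M).
Hypothesis gD : metric_compatible g D.

Lemma holonomy_algebra_skew p j A :
  cdom j p -> holonomy_algebra D p j A ->
  g j (coords j p) *m A + (g j (coords j p) *m A)^T = 0.
Proof.
move=> jp [e [c [e0 [_ /(_ 1)[dc _]] hol c0 cA]]].
have I0 : - e < 0 < e by rewrite oppr_lt0 e0.
have /derivableP := dc 0 I0; rewrite -derive1E cA => dA.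
set G := g j (coords j p).
have H := is_derive_mulmx (is_derive_mulmx (is_derive_trmx dA)
  (is_derive_cst G (0 : R) (1 : R))) dA.
have E : \forall t \near (0 : R), (c t)^T *m cst G t *m c t = cst G t.
  apply/nbhs_normP; exists e => //= t; rewrite /= sub0r normrN ltr_norml => te.
  by have [] := transport_metric gD (hol t te).
have [_ H0] := near_eq_is_derive E H.
rewrite derive_cst in H0; rewrite [RHS]H0 c0 trmx1 mulmx0 addr0 mulmx1 mul1mx.
by rewrite addrC trmx_mul (metric_sym g (cimg_coords jp)).
Qed.

(** Each entry of [G A + (G A)^T] is a linear form in [A]. It vanishes on the holonomy algebra
    because holonomies are isometries, hence on the curvature. *)
Lemma riem_mx_skew p j c d : cdom j p ->
  let A := g j (coords j p) *m riem_mx D j (coords j p) c d in A + A^T = 0.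
Proof.
move=> jp; cbv zeta; set G := g j (coords j p); apply/matrixP => a b.
rewrite [RHS]mxE.
apply: (@holonomy_curvature R M g D gD p j c d (fun A => (G *m A + (G *m A)^T) a b) jp).
  move=> k A B; rewrite mulmxDr -scalemxAr.
  by move: (G *m A) (G *m B) => X Y; rewrite !mxE; ring.
by move=> A /(holonomy_algebra_skew jp); rewrite -/G => ->; rewrite mxE.
Qed.

(** Loops at [p] become loops at [m] when preceded by the path from [m] to [p] and followed by its
    reversal. *)
Lemma holonomy_algebra_conj m i p j A B : transport D m i p j B ->
  holonomy_algebra D p j A -> holonomy_algebra D m i (invmx B *m A *m B).
Proof.
move=> TB [e [c [e0 Hc hol c0 cA]]].
have Bu := transport_unitmx gD TB.
have Iop : open [set t : R | - e < t < e].
  have -> : [set t : R | - e < t < e] = `](- e), e[%classic.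
    by apply/seteqP; split=> t /=; rewrite in_itv.
  exact: interval_open.
have [cc /(_ 1)[dc [cdc _]]] := Hc.
have d1 (t : R) : - e < t < e -> is_derive t 1 (fun t => invmx B *m c t *m B)
    (invmx B *m 'D_1 c t *m B).
  move=> te; have H := is_derive_mulmx (is_derive_mulmx
    (is_derive_cst (invmx B) t (1 : R)) (derivableP (dc t te)))
    (is_derive_cst B t (1 : R)).
  by apply: (is_derive_ext H) => //; rewrite mul0mx add0r mulmx0 addr0.
have cst_cont (X : 'M[R]_4) (t : R) : {for t, continuous (fun _ : R => X)}.
  exact: cvg_cst.
have c1 (t : R) : - e < t < e ->
    {for t, continuous (fun t : R => invmx B *m 'D_1 c t *m B)}.
  move=> te.
  exact: (continuous_mulmx (continuous_mulmx (cst_cont _ _) (cdc t te)) (cst_cont _ _)).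
exists e, (fun t => invmx B *m c t *m B); split; first exact: e0.
- exact: Ck1_curve Iop d1 c1.
- move=> t te; rewrite /holonomy_group /= -mulmxA.
  apply: transport_comp (transport_inv gD TB).
  by apply: transport_comp TB _; exact: hol.
- by rewrite c0 mulmx1 mulVmx.
rewrite derive1E; have [|_ ->] := d1 0; first by rewrite oppr_lt0 e0.
by rewrite -derive1E cA.
Qed.

Lemma riem_mx_generator m i p j (F B : 'M[R]_4) :
  F != 0 -> (forall A, holonomy_algebra D m i A -> exists k : R, A = k *: F) ->
  transport D m i p j B ->
  exists H : 'I_4 -> 'I_4 -> R, forall c d,
    riem_mx D j (coords j p) c d = H c d *: (B *m F *m invmx B).
Proof.
move=> F0 holF TB; have Bu := transport_unitmx gD TB.
have [_ jp _] := transport_metric gD TB.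
pose Fp := B *m F *m invmx B.
have Fp0 : Fp != 0.
  apply: contraNneq F0 => E.
  have -> : F = invmx B *m Fp *m B by rewrite /Fp !mulmxA mulVmx// mul1mx mulmxKV.
  by rewrite E mulmx0 mul0mx.
have holp A : holonomy_algebra D p j A -> exists k : R, A = k *: Fp.
  move=> /(holonomy_algebra_conj TB)/holF[k E]; exists k.
  have -> : A = B *m (invmx B *m A *m B) *m invmx B.
    by rewrite !mulmxA mulmxV// mul1mx mulmxK.
  by rewrite E -scalemxAr -scalemxAl.
have [a0 [b0 Fab]] : exists a b, Fp a b != 0.
  move: Fp0 => /eqP/matrixP/existsNP[a /existsNP[b]]; rewrite [X in _ <> X]mxE => /eqP.
  by exists a, b.
exists (fun c d => riem_mx D j (coords j p) c d a0 b0 / Fp a0 b0) => c d.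
apply/matrixP => a b; rewrite [RHS]mxE -/Fp mulrAC.
suff /eqP : riem_mx D j (coords j p) c d a b * Fp a0 b0
    - riem_mx D j (coords j p) c d a0 b0 * Fp a b = 0.
  by rewrite subr_eq0 => /eqP <-; rewrite mulfK.
(* The line spanned by [Fp] is the common zero set of these forms, for a fixed nonzero entry
   [Fp a0 b0]; each is therefore a valid test on the curvature. *)
apply: (@holonomy_curvature R M g D gD p j c d (fun A => A a b * Fp a0 b0 - A a0 b0 * Fp a b) jp).
  by move=> k A A'; rewrite !mxE; ring.
by move=> A /holp[k ->]; rewrite !mxE; ring.
Qed.

End HolonomyAlgebra.

(** * First Bianchi identity *)

Section Bianchi.
Variables (R : realType) (M : manifold4 R) (D : connection M).

Lemma riem_mx_anti i x c d : riem_mx D i x c d = - riem_mx D i x d c.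
Proof. by rewrite !riem_mxE; apply/matrixP => a b; rewrite !mxE; ring. Qed.

Hypothesis tD : torsion_free D.

Lemma conn_basis_sym i x b c : cimg i x ->
  col c (conn_basis D i b x) = col b (conn_basis D i c x).
Proof. by move=> ix; apply/colP => a; rewrite !mxE tD. Qed.

Lemma partial_conn_sym i x b c d : cimg i x ->
  col c (partial_conn D i d b x) = col b (partial_conn D i d c x).
Proof.
move=> ix; apply/colP => a; rewrite !mxE; apply: near_eq_derive.
apply: filterS (open_nbhs_nbhs (conj (@open_cimg R M i) ix)) => y iy.
exact: tD.
Qed.

(** Symmetry of the coefficients identifies the derivative terms in pairs, and likewise the
    products; each pair has opposite signs. *)
Lemma riem_mx_bianchi i x b c d : cimg i x ->
  col b (riem_mx D i x c d) + col c (riem_mx D i x d b)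
  + col d (riem_mx D i x b c) = 0.
Proof.
move=> ix.
have cB (X Y Z W : 'M[R]_4) e :
    col e (X - Y + (Z - W)) = col e X - col e Y + (col e Z - col e W).
  by apply/colP => a; rewrite !mxE.
have cm (X Y : 'M[R]_4) e : col e (X *m Y) = X *m col e Y.
  by rewrite !colE mulmxA.
rewrite !riem_mxE !cB !cm (partial_conn_sym d b c ix) (partial_conn_sym c b d ix)
  (partial_conn_sym c d b ix) (conn_basis_sym d b ix) (conn_basis_sym c b ix)
  (conn_basis_sym d c ix).
move: (col _ (partial_conn _ _ _ _ _)) (col _ (partial_conn _ _ _ _ _))
  (col _ (partial_conn _ _ _ _ _)) => p1 p2 p3.
move: (_ *m _) (_ *m _) (_ *m _) => q1 q2 q3.
by apply/colP => a; rewrite !mxE; ring.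
Qed.

End Bianchi.

(** * Connection and curvature under a projective change *)

Section ProjectiveChange.
Variables (R : realType) (M : manifold4 R) (D D' : connection M).
Hypotheses (tD : torsion_free D) (tD' : torsion_free D').
Hypothesis proj : projectively_related D D'.

(** Putting all three indices equal in the projective relation gives twice the covector, hence the
    divisor 2. *)
Definition proj_form (i : chart M) (x : 'cV[R]_4) : 'rV[R]_4 :=
  \row_c ((D' i x c c c - D i x c c c) / 2).

Definition d_proj_form (i : chart M) (x : 'cV[R]_4) (c : 'I_4) : 'rV[R]_4 :=
  \row_b partial c (fun y => proj_form i y 0 b) x.

Lemma conn_basis_change i x b : cimg i x ->
  conn_basis D' i b x = conn_basis D i b x
    + ((proj_form i x 0 b)%:M + delta_mx b 0 *m proj_form i x).
Proof.
move=> ix.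
have := @parallel_quadratic R (fun b => conn_basis D' i b x - conn_basis D i b x).
move=> /(_ _)/wrap[]; first by move=> a b' c; rewrite !mxE tD// tD'.
move=> /(_ _)/wrap[].
  move=> v; have [k E] := projective_parallel proj v ix; exists k.
  rewrite -E !conn_mxE -mulmxBl -sumrB; congr (_ *m _).
  by apply: eq_bigr => c _; rewrite scalerBr.
move=> /(_ b) E; apply/eqP; rewrite addrC -subr_eq E; apply/eqP.
have -> : proj_form i x
    = \row_c ((conn_basis D' i c x - conn_basis D i c x) c c / 2).
  by apply/rowP => c; rewrite !mxE.
by rewrite [in RHS]mxE.
Qed.

Lemma is_derive_christoffel (D0 : connection M) i x a b c (d : 'I_4) :
  cimg i x -> is_derive x (basis_vec R d) (fun y => D0 i y a b c)
    (partial d (fun y => D0 i y a b c) x).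
Proof.
move=> ix; apply: derivableP.
by have [_ /(_ (basis_vec R d))[/(_ x ix)]] := christoffel_smooth D0 i a b c 1%N.
Qed.

Lemma is_derive_proj_form i x b c : cimg i x ->
  is_derive x (basis_vec R c) (fun y => proj_form i y 0 b) (d_proj_form i x c 0 b).
Proof.
move=> ix; rewrite mxE; apply: derivableP.
have H := is_derive_mulr (is_deriveB (is_derive_christoffel D' b b b c ix)
  (is_derive_christoffel D b b b c ix)) (is_derive_cst (2^-1 : R) x (basis_vec R c)).
have -> : (fun y => proj_form i y 0 b) =
    (fun y => ((fun y => D' i y b b b) - (fun y => D i y b b b)) y * cst 2^-1 y).
  by apply/funext => y; rewrite mxE.
by have [] := H.
Qed.

Lemma partial_conn_change i x c d : cimg i x ->
  partial_conn D' i c d x = partial_conn D i c d x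
    + ((d_proj_form i x c 0 d)%:M + delta_mx d 0 *m d_proj_form i x c).
Proof.
move=> ix; apply/matrixP => a b.
have H1 := is_derive_mulr (is_derive_cst ((a == b)%:R : R) x (basis_vec R c))
  (is_derive_proj_form d c ix).
have H2 := is_derive_mulr (is_derive_cst ((a == d)%:R : R) x (basis_vec R c))
  (is_derive_proj_form b c ix).
have H := is_deriveD (is_derive_christoffel D a d b c ix) (is_deriveD H1 H2).
rewrite [LHS]mxE /partial.
have E : \forall y \near x, ((fun y => D i y a d b) +
    ((fun y => cst (a == b)%:R y * proj_form i y 0 d) +
     (fun y => cst (a == d)%:R y * proj_form i y 0 b))) y = D' i y a d b.
  apply: filterS (open_nbhs_nbhs (conj (@open_cimg R M i) ix)) => y iy.
  rewrite -[LHS]/(D i y a d b + ((a == b)%:R * proj_form i y 0 d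
    + (a == d)%:R * proj_form i y 0 b)).
  have /matrixP/(_ a b) := conn_basis_change d iy.
  move: (proj_form i y) => f; rewrite !mxE big_ord1 !mxE eqxx andbT => ->.
  by rewrite -[f 0 d *+ _]mulr_natl.
have [_ ->] := near_eq_is_derive E H.
rewrite [RHS]mxE [X in _ = X + _]mxE; congr (_ + _).
move: (d_proj_form i x c) => f; rewrite !mxE big_ord1 !mxE eqxx andbT /cst.
by rewrite -[f 0 d *+ _]mulr_natl; ring.
Qed.

(** The row with index [c] of the tensor [nabla psi - psi psi], that is
    [nabla_c psi_b - psi_c psi_b]. *)
Definition proj_schouten i x c : 'rV[R]_4 :=
  d_proj_form i x c - proj_form i x *m conn_basis D i c x
  - proj_form i x 0 c *: proj_form i x.

(** In the commutator of the changed coefficients, freedom from torsion cancels the terms where one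
    coefficient acts on the other's basis vector; the rest regroups into [proj_schouten], and the
    scalar part is the curl of psi. *)
Lemma riem_mx_change i x c d : cimg i x ->
  riem_mx D' i x c d = riem_mx D i x c d
    + delta_mx d 0 *m proj_schouten i x c - delta_mx c 0 *m proj_schouten i x d
    + (d_proj_form i x c 0 d - d_proj_form i x d 0 c)%:M.
Proof.
move=> ix; rewrite !riem_mxE !partial_conn_change// !conn_basis_change//.
rewrite /proj_schouten; have := conn_basis_sym tD c d ix; rewrite !colE.
move: (partial_conn D i c d x) (partial_conn D i d c x) (d_proj_form i x c)
  (d_proj_form i x d) (conn_basis D i c x) (conn_basis D i d x)
  => Pcd Pdc fc fd A B.
set psi := proj_form i x; set e := delta_mx c 0; set f := delta_mx d 0 => AB.
have pe : psi *m e = (psi 0 c)%:M.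
  by rewrite -colE; apply/matrixP => a b; rewrite !mxE !ord1.
have pf : psi *m f = (psi 0 d)%:M.
  by rewrite -colE; apply/matrixP => a b; rewrite !mxE !ord1.
move: (psi 0 c) (psi 0 d) pe pf => s t pe pf.
have prod (X Y : 'M[R]_4) (u v : 'cV[R]_4) (p q : R) : psi *m v = q%:M ->
   (X + (p%:M + u *m psi)) *m (Y + (q%:M + v *m psi)) =
   X *m Y + q *: X + (X *m v) *m psi + p *: Y + (p * q)%:M + p *: (v *m psi)
   + u *m (psi *m Y) + q *: (u *m psi) + q *: (u *m psi).
  move=> pv; rewrite !mulmxDl !mulmxDr !mul_scalar_mx !mul_mx_scalar scale_scalar_mx.
  rewrite -[u *m psi *m Y]mulmxA [u *m psi *m (v *m psi)]mulmxA -[u *m psi *m v]mulmxA pv.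
  by rewrite mul_mx_scalar -scalemxAl mulmxA !addrA.
rewrite (prod A B e f s t pf) (prod B A f e t s pe) AB.
rewrite !mulmxBr -!scalemxAr.
move: (A *m B) (B *m A) (B *m e *m psi) (e *m (psi *m B)) (f *m (psi *m A))
  (e *m psi) (f *m psi) (f *m fc) (e *m fd) => a1 a2 a3 a4 a5 a6 a7 a8 a9.
apply/matrixP => a b; rewrite !mxE; case: (a == b); rewrite ?mulr1n ?mulr0n; ring.
Qed.

End ProjectiveChange.

(** * Vanishing of the covector where the curvature is nonzero *)

Section PointwiseVanishing.
Variables (R : realType) (M : manifold4 R) (g g' : lorentz_metric M).
Variables (D D' : connection M).
Hypotheses (hD : levi_civita g D) (hD' : levi_civita g' D').
Hypothesis proj : projectively_related D D'.
Variables (m : M) (i : chart M) (F : 'M[R]_4) (k : 'cV[R]_4).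
Hypothesis F_neq0 : F != 0.
Hypothesis F_skew : g i (coords i m) *m F + (g i (coords i m) *m F)^T = 0.
Hypotheses (k_neq0 : k != 0) (Fk0 : F *m k = 0).
Hypothesis holF : forall A, holonomy_algebra D m i A -> exists s : R, A = s *: F.

Let gD : metric_compatible g D := proj2 hD.
Let gD' : metric_compatible g' D' := proj2 hD'.
Let tD : torsion_free D := proj1 hD.
Let tD' : torsion_free D' := proj1 hD'.

(** [bianchi_kernel] places [B k] in the kernel of [H], and [generator_skew] then applies with
    [proj_schouten] as [Pi]. Allowing any transport [B] makes the result available at moving
    points. *)
Lemma generator_metric_skew p j B c0 d0 :
  transport D m i p j B -> riem_mx D j (coords j p) c0 d0 != 0 ->
  let A := g' j (coords j p) *m (B *m F *m invmx B) in A + A^T = 0.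
Proof.
move=> TB r0; cbv zeta.
have Bu := transport_unitmx gD TB; have [im jp _] := transport_metric gD TB.
have jx := cimg_coords jp; set x := coords j p in r0 jx *.
have [H HE] := riem_mx_generator gD F_neq0 holF TB.
set Fp := B *m F *m invmx B in HE *.
have FE : F = invmx B *m Fp *m B by rewrite /Fp !mulmxA mulVmx// mul1mx mulmxKV.
have Fp0 : Fp != 0.
  by apply: contraNneq F_neq0 => E; rewrite FE E mulmx0 mul0mx.
have H0 : H c0 d0 != 0.
  by apply: contraNneq r0 => E; rewrite HE E scale0r.
have Hanti c d : H c d = - H d c.
  have := riem_mx_anti D j x c d; rewrite !HE -scaleNr => /eqP.
  by rewrite -subr_eq0 -scalerBl scaler_eq0 (negbTE Fp0) orbF subr_eq0 => /eqP.
(* A factorisation of [Fp] would be carried back by [B] to one of [F], which is skew for the metric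
   at [m] and nonzero. *)
have rk (f : 'cV[R]_4) (h : 'rV[R]_4) : Fp <> f *m h.
  move=> E; move/eqP: F_neq0; apply.
  apply: (rank_one_skew (metric_unitmx g (cimg_coords im)) F_skew
    (f := invmx B *m f) (h := h *m B)).
  by rewrite FE E !mulmxA.
have Fkp : Fp *m (B *m k) = 0.
  by rewrite /Fp mulmxA mulmxKV// -mulmxA Fk0 mulmx0.
have kp0 : B *m k != 0.
  by apply: contraNneq k_neq0 => E; rewrite -(mulKmx Bu k) E mulmx0.
have cyc b c d : H c d *: col b Fp + H d b *: col c Fp + H b c *: col d Fp = 0.
  have := riem_mx_bianchi tD b c d jx; rewrite !HE.
  have cZ (s : R) e : col e (s *: Fp) = s *: col e Fp by apply/colP => a; rewrite !mxE.
  by rewrite !cZ.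
have kH := bianchi_kernel rk Fkp Hanti cyc.
apply: (generator_skew (H := H) (k := B *m k) (Pi := proj_schouten D D' j x)
  (metric_sym g' jx) (metric_unitmx g' jx) kp0 H0 kH) => c d; cbv zeta.
have := riem_mx_skew gD' c d jp; cbv zeta; rewrite -/x.
have E := riem_mx_change tD tD' proj c d jx.
have tr' : \tr (riem_mx D' j x c d) = 0.
  exact: (skew_trace0 (metric_sym g' jx) (metric_unitmx g' jx) (riem_mx_skew gD' c d jp)).
have tr0 : \tr (riem_mx D j x c d) = 0.
  exact: (skew_trace0 (metric_sym g jx) (metric_unitmx g jx) (riem_mx_skew gD c d jp)).
set w := d_proj_form D D' j x c 0 d - d_proj_form D D' j x d 0 c in E.
have trE (r : 'rV[R]_4) (e : 'I_4) : \tr (delta_mx e 0 *m r) = r 0 e.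
  by rewrite mxtrace_mulC -colE /mxtrace big_ord1 mxE.
(* Both curvatures are trace-free. The two [proj_schouten] terms contribute [w], their symmetric
   parts cancelling, and the scalar matrix contributes [4 w]; hence [5 w = 0]. *)
have w0 : w = 0.
  have := congr1 (@mxtrace R 4) E.
  rewrite linearD /= linearB /= linearD /= tr' tr0 !trE mxtrace_scalar add0r.
  rewrite /proj_schouten => e.
  have cs : (proj_form D D' j x *m conn_basis D j c x) 0 d
      = (proj_form D D' j x *m conn_basis D j d x) 0 c.
    rewrite !mxE; apply: eq_bigr => a _; congr (_ * _).
    by rewrite !mxE tD.
  move: e cs; rewrite /w.
  move: (_ *m conn_basis D j c x) (_ *m conn_basis D j d x) => q1 q2.
  move: (d_proj_form D D' j x c) (d_proj_form D D' j x d) (proj_form D D' j x)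
    => f1 f2 f.
  rewrite !mxE => e cs; lra.
by rewrite E w0 -scalemx1 scale0r addr0 HE.
Qed.

Lemma conn_basis_eq p j B a b c d :
  transport D m i p j B -> riem D j (coords j p) a b c d != 0 ->
  forall e, conn_basis D' j e (coords j p) = conn_basis D j e (coords j p).
Proof.
move=> TB r0.
have Bu := transport_unitmx gD TB; have [im jp _] := transport_metric gD TB.
have jx := cimg_coords jp; set x := coords j p in r0 jx *.
set Fp := B *m F *m invmx B.
have FE : F = invmx B *m Fp *m B by rewrite /Fp !mulmxA mulVmx// mul1mx mulmxKV.
have Fp0 : Fp != 0.
  by apply: contraNneq F_neq0 => E; rewrite FE E mulmx0 mul0mx.
have trF : \tr F = 0.
  exact: (skew_trace0 (metric_sym g (cimg_coords im)) (metric_unitmx g (cimg_coords im)) F_skew).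
have trFp : \tr Fp = 0 by rewrite /Fp mxtrace_mulC mulmxA mulVmx// mul1mx.
(* To be differentiated, the skewness must hold near the point and not only at it. *)
have near_nz : \forall y \near x, riem_mx D j y c d != 0.
  have := riem_mx_continuous (D := D) (c := c) (d := d) jx.
  move=> /continuous_mxP/(_ a b)/cvgrPdist_lt/(_ `|riem D j x a b c d|).
  rewrite normr_gt0 => /(_ r0); apply: filterS => y; rewrite !mxE => Hy.
  apply: contraTneq Hy => E; rewrite -leNgt.
  have -> : riem D j y a b c d = 0.
    by have /matrixP/(_ a b) := E; rewrite !mxE.
  by rewrite subr0.
have r0' : riem_mx D j x c d != 0.
  by apply: contraNneq r0 => /matrixP/(_ a b); rewrite !mxE => ->.
have skew0 := generator_metric_skew TB r0'; cbv zeta in skew0; rewrite -/Fp -/x in skew0.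
set G := g' j x in skew0.
suff psi0 : proj_form D D' j x = 0.
  move=> e; rewrite (conn_basis_change tD tD' proj e jx) psi0 mulmx0 addr0.
  by rewrite mxE -scalemx1 scale0r addr0.
apply: (covector_zero trFp Fp0) => z; set psi := proj_form D D' j x.
have key e : (psi *m z) 0 0 * (G *m (Fp *m z)) e 0 + (psi *m Fp *m z) 0 0 * (G *m z) e 0 = 0.
  have [r1 [C [r10 Hr]]] := conn_locally_bounded D jx.
  have [r2 /= r20 Hr2] := (nbhs_normP _ _).1 near_nz.
  pose r := Num.min r1 r2 / 2.
  have rlt : 0 < r by rewrite divr_gt0// lt_min r10.
  have rr1 : r < r1 by rewrite /r; case: (leP r1 r2) => h; lra.
  have rr2 : r < r2 by rewrite /r; case: (leP r1 r2) => h; lra.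
  pose v : 'cV[R]_4 := delta_mx e 0.
  have tv t : `|t| <= r -> `|(t *: v + x) - x| <= r.
    move=> tr; rewrite addrK normrZ -[leRHS]mulr1 ler_pM// delta_mx_norm_le//.
  have cv t : `|t| <= r -> cimg j (t *: v + x).
    by move=> /tv h; have [] := Hr _ (le_lt_trans h rr1).
  have [|X [X0 dX]] := @line_frame R M D j x v r C rlt cv.
    move=> t /tv h; rewrite conn_mx_basis.
    by have [_] := Hr _ (le_lt_trans h rr1).
  (* The generator at the moving point is [X t *m Fp *m invmx (X t)]. Read in the frame [X t] it is
     the constant [Fp], so only the metric factor varies. *)
  have skewt t : `|t| < r ->
      (X t)^T *m g' j (t *: v + x) *m X t *m Fp
      + ((X t)^T *m g' j (t *: v + x) *m X t *m Fp)^T = 0.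
    move=> tr; have TX := line_transport cv X0 dX tr.
    rewrite coordsK// in TX.
    have Xu := transport_unitmx gD TX.
    have TXB := transport_comp TB TX.
    have ct := cv t (ltW tr).
    have rt : riem_mx D j (coords j (param j (t *: v + x))) c d != 0.
      rewrite paramK//; apply: Hr2; rewrite /= distrC.
      exact: le_lt_trans (tv t (ltW tr)) rr2.
    have := generator_metric_skew TXB rt; cbv zeta; rewrite paramK//.
    have -> : X t *m B *m F *m invmx (X t *m B) = X t *m Fp *m invmx (X t).
      rewrite /Fp -!mulmxA; congr (_ *m (_ *m (_ *m _))).
      apply/esym/left_inverse_unique.
      by rewrite mulmxA -[invmx B *m _ *m _]mulmxA mulVmx// mulmx1 mulVmx.
    move: (g' j _) => Gt E.
    have := congr1 (fun Y => (X t)^T *m Y *m X t) E.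
    have tE (A : 'M[R]_4) : (X t)^T *m A^T *m X t = ((X t)^T *m A *m X t)^T.
      by rewrite !trmx_mul trmxK mulmxA.
    rewrite mulmxDr mulmxDl mulmx0 mul0mx tE.
    by rewrite !mulmxA mulmxKV.
  have Hu := is_derive_line_id x v (0 : R).
  have n0 : `|0 : R| <= r by rewrite normr0 ltW.
  have dG := is_derive_metric_frame gD' (cv 0 n0) Hu (dX 0 n0).
  have dGF := is_derive_mulmx dG (is_derive_cst Fp (0 : R) (1 : R)).
  have dS := is_deriveD dGF (is_derive_trmx dGF).
  have E : \forall t \near (0 : R), ((fun t => (X t)^T *m g' j (t *: v + x) *m X t *m cst Fp t)
      + (fun t => ((X t)^T *m g' j (t *: v + x) *m X t *m cst Fp t)^T)) t = cst 0 t.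
    apply/nbhs_normP; exists r => //= t; rewrite /= sub0r normrN; exact: skewt.
  have [_ dS0] := near_eq_is_derive E dS; rewrite derive_cst in dS0.
  rewrite X0 trmx1 mul1mx !mulmx1 mulmx0 addr0 scale0r add0r !conn_mx_basis in dS0.
  rewrite (conn_basis_change tD tD' proj e jx) [conn_basis _ _ _ _ + _]addrC addrK in dS0.
  rewrite -/G -/psi in dS0.
  have form := form_of_skew z (esym dS0).
  have s0 := form_of_skew z skew0.
  have Gs : G^T = G by exact: metric_sym.
  move: form.
  (* The first term on the right is a multiple of the form of [G Fp], which vanishes by skewness at
     the point itself; the other two make up [key]. *)
  have -> : z^T *m ((((psi 0 e)%:M + delta_mx e 0 *m psi)^T *m G
      + G *m ((psi 0 e)%:M + delta_mx e 0 *m psi)) *m Fp) *m z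
    = (psi 0 e *+ 2) *: (z^T *m (G *m Fp) *m z)
      + (psi *m z)^T *m ((delta_mx e 0)^T *m (G *m (Fp *m z)))
      + (z^T *m G *m delta_mx e 0) *m (psi *m Fp *m z).
    have -> : ((psi 0 e)%:M + delta_mx e 0 *m psi)^T
        = (psi 0 e)%:M + psi^T *m (delta_mx e 0)^T.
      by rewrite [LHS]linearD /= tr_scalar_mx trmx_mul.
    move: (psi 0 e) (delta_mx e 0 : 'cV[R]_4) => s E'.
    rewrite trmx_mul !mulmxDl !mulmxDr mul_scalar_mx mul_mx_scalar !mulmxDl -!scalemxAl.
    rewrite !mulmxDr -!scalemxAr !mulmxDl -!scalemxAl !mulmxA.
    rewrite mulr2n scalerDl -!addrA; congr (_ + _).
    by rewrite [X in _ = X]addrCA.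
  have -> : z^T *m G *m delta_mx e 0 = ((G *m z) e 0)%:M.
    rewrite -{1}Gs -trmx_mul -colE; move: (G *m z) => y.
    by apply/matrixP => q1 q2; rewrite !ord1 !mxE eqxx mulr1n.
  rewrite trmx_delta -rowE mul_scalar_mx.
  move: (z^T *m (G *m Fp) *m z) s0 => q0 s0.
  move: (psi *m z) (psi *m Fp *m z) (G *m (Fp *m z)) (G *m z) => q1 q2 q3 q4.
  by rewrite !mxE big_ord1 !mxE s0 => <-; ring.
have Gu : G \in unitmx by exact: metric_unitmx.
have GV : G *m ((psi *m z) 0 0 *: (Fp *m z) + (psi *m Fp *m z) 0 0 *: z) = 0.
  apply/colP => e; have := key e; rewrite mulmxDr -!scalemxAr.
  move: ((psi *m z) 0 0) ((psi *m Fp *m z) 0 0) (G *m (Fp *m z)) (G *m z) => q1 q2 q3 q4.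
  by rewrite !mxE.
by rewrite -[LHS](mulKmx Gu) GV mulmx0.
Qed.

End PointwiseVanishing.

(** * Generators of the three holonomy types *)

Section HolonomyGenerator.
Variable R : realType.
Implicit Types (G : 'M[R]_4) (p q w : 'cV[R]_4).

Lemma inner_sym G p q : G^T = G -> inner G p q = inner G q p.
Proof. by move=> Gs; rewrite /inner trmx11 !trmx_mul Gs trmxK mulmxA. Qed.

Lemma wedge_mx_mul G p q w :
  wedge_mx G p q *m w = inner G q w *: p - inner G p w *: q.
Proof.
have E (u v z : 'cV[R]_4) : u *m v^T *m G *m z = inner G v z *: u.
  rewrite -!mulmxA !mulmxA -[u *m _ *m _]mulmxA -[u *m _ *m _]mulmxA.
  by rewrite [X in u *m X]mx11_scalar mul_mx_scalar.
by rewrite /wedge_mx !mulmxBl !E.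
Qed.

Lemma wedge_mx_skew G p q : G^T = G ->
  G *m wedge_mx G p q + (G *m wedge_mx G p q)^T = 0.
Proof.
move=> Gs; rewrite /wedge_mx !trmx_mul Gs.
have -> : (p *m q^T - q *m p^T)^T = - (p *m q^T - q *m p^T).
  by rewrite [LHS]linearB /= !trmx_mul !trmxK opprB.
by rewrite mulmxN mulNmx mulmxA subrr.
Qed.

Lemma holonomy_generator_skew T G l n x y : G^T = G ->
  let F := holonomy_generator T G l n x y in G *m F + (G *m F)^T = 0.
Proof. by case: T => Gs; exact: wedge_mx_skew. Qed.

(** By the tetrad relations, the bivector of [l] and [n] kills [x] and maps [l] to [l]; that of [l]
    and [x] kills [l] and maps [x] to [l]; that of [x] and [y] kills [l] and maps [x] to [- y]. *)
Lemma holonomy_generator_kernel T G l n x y : G^T = G -> null_tetrad G l n x y ->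
  holonomy_generator T G l n x y != 0 /\
  exists2 k : 'cV[R]_4, k != 0 & holonomy_generator T G l n x y *m k = 0.
Proof.
move=> Gs [_ [ln xx yy] [ll nn xy] [lx ly nx ny]].
have inner0 p : inner G p 0 = 0 by rewrite /inner mulmx0 mxE.
have neq0 p q : inner G p q = 1 -> q != 0.
  by move=> pq; apply/eqP => q0; have := @oner_neq0 R; rewrite -pq q0 inner0 eqxx.
have l0 : l != 0 by apply: (neq0 n); rewrite inner_sym.
have x0 := neq0 _ _ xx; have y0 := neq0 _ _ yy.
have mul0 (A : 'M[R]_4) (w : 'cV[R]_4) : A *m w != 0 -> A != 0.
  by apply: contraNneq => ->; rewrite mul0mx.
case: T; split=> /=.
- apply: (mul0 _ l); rewrite wedge_mx_mul ll (inner_sym n l Gs) ln.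
  by rewrite scale1r scale0r subr0.
- by exists x => //; rewrite wedge_mx_mul nx lx !scale0r subr0.
- apply: (mul0 _ x); rewrite wedge_mx_mul xx lx.
  by rewrite scale1r scale0r subr0.
- by exists l => //; rewrite wedge_mx_mul (inner_sym x l Gs) lx ll !scale0r subr0.
- apply: (mul0 _ x); rewrite wedge_mx_mul xx (inner_sym y x Gs) xy.
  by rewrite scale1r scale0r sub0r oppr_eq0.
exists l => //; rewrite wedge_mx_mul (inner_sym y l Gs) (inner_sym x l Gs) lx ly.
by rewrite !scale0r subr0.
Qed.

End HolonomyGenerator.

(** The inhomogeneous term of the transformation law is common to both connections, and the Jacobian
    is invertible. The chart where the curvature is found nonzero may differ from the one where
    coefficients are compared. *)
Lemma christoffel_eq_transfer (R : realType) (M : manifold4 R)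
    (g : lorentz_metric M) (D D' : connection M) (i j : chart M) p :
  metric_compatible g D -> cdom i p -> cdom j p ->
  (forall a b c, D j (coords j p) a b c = D' j (coords j p) a b c) ->
  forall a b c, D i (coords i p) a b c = D' i (coords i p) a b c.
Proof.
move=> gD ip jp E a b c.
set J := jac (transition i j) (coords i p).
have Ju : J \in unitmx by exact: (jac_transition_unitmx gD).
pose v (D0 : connection M) : 'cV[R]_4 := \col_d D0 i (coords i p) d b c.
have JE (D0 : connection M) : J *m v D0 = \col_a (
    (partial b (partial c (transition i j)) (coords i p)) a 0
    + \sum_d \sum_e D0 j (coords j p) a d e * J d b * J e c).
  apply/colP => a'; rewrite [RHS]mxE (christoffel_transform D0 a' b c ip jp).
  by rewrite [LHS]mxE; apply: eq_bigr => d _; congr (_ * _); rewrite mxE.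
have : v D = v D'.
  rewrite -(mulKmx Ju (v D)) -(mulKmx Ju (v D')) !JE; congr (_ *m _).
  apply/colP => a'; rewrite !mxE; congr (_ + _).
  by apply: eq_bigr => d _; apply: eq_bigr => e _; rewrite E.
by move=> /colP/(_ a); rewrite !mxE.
Qed.

Theorem theorem6p1 (R : realType) (M : manifold4 R) (g g' : lorentz_metric M)
  (D D' : connection M) (T : holonomy_type)
  (hM : spacetime_manifold M)
  (hD : levi_civita g D) (hD' : levi_civita g' D')
  (hflat : non_flat D)
  (hT : of_holonomy_type g D T)
  (hproj : projectively_related D D') :
  same_connection D D'.
Proof.
have [_ conM] := hM; have [_ gD] := hD.
have [m [i [l [n [x [y [im tet hol]]]]]]] := hT.
set F := holonomy_generator T (g i (coords i m)) l n x y in hol.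
have Gs := metric_sym g (cimg_coords im).
have [F0 [k k0 Fk]] := holonomy_generator_kernel T Gs tet.
have Fs := holonomy_generator_skew T l n x y Gs.
have holF A : holonomy_algebra D m i A -> exists s : R, A = s *: F.
  by rewrite hol => -[s _ <-]; exists s.
move=> j z jz a b c; apply/eqP/negP => /negP neq.
pose f (D0 : connection M) p := D0 j (coords j p) a b c.
(* If one coefficient differs at one point, it differs on this open set. Non-flatness yields in it a
   point of nonzero curvature, where the connections agree, a contradiction. *)
pose O : set M := [set p | cdom j p /\ f D p != f D' p].
have fc D0 p : cdom j p -> {for p, continuous (f D0)}.
  move=> jp; apply: (@continuous_comp _ _ _ (coords j) (fun x => D0 j x a b c)).
    exact: coords_continuous.
  by have [/(_ _ (cimg_coords jp))] := christoffel_smooth D0 j a b c 0%N.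
have Oop : open O.
  rewrite openE => p [jp fp].
  have N1 : nbhs p (cdom j) by apply: open_nbhs_nbhs; split=> //; exact: cdom_open.
  have fB : {for p, continuous (fun q => f D q - f D' q)}.
    exact: (continuousB (fc D p jp) (fc D' p jp)).
  have N2 : \forall q \near p, f D q - f D' q != 0.
    move: fB => /cvgrPdist_lt/(_ `|f D p - f D' p|).
    rewrite normr_gt0 subr_eq0 => /(_ fp); apply: filterS => q.
    by move=> Hq; apply: contraTneq Hq => ->; rewrite subr0 ltxx.
  by apply: filterS2 N1 N2 => q jq; rewrite subr_eq0.
have Oz : O (param j z) by split; [exact: cdom_param|rewrite /f paramK].
have [p [h [a' [b' [c' [d' [[jp fp] hp r0]]]]]]] := hflat O Oop (ex_intro _ _ Oz).
(* The holonomy algebra is given at [m] alone; connectedness supplies a transport of its generator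
   to the point found. *)
have [B TB] := transport_exists gD conM im hp.
have E := conn_basis_eq hD hD' hproj F0 Fs k0 Fk holF TB r0.
move/negP: fp; apply; apply/eqP.
apply: (christoffel_eq_transfer gD jp hp) => a0 b0 c0.
by have /matrixP/(_ a0 c0) := E b0; rewrite !mxE.
Qed.
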